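(* Let $(M^n,g)$ be a Riemannian manifold, $n\ge3$, with $\mathrm{Ric}(g)=\lambda(n-1)g$ for a constant $\lambda$, and let $\Sigma^k\subset M$, $1\le k\le n-1$, be a minimal submanifold of $(M,g)$. Let $$g_+=r^{-2}\big(dr^2+(1-\tfrac14\lambda r^2)^2g\big)$$ on $M\times(0,\epsilon_0)_r$ be the canonical Poincaré metric, and let $Y=\Sigma\times[0,\epsilon_0)$ be the canonical minimal extension of $\Sigma$. Denote by $h$ the metric on $\Sigma$ induced by $g$ and by $h_+$ the metric on $\mathring Y=\Sigma\times(0,\epsilon_0)$ induced by $g_+$. Let $\ell\in\mathbb N$. The operators produced by the GJMS construction for $(\mathring Y,h_+)$ (with respect to the representative $h$) are $$P_{2\ell}=\prod_{j=1}^{\ell}(-\Delta_h+\lambda c_j),\qquad c_j=\big(\tfrac k2+j-1\big)\big(\tfrac k2-j\big).$$ If $k$ is even, then the associated critical $Q$-curvature is $Q_k=\lambda^{k/2}(k-1)!$.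
   Context: Here $\epsilon_0>0$ is small (in particular $1-\frac14\lambda r^2>0$ on $[0,\epsilon_0)$). Laplacians have the sign $\Delta=\sum\partial_i^2$ on Euclidean space; $\mathbb N=\{1,2,\dots\}$; submanifolds are embedded. **GJMS construction.** Let $Y^{k+1}$ be a manifold with boundary $\Sigma^k$, $h_+$ an asymptotically hyperbolic metric on $\mathring Y$ (for a defining function $r$ of $\Sigma$, $r^2h_+$ extends to a smooth metric on $Y$ with $|dr|^2_{r^2h_+}=1$ on $\Sigma$), $h$ a representative of its conformal infinity, and $r$ a defining function with $r^2h_+|_{T\Sigma}=h$. Let $\ell\in\mathbb N$. Given $f\in C^\infty(\Sigma)$ there is $F\in C^\infty(Y)$, unique modulo $O(r^{2\ell})$, with $F|_\Sigma=f$ and such that $u:=r^{k/2-\ell}F$ satisfies $(\Delta_{h_+}+((k/2)^2-\ell^2))u=O(r^{k/2+\ell})$. The function $\big(r^{-k/2-\ell}(\Delta_{h_+}+((k/2)^2-\ell^2))u\big)\big|_\Sigma$ is independent of the remaining choices and is written $a_\ell P_{2\ell}f$ with $a_\ell^{-1}=(-1)^\ell2^{2(\ell-1)}((\ell-1)!)^2$. This defines the differential operator $P_{2\ell}$ on $\Sigma$. **$Q$-curvature.** For $2\ell\ne k$, $Q_{2\ell}$ is defined by $P_{2\ell}1=(k/2-\ell)Q_{2\ell}$. For $k$ even, the critical $Q$-curvature $Q_k$ is defined by analytic continuation of this relation in $k$; equivalently, there is $A\in C^\infty(Y)$ with $A|_\Sigma=0$, unique modulo $O(r^k)$, such that $\Delta_{h_+}(\log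 r+A)+k=O(r^k)$, and $\big(r^{-k}(\Delta_{h_+}(\log r+A)+k)\big)\big|_\Sigma=a_{k/2}Q_k$. *)

(* Defs.v *)
From HB Require Import structures.
From mathcomp Require Import all_boot all_order all_algebra.
From mathcomp Require Import all_classical all_reals all_analysis.
Import Order.TTheory GRing.Theory Num.Theory.
Import numFieldNormedType.Exports.
Set Implicit Arguments.
Unset Strict Implicit.
Unset Printing Implicit Defensive.
Local Open Scope classical_set_scope.
Local Open Scope ring_scope.

Definition partial {R : realType} {n} (i : 'I_n) (f : 'rV[R]_n -> R) :
  'rV[R]_n -> R := fun x => 'D_(delta_mx 0 i) f x.

Definition iter_partial {R : realType} {n} (s : seq 'I_n) (f : 'rV[R]_n -> R) :=
  foldr partial f s.

Definition smooth_on {R : realType} {n} (U : set 'rV[R]_n) (f : 'rV[R]_n -> R) :=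
  forall s x, U x -> differentiable (iter_partial s f) x.

Definition smooth_map_on {R : realType} {m n} (U : set 'rV[R]_m)
  (f : 'rV[R]_m -> 'rV[R]_n) := forall j, smooth_on U (fun x => f x 0 j).

(* smoothness on a set that need not be open, such as a half-space: local
   smooth extension *)
Definition smooth_ext_on {R : realType} {n} (A : set 'rV[R]_n)
    (f : 'rV[R]_n -> R) :=
  forall x, A x -> exists U (g : 'rV[R]_n -> R),
    [/\ open U, U x, smooth_on U g & forall y, U y -> A y -> f y = g y].

Lemma near_eq_differentiable {R : realType} {V W : normedModType R}
    (f g : V -> W) x :
  (\near x, f x = g x) -> differentiable f x -> differentiable g x.
Proof.
move=> fg df.
have dg : g \o shift x = cst (g x) + 'd f x +o_ 0 id.
  apply/eqaddoP => d d0.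
  have /eqaddoP /(_ d d0) fd := diff_locally df.
  have fg0 : \forall h \near (0 : V), f (h + x) = g (h + x).
    have := fg; rewrite (near_shift 0) subr0; exact.
  near=> h.
  have fgh : f (h + x) = g (h + x) by near: h.
  have -> : (g \o shift x - (cst (g x) + 'd f x)) h =
            (f \o shift x - (cst (f x) + 'd f x)) h.
    by rewrite /cst !fctE /= fgh (nbhs_singleton fg).
  by near: h; exact: fd.
apply/diff_locallyP.
have dfc : continuous ('d f x) by exact: diff_continuous.
by rewrite (diff_unique dfc dg).
Unshelve. all: by end_near. Qed.

Lemma smooth_on_eq {R : realType} {n} (U : set 'rV[R]_n) (f g : 'rV[R]_n -> R) :
  open U -> (forall x, U x -> f x = g x) -> smooth_on U f -> smooth_on U g.
Proof.
move=> oU fg sf s x Ux.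
have nU z : U z -> \forall y \near z, U y by move=> Uz; exact: open_nbhs_nbhs.
have fgs z : U z -> iter_partial s f z = iter_partial s g z.
  elim: s {x Ux sf} z => [|i s IH] z Uz /=; first exact: fg.
  by apply: near_eq_derive; apply: filterS (nU z Uz) => y; exact: IH.
apply: near_eq_differentiable (sf s x Ux).
by apply: filterS (nU x Ux) => y; exact: fgs.
Qed.

Section Coordinates.
Context {R : realType} {n : nat}.
Implicit Types (G : 'rV[R]_n -> 'M[R]_n) (f : 'rV[R]_n -> R).

(* [christoffel G l i j] is Gamma^l_ij *)
Definition christoffel G (l i j : 'I_n) (x : 'rV[R]_n) : R :=
  2^-1 * \sum_m invmx (G x) l m *
    (partial i (fun y => G y j m) x + partial j (fun y => G y i m) x
     - partial m (fun y => G y i j) x).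

Definition ricci G (x : 'rV[R]_n) : 'M[R]_n := \matrix_(i, j)
  (\sum_l (partial l (christoffel G l i j) x - partial j (christoffel G l i l) x)
   + \sum_l \sum_m (christoffel G l l m x * christoffel G m i j x
                    - christoffel G l j m x * christoffel G m i l x)).

Definition hessian G f (x : 'rV[R]_n) : 'M[R]_n := \matrix_(i, j)
  (partial i (partial j f) x - \sum_l christoffel G l i j x * partial l f x).

Definition coord_laplacian G f (x : 'rV[R]_n) : R :=
  \sum_i \sum_j invmx (G x) i j * hessian G f x i j.

End Coordinates.

Section CoordinateSubmanifold.
Context {R : realType} {k n : nat}.
Variables (G : 'rV[R]_n -> 'M[R]_n) (y : 'rV[R]_k -> 'rV[R]_n).

Definition pullback (x : 'rV[R]_k) : 'M[R]_k :=
  jacobian y x *m G (y x) *m (jacobian y x)^T.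

(* the covariant derivative along [y] of d_b y in the direction a *)
Definition acceleration (a b : 'I_k) (x : 'rV[R]_k) : 'rV[R]_n := \row_i
  (partial a (partial b (fun z => y z 0 i)) x
   + \sum_j \sum_l christoffel G i j l (y x)
       * partial a (fun z => y z 0 j) x * partial b (fun z => y z 0 l) x).

(* the rows of [jacobian y x] span the tangent space, and the subtracted term
   is the G-orthogonal projection of [v] onto it *)
Definition normal_part (x : 'rV[R]_k) (v : 'rV[R]_n) : 'rV[R]_n :=
  v - v *m G (y x) *m (jacobian y x)^T *m invmx (pullback x) *m jacobian y x.

Definition second_fundamental_form (a b : 'I_k) (x : 'rV[R]_k) :=
  normal_part x (acceleration a b x).

Definition mean_curvature (x : 'rV[R]_k) : 'rV[R]_n :=
  \sum_a \sum_b invmx (pullback x) a b *: second_fundamental_form a b x.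

End CoordinateSubmanifold.

(* The values of [cinv] outside the image of the chart are irrelevant. *)
Record chart (R : realType) (n : nat) (M : topologicalType) := Chart {
  cdom : set M;
  cmap : M -> 'rV[R]_n;
  cinv : 'rV[R]_n -> M;
  cdom_open : open cdom;
  cimg_open : open (cmap @` cdom);
  cmapK : forall p, cdom p -> cinv (cmap p) = p;
  cmap_continuous : forall p, cdom p -> {for p, continuous cmap};
  cinv_continuous : forall p, cdom p -> {for cmap p, continuous cinv} }.

Definition cimg {R : realType} {n} {M : topologicalType} (phi : chart R n M) :
  set 'rV[R]_n := cmap phi @` cdom phi.

Lemma open_chart_image {R : realType} {n} {M : topologicalType}
    (phi : chart R n M) (A : set M) :
  open A -> open (cmap phi @` (cdom phi `&` A)).
Proof.
move=> oA; rewrite openE => _ [p [dp Ap] <-].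
have n1 : nbhs (cmap phi p) (cimg phi).
  by apply: open_nbhs_nbhs; split; [exact: cimg_open|exists p].
have n2 : nbhs (cmap phi p) (cinv phi @^-1` A).
  apply: cinv_continuous => //; rewrite cmapK//.
  exact: open_nbhs_nbhs.
apply: filterS2 n1 n2 => _ [q dq <-] /=; rewrite cmapK// => Aq.
by exists q.
Qed.

(* A smooth atlas on a topological space; Hausdorff and second countable are
   added in [is_manifold]. *)
Record smooth_space (R : realType) (n : nat) := SmoothSpace {
  carrier :> topologicalType;
  atlas : set (chart R n carrier);
  atlas_cover : forall p, exists2 phi, atlas phi & cdom phi p;
  atlas_compat : forall phi psi, atlas phi -> atlas psi ->
    smooth_map_on (cmap phi @` (cdom phi `&` cdom psi))
                  (cmap psi \o cinv phi) }.

Definition is_manifold {R : realType} {n} (M : smooth_space R n) :=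
  hausdorff_space M /\ @second_countable M.

Definition chart_at {R : realType} {n} (M : smooth_space R n) (p : M) :
  chart R n M := s2val (cid2 (atlas_cover p)).

Definition smooth_fun {R : realType} {n} (M : smooth_space R n) (f : M -> R) :=
  forall phi, atlas phi -> smooth_on (cimg phi) (f \o cinv phi).

Definition coord_map {R : realType} {k n} {S : smooth_space R k}
    {M : smooth_space R n} (phi : chart R k S) (psi : chart R n M)
    (i : S -> M) : 'rV[R]_k -> 'rV[R]_n :=
  cmap psi \o i \o cinv phi.

Definition smooth_map {R : realType} {k n} {S : smooth_space R k}
    {M : smooth_space R n} (i : S -> M) :=
  continuous i /\ forall phi psi, atlas phi -> atlas psi ->
    smooth_map_on (cmap phi @` (cdom phi `&` i @^-1` cdom psi))
                  (coord_map phi psi i).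

Definition smooth_embedding {R : realType} {k n} {S : smooth_space R k}
    {M : smooth_space R n} (i : S -> M) :=
  [/\ smooth_map i,
      forall phi psi p, atlas phi -> atlas psi -> cdom phi p -> cdom psi (i p) ->
        \rank (jacobian (coord_map phi psi i) (cmap phi p)) = k,
      injective i &
      forall U, open U -> exists2 V, open V & U = i @^-1` V].

(* Component matrices in the charts of the atlas, as functions of the
   coordinates; values outside [cimg phi] are irrelevant. *)
Record riem_metric (R : realType) (n : nat) (M : smooth_space R n) := Metric {
  components :> chart R n M -> 'rV[R]_n -> 'M[R]_n;
  metric_smooth : forall phi, atlas phi -> forall i j,
    smooth_on (cimg phi) (fun x => components phi x i j);
  metric_sym : forall phi x, atlas phi -> cimg phi x ->
    (components phi x)^T = components phi x;
  metric_pos : forall phi x, atlas phi -> cimg phi x ->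
    forall v : 'rV[R]_n, v != 0 -> 0 < (v *m components phi x *m v^T) 0 0;
  metric_transform : forall phi psi p, atlas phi -> atlas psi ->
    cdom phi p -> cdom psi p ->
    components phi (cmap phi p) =
      pullback (components psi) (cmap psi \o cinv phi) (cmap phi p) }.

(* trace of the Hessian, in a chosen chart at p; the value does not depend on
   the chart *)
Definition laplacian {R : realType} {n} {M : smooth_space R n} (g : riem_metric M)
    (f : M -> R) (p : M) : R :=
  let phi := chart_at p in
  coord_laplacian (g phi) (f \o cinv phi) (cmap phi p).

Definition is_einstein {R : realType} {n} {M : smooth_space R n} (g : riem_metric M)
    (lambda : R) :=
  forall phi x, atlas phi -> cimg phi x ->
    ricci (g phi) x = (lambda * (n%:R - 1)) *: g phi x.

Definition is_induced_metric {R : realType} {k n} {S : smooth_space R k}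
    {M : smooth_space R n} (i : S -> M) (g : riem_metric M) (h : riem_metric S) :=
  forall phi psi p, atlas phi -> atlas psi -> cdom phi p -> cdom psi (i p) ->
    h phi (cmap phi p) = pullback (g psi) (coord_map phi psi i) (cmap phi p).

Definition is_minimal {R : realType} {k n} {S : smooth_space R k}
    {M : smooth_space R n} (i : S -> M) (g : riem_metric M) :=
  forall phi psi p, atlas phi -> atlas psi -> cdom phi p -> cdom psi (i p) ->
    mean_curvature (g psi) (coord_map phi psi i) (cmap phi p) = 0.

Section Cylinder.
Context {R : realType} {n : nat} (M : smooth_space R n) (e : {posnum R}).

Definition itv0 : set R := [set r | 0 < r < e%:num].

Lemma mid_itv0 : (e%:num / 2) \in itv0.
Proof.
by rewrite inE /itv0 /= divr_gt0//= ltr_pdivrMr// ltr_pMr// ltr1n.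
Qed.

Definition to_itv0 (r : R) : set_type itv0 :=
  insubd (exist _ (e%:num / 2) mid_itv0 : set_type itv0) r.

Lemma to_itv0K (r : set_type itv0) : to_itv0 (\val r) = r.
Proof. by rewrite /to_itv0 valKd. Qed.

Lemma val_to_itv0 r : itv0 r -> \val (to_itv0 r) = r.
Proof. by move=> re; rewrite /to_itv0 insubdK// inE. Qed.

Definition cylinder : topologicalType := (M * set_type itv0)%type.

Section CylinderChart.
Variable phi : chart R n M.

Definition cyl_dom : set cylinder := [set q | cdom phi q.1].

Definition cyl_map (q : cylinder) : 'rV[R]_(n + 1) :=
  row_mx (cmap phi q.1) (\val q.2)%:M.

Definition cyl_inv (z : 'rV[R]_(n + 1)) : cylinder :=
  (cinv phi (lsubmx z), to_itv0 (rsubmx z 0 0)).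

Lemma cyl_mapK q : cyl_dom q -> cyl_inv (cyl_map q) = q.
Proof.
case: q => p r /= dp; rewrite /cyl_inv /cyl_map row_mxKl row_mxKr cmapK//.
by rewrite mxE eqxx mulr1n to_itv0K.
Qed.

Lemma cyl_imgE : cyl_map @` cyl_dom =
  [set z | cimg phi (lsubmx z) /\ itv0 (rsubmx z 0 0)].
Proof.
apply/seteqP; split => [_ [[p r] /= dp <-]|z [[p dp pz] rz]] /=.
  rewrite /cyl_map row_mxKl row_mxKr mxE eqxx mulr1n; split; first by exists p.
  exact: set_mem (valP r).
exists (p, to_itv0 (rsubmx z 0 0)) => //.
rewrite /cyl_map /= pz val_to_itv0// -[RHS]hsubmxK; congr row_mx.
by apply/matrixP => i j; rewrite !ord1 !mxE eqxx mulr1n.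
Qed.

Lemma cyl_dom_open : open cyl_dom.
Proof.
apply: (open_comp (f := fst : cylinder -> M)); last exact: cdom_open.
by move=> q _; exact: cvg_fst.
Qed.

Lemma rcoord_continuous : continuous (fun z : 'rV[R]_(n + 1) => rsubmx z 0 0).
Proof.
move=> z; apply: (@continuous_comp _ _ _ (rsubmx : 'rV[R]_(n + 1) -> 'rV[R]_1)
  (fun w : 'rV[R]_1 => w 0 0)); first exact: continuous_rsubmx.
exact: coord_continuous.
Qed.

Lemma cyl_img_open : open (cyl_map @` cyl_dom).
Proof.
rewrite cyl_imgE; apply: openI.
  apply: (open_comp (f := lsubmx : 'rV[R]_(n + 1) -> 'rV[R]_n)).
    by move=> z _; exact: continuous_lsubmx.
  exact: cimg_open.
apply: (open_comp (f := fun z : 'rV[R]_(n + 1) => rsubmx z 0 0)).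
  by move=> z _; exact: rcoord_continuous.
have -> : itv0 = `]0, e%:num[%classic.
  by apply/seteqP; split => x /=; rewrite in_itv.
exact: interval_open.
Qed.

Lemma cyl_map_continuous q : cyl_dom q -> {for q, continuous cyl_map}.
Proof.
case: q => p r /= dp A [B nB BA].
have [B1 nB1 B1B] : exists2 B1, nbhs (cmap phi p) B1 &
    forall x t, B1 x -> B 0 (rshift n 0) t -> A (row_mx x t%:M).
  exists [set x | forall j, B 0 (lshift 1 j) (x 0 j)].
    exists (fun _ j => B 0 (lshift 1 j)); last by move=> x /= Bx j; exact: Bx.
    by move=> i j; rewrite ord1; have := nB 0 (lshift 1 j); rewrite row_mxEl.
  move=> x t Bx Bt; apply: BA => i j; rewrite ord1.
  case: (split_ordP j) => m ->; first by rewrite row_mxEl.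
  by rewrite ord1 row_mxEr mxE eqxx mulr1n.
have nr : nbhs (\val r) (B 0 (rshift n 0)).
  by have := nB 0 (rshift n 0); rewrite /cyl_map row_mxEr mxE eqxx mulr1n.
exists (cmap phi @^-1` B1, set_val @^-1` B 0 (rshift n 0)) => /=.
  split; first exact: cmap_continuous nB1.
  exact: (@initial_continuous _ _ (set_val : set_type itv0 -> R)).
by move=> [x t] /= [Bx Bt]; exact: B1B.
Qed.

Lemma to_itv0_continuous r : itv0 r -> {for r, continuous to_itv0}.
Proof.
move=> re A; rewrite nbhs_simpl /= => -[_ [[W oW <-] /= Wr WA]].
have oI : open itv0.
  have -> : itv0 = `]0, e%:num[%classic.
    by apply/seteqP; split => x /=; rewrite in_itv.
  exact: interval_open.
have nW : nbhs r (W `&` itv0).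
  apply: open_nbhs_nbhs; split; first exact: openI.
  by split => //; rewrite -(val_to_itv0 re).
apply: filterS nW => t [Wt te]; apply: WA => /=.
by rewrite set_valE val_to_itv0.
Qed.

Lemma cyl_inv_continuous q :
  cyl_dom q -> {for cyl_map q, continuous cyl_inv}.
Proof.
case: q => p r /= dp; set z0 := cyl_map _.
have c1 : (cinv phi \o lsubmx) @ z0 --> (cinv phi \o lsubmx) z0.
  apply: (@continuous_comp _ _ _ (lsubmx : 'rV[R]_(n + 1) -> 'rV[R]_n)).
    exact: continuous_lsubmx.
  by rewrite row_mxKl; exact: cinv_continuous.
pose rc := fun z : 'rV[R]_(n + 1) => rsubmx z 0 0.
have c2 : (to_itv0 \o rc) @ z0 --> (to_itv0 \o rc) z0.
  apply: (@continuous_comp _ _ _ rc); first exact: rcoord_continuous.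
  rewrite /rc row_mxKr mxE eqxx mulr1n; apply: to_itv0_continuous.
  exact: set_mem (valP r).
exact: (cvg_pair c1 c2).
Qed.

Definition cyl_chart : chart R (n + 1) cylinder :=
  Chart cyl_dom_open cyl_img_open cyl_mapK cyl_map_continuous
    cyl_inv_continuous.

End CylinderChart.

Definition cyl_atlas : set (chart R (n + 1) cylinder) :=
  cyl_chart @` atlas (s := M).

Lemma cyl_cover (q : cylinder) : exists2 Phi, cyl_atlas Phi & cdom Phi q.
Proof.
have [phi aphi dphi] := atlas_cover q.1.
by exists (cyl_chart phi) => //; exists phi.
Qed.

Lemma iter_partial_cst0 m (s : seq 'I_m) :
  iter_partial s (fun _ : 'rV[R]_m => 0) = fun _ => 0.
Proof.
by elim: s => //= i s ->; apply/funext => x; rewrite /partial derive_cst.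
Qed.

Lemma iter_partial_lsubmx (s : seq 'I_(n + 1)) (f : 'rV[R]_n -> R) :
  iter_partial s (f \o lsubmx) = (fun _ => 0) \/
  exists s', iter_partial s (f \o lsubmx) = iter_partial s' f \o lsubmx.
Proof.
elim: s => [|i s]; first by right; exists [::].
rewrite [iter_partial (i :: s) _]/= -/(iter_partial s _) => -[->|[s' IH]].
  by left; apply/funext => x; rewrite /partial derive_cst.
rewrite IH.
have dE z : partial i (iter_partial s' f \o lsubmx) z =
    'D_(lsubmx (delta_mx 0 i)) (iter_partial s' f) (lsubmx z).
  rewrite /partial /derive; 
  apply: (f_equal (fun g : R -> R => lim (g @ 0^'))); apply/funext => t /=.
  by congr (_ *: (iter_partial s' f _ - _)); apply/matrixP => a b; rewrite !mxE.
case: (split_ordP i) => j ij; [right; exists (j :: s')|left]; apply/funext => z.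
  rewrite dE /= /partial; congr (derive _ _ _); apply/matrixP => a b.
  by rewrite !mxE ij eq_lshift.
rewrite dE; have -> : lsubmx (delta_mx 0 i : 'rV[R]_(n + 1)) = 0.
  by apply/matrixP => a b; rewrite !mxE ij eq_lrshift andbF.
by rewrite derive0.
Qed.

Lemma smooth_on_lsubmx (U : set 'rV[R]_n) (f : 'rV[R]_n -> R) :
  smooth_on U f -> smooth_on (lsubmx @^-1` U : set 'rV[R]_(n + 1)) (f \o lsubmx).
Proof.
move=> sf s z Uz; have [->|[s' ->]] := iter_partial_lsubmx s f.
  exact: differentiable_cst.
by apply: differentiable_comp; [exact: differentiable_lsubmx|exact: sf].
Qed.

Lemma smooth_on_rcoord (U : set 'rV[R]_(n + 1)) :
  smooth_on U (fun z => rsubmx z 0 0).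
Proof.
have dE (i : 'I_(n + 1)) : exists c : R,
    partial i (fun z : 'rV[R]_(n + 1) => rsubmx z 0 0) = fun _ => c.
  exists (rsubmx (delta_mx 0 i : 'rV[R]_(n + 1)) 0 0); apply/funext => z.
  rewrite /partial /derive; apply: cvg_lim => //.
  apply: cvg_near_cst; near=> t => /=.
  rewrite !mxE -[X in _ *: (X + _ - _)]/(t * _) addrK.
  rewrite -[_ *: _]/(t^-1 * (t * _)) mulKf//.
  by near: t; exact: nbhs_dnbhs_neq.
move=> s z _; elim/last_ind: s => [|s i _].
  rewrite /=; under eq_fun do rewrite mxE; exact: differentiable_coord.
rewrite /iter_partial foldr_rcons; have [c ->] := dE i.
case/lastP: s => [|s j]; first exact: differentiable_cst.
rewrite foldr_rcons (_ : partial j _ = fun _ => 0).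
  by rewrite -/(iter_partial s _) iter_partial_cst0; exact: differentiable_cst.
by apply/funext => x; rewrite /partial derive_cst.
Unshelve. all: by end_near. Qed.

Lemma cyl_compat (Phi Psi : chart R (n + 1) cylinder) :
  cyl_atlas Phi -> cyl_atlas Psi ->
  smooth_map_on (cmap Phi @` (cdom Phi `&` cdom Psi)) (cmap Psi \o cinv Phi).
Proof.
move=> [phi aphi <-] [psi apsi <-].
set D := (X in smooth_map_on X _).
have DE : D = [set z | (cmap phi @` (cdom phi `&` cdom psi)) (lsubmx z) /\
                       itv0 (rsubmx z 0 0)].
  apply/seteqP; split => [_ [[p r] /= [dp dq] <-]|z [[p [dp dq] pz] rz]] /=.
    rewrite row_mxKl row_mxKr mxE eqxx mulr1n; split; first by exists p.
    exact: set_mem (valP r).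
  exists (p, to_itv0 (rsubmx z 0 0)) => //.
  rewrite /= /cyl_map /= pz val_to_itv0// -[RHS]hsubmxK; congr row_mx.
  by apply/matrixP => i j; rewrite !ord1 !mxE eqxx mulr1n.
have oD : open D by apply: open_chart_image; exact: cdom_open.
move=> j; case: (split_ordP j) => i ->.
  have := atlas_compat aphi apsi => /(_ i) /smooth_on_lsubmx sm s z.
  rewrite DE => -[Dz _]; have := sm s z Dz.
  congr (differentiable (iter_partial s _) _); apply/funext => w /=.
  by rewrite row_mxEl.
apply: (smooth_on_eq oD _ (@smooth_on_rcoord D)) => z.
by rewrite DE => -[_ rz] /=; rewrite row_mxEr (ord1 i) [RHS]mxE eqxx mulr1n val_to_itv0.
Qed.

Definition cyl : smooth_space R (n + 1) :=
  SmoothSpace cyl_cover cyl_compat.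

End Cylinder.

Definition cyl_lift {R : realType} {k n} {S : smooth_space R k}
    {M : smooth_space R n} (e : {posnum R}) (i : S -> M) :
  cyl S e -> cyl M e := fun q : cylinder S e => (i q.1, q.2).

(* r^-2 (dr^2 + (1 - lambda r^2 / 4)^2 g) on M x (0, e); in product charts the
   last coordinate is r *)
Definition canonical_poincare {R : realType} {n} {M : smooth_space R n}
    (e : {posnum R}) (g : riem_metric M) (lambda : R) (gp : riem_metric (cyl M e)) :=
  forall phi x r, atlas phi -> cimg phi x -> itv0 e r ->
    gp (cyl_chart e phi) (row_mx x r%:M) =
      r ^- 2 *: block_mx ((1 - lambda / 4 * r ^+ 2) ^+ 2 *: g phi x) 0 0 1%:M.

(* Y = S x [0, e): a function on Y is given by [F : S -> R -> R], of which only the values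
   [F p r] with 0 <= r < e matter. *)

Section GJMS.
Context {R : realType} {k : nat} {S : smooth_space R k} {e : {posnum R}}.
Implicit Types (F rho A : S -> R -> R) (E : cyl S e -> R) (f v : S -> R).
Variable hp : riem_metric (cyl S e).

Definition interior_restr F : cyl S e -> R :=
  fun q : cylinder S e => F q.1 (\val q.2).

Definition smooth_to_boundary F := forall phi : chart R k S, atlas phi ->
  smooth_ext_on
    [set z : 'rV[R]_(k + 1) | cimg phi (lsubmx z) /\ 0 <= rsubmx z 0 0 < e%:num]
    (fun z => F (cinv phi (lsubmx z)) (rsubmx z 0 0)).

(* the trace on the interior of Y of the neighborhoods of the boundary point p *)
Definition toward_boundary (p : S) : set_system (cyl S e) :=
  [set B | exists2 W : set (S * R), nbhs (p, 0) W &
     forall q : cylinder S e, W (q.1, \val q.2) -> B q].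

Definition boundary_bigO rho (s : R) E := forall p, exists C,
  \forall q \near toward_boundary p, `|E q| <= C * interior_restr rho q `^ s.

Definition boundary_value E v := forall p, E q @[q --> toward_boundary p] --> v p.

(* rho is a defining function of the boundary S with rho^2 h_+ |_TS = h *)
Definition defining_function (h : riem_metric S) rho :=
  [/\ smooth_to_boundary rho,
      forall p, rho p 0 = 0,
      forall q, 0 < interior_restr rho q,
      forall p, exists2 c : R, c != 0 & rho p r / r @[r --> 0^'+] --> c &
      forall phi p, atlas phi -> cdom phi p -> forall i j,
        interior_restr rho q ^+ 2 *
          ulsubmx (hp (cyl_chart e phi) (cyl_map phi q)) i j
          @[q --> toward_boundary p] --> h phi (cmap phi p) i j].

Definition gjms_coef (l : nat) : R :=
  ((-1) ^+ l * 2 ^+ (2 * l.-1) * (l.-1`!)%:R ^+ 2)^-1.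

(* (Delta_{h_+} + (k/2)^2 - l^2) u for u = rho^(k/2 - l) F *)
Definition gjms_defect rho (l : nat) F : cyl S e -> R :=
  let u q := interior_restr rho q `^ (k%:R / 2 - l%:R) * interior_restr F q in
  fun q => laplacian hp u q + ((k%:R / 2) ^+ 2 - l%:R ^+ 2) * u q.

Definition gjms_extension rho (l : nat) f F :=
  [/\ smooth_to_boundary F, forall p, F p 0 = f p &
      boundary_bigO rho (k%:R / 2 + l%:R) (gjms_defect rho l F)].

(* An extension exists and every extension yields P f, so P is determined on
   smooth functions. *)
Definition is_gjms_operator rho (l : nat) (P : (S -> R) -> (S -> R)) :=
  forall f, smooth_fun f ->
    (exists F, gjms_extension rho l f F) /\
    forall F, gjms_extension rho l f F ->
      boundary_value
        (fun q => interior_restr rho q `^ (- (k%:R / 2) - l%:R)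
                  * gjms_defect rho l F q)
        (fun p => gjms_coef l * P f p).

(* Delta_{h_+} (log rho + A) + k *)
Definition log_defect rho A : cyl S e -> R := fun q =>
  laplacian hp (fun q' => ln (interior_restr rho q') + interior_restr A q') q
  + k%:R.

Definition log_extension rho A :=
  [/\ smooth_to_boundary A, forall p, A p 0 = 0 &
      boundary_bigO rho k%:R (log_defect rho A)].

(* meaningful for k even, where k./2 is the exact half *)
Definition is_critical_Q_curvature rho (Q : S -> R) :=
  (exists A, log_extension rho A) /\
  forall A, log_extension rho A ->
    boundary_value
      (fun q => interior_restr rho q `^ (- k%:R) * log_defect rho A q)
      (fun p => gjms_coef k./2 * Q p).

End GJMS.

Definition neg_laplacian_plus {R : realType} {k} {S : smooth_space R k}
    (h : riem_metric S) (c : R) (f : S -> R) : S -> R :=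
  fun p => - laplacian h f p + c * f p.

(* Main.v *)
From HB Require Import structures.
Require Import Defs.
From mathcomp Require Import all_boot all_order all_algebra.
From mathcomp Require Import all_classical all_reals all_analysis.
From mathcomp Require Import ring lra.
Import Order.TTheory GRing.Theory Num.Theory.
Import numFieldNormedType.Exports.
Local Open Scope classical_set_scope.
Local Open Scope ring_scope.
Set Implicit Arguments.
Unset Strict Implicit.
Unset Printing Implicit Defensive.

(* In the product coordinates of Y the induced metric is
   [h_+ = r^-2 (dr^2 + (1 - lambda r^2 / 4)^2 h)]; minimality and the Einstein
   equation only serve to make Y canonical, and the statement concerns the metric
   h_+ alone. Put [s = r / (1 - lambda r^2 / 4)]. For a function [a] on Sigma the
   h_+-Laplacian of [s^alpha a] is a combination of [s^alpha] and [s^(alpha + 2)],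
   so the extension problem has an explicit solution, a finite sum of powers of
   [s], whose defect is a single term [s^(k/2 + l)]. Its coefficient is
   [gjms_coef l] times a product of l operators [- Delta_h + lambda c], and a
   reordering of the factors gives the constants c_j. The same computation with
   [log s] gives the critical Q-curvature.
   Any two extensions differ by [r^(k/2 - l) G] with G vanishing on the boundary;
   dividing G by [r] (Hadamard's lemma) and comparing leading terms with the
   indicial polynomial forces G to vanish to order [2 l], hence equal values.
   A general defining function is [rho = r w] with [w] smooth, and [w = 1] on
   Sigma, so that powers of [w] can be absorbed into the extension. *)

(** * Smooth functions in coordinates *)

(** [laplacian] evaluates each point in a chart chosen for that point. Coordinate invariance of the
    Laplacian therefore has to come early: without it [laplacian h f] could not be seen to be
    smooth, nor be iterated. Division by r must keep smoothness up to the boundary. This is done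
    without an integral formula: the functions g / r^N, with g vanishing to order N on r = 0, are
    continuous and their partial derivatives are again of this kind, so the criterion by continuous
    partial derivatives makes them smooth. As for the constants, put sigma = k/2 - l + 2m. Then
    sigma (sigma - k) + (k/2)^2 - l^2 = - 4 m (l - m). This is nonzero for 0 < m < l, so each
    coefficient of the solution can be solved for; it is zero at m = l, so the term of order k/2 + l
    cannot be removed and is the obstruction. The product of the 4 m (l - m) over 0 < m < l is
    2^(2(l-1)) (l-1)!^2, the normalisation in a_l. The other term of the Laplacian carries lambda
    sigma (sigma + 1 - k), which is minus lambda (k/2 + y - 1)(k/2 - y) at y = 2m - l + 1; the
    symmetry y -> 1 - y of this expression turns these values into the c_j. *)

Section Calculus.
Context {R : realType} {n : nat}.
Implicit Types (f g : 'rV[R]_n -> R) (U : set 'rV[R]_n).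

Lemma near_open (T : topologicalType) (U : set T) x :
  open U -> U x -> \forall y \near x, U y.
Proof. by move=> oU Ux; exact: open_nbhs_nbhs. Qed.

Lemma partial_eq U f g i x : open U -> (forall y, U y -> f y = g y) -> U x ->
  partial i f x = partial i g x.
Proof.
move=> oU fg Ux; apply: near_eq_derive.
by apply: filterS (near_open oU Ux) => y; exact: fg.
Qed.

Lemma partialE f i x : differentiable f x ->
  partial i f x = 'd f x (delta_mx 0 i).
Proof. exact: deriveE. Qed.

Lemma partialD f g i x : differentiable f x -> differentiable g x ->
  partial i (fun y => f y + g y) x = partial i f x + partial i g x.
Proof. by move=> df dg; apply: deriveD; exact: diff_derivable. Qed.

Lemma partialM f g i x : differentiable f x -> differentiable g x ->
  partial i (fun y => f y * g y) x = f x * partial i g x + g x * partial i f x.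
Proof. by move=> df dg; apply: deriveM; exact: diff_derivable. Qed.

Lemma partial_cst (c : R) i x : partial i (fun _ : 'rV[R]_n => c) x = 0.
Proof. exact: derive_cst. Qed.

Lemma partialZ (c : R) f i x : differentiable f x ->
  partial i (fun y => c * f y) x = c * partial i f x.
Proof. by move=> df; apply: deriveZ; exact: diff_derivable. Qed.

Lemma differentiable_sums (I : Type) (r : seq I) (P : pred I) (F : I -> 'rV[R]_n -> R) x :
  (forall j, differentiable (F j) x) ->
  differentiable (fun y => \sum_(j <- r | P j) F j y) x.
Proof.
move=> dF; elim: r => [|j r IH].
  by under eq_fun do rewrite big_nil; exact: differentiable_cst.
case Pj: (P j); last by under eq_fun do rewrite big_cons Pj.
by under eq_fun do rewrite big_cons Pj; exact: differentiableD.
Qed.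

Lemma partial_sum (I : Type) (r : seq I) (P : pred I) (F : I -> 'rV[R]_n -> R) i x :
  (forall j, differentiable (F j) x) ->
  partial i (fun y => \sum_(j <- r | P j) F j y) x = \sum_(j <- r | P j) partial i (F j) x.
Proof.
move=> dF; elim: r => [|j r IH].
  by under eq_fun do rewrite big_nil; rewrite partial_cst big_nil.
case Pj: (P j); last by under eq_fun do rewrite big_cons Pj; rewrite big_cons Pj.
under eq_fun do rewrite big_cons Pj; rewrite big_cons Pj partialD ?IH//.
exact: differentiable_sums.
Qed.

(** The Leibniz and chain rules replace one derivative of a product or composite by sums of products
    of other functions. Counting derivatives, instead of listing directions as [smooth_on] does,
    gives an induction that accommodates this. *)
Fixpoint diff_upto U m f : Prop :=
  (forall x, U x -> differentiable f x) /\
  if m is m'.+1 then forall i, diff_upto U m' (partial i f) else True.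

Lemma diff_upto_diff U m f x : diff_upto U m f -> U x -> differentiable f x.
Proof. by case: m => [|m] [df _]; exact: df. Qed.

Lemma diff_uptoW U m f : diff_upto U m.+1 f -> diff_upto U m f.
Proof.
elim: m f => [|m IH] f [df pf]; split => // i; exact/IH/pf.
Qed.

Lemma smooth_onP U f : smooth_on U f <-> forall m, diff_upto U m f.
Proof.
split => [sf m|sf s].
  elim: m f sf => [|m IH] f sf; split=> //; try exact: (sf [::]).
  by move=> i; apply: IH => s; have := sf (rcons s i); rewrite /iter_partial foldr_rcons.
elim/last_ind: s f sf => [|s i IH] f sf x Ux; first exact: diff_upto_diff (sf 0%N) Ux.
rewrite /iter_partial foldr_rcons; apply: IH => // m.
by have [_] := sf m.+1; apply.
Qed.

Lemma smooth_on_partial U f i : smooth_on U f -> smooth_on U (partial i f).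
Proof. by move=> sf s; have := sf (rcons s i); rewrite /iter_partial foldr_rcons. Qed.

Lemma smooth_on_diff U f x : smooth_on U f -> U x -> differentiable f x.
Proof. by move=> sf; exact: (sf [::]). Qed.

Lemma smooth_on_continuous U f x : smooth_on U f -> U x -> {for x, continuous f}.
Proof. by move=> sf /(smooth_on_diff sf); exact: differentiable_continuous. Qed.

Lemma smooth_onS U V f : V `<=` U -> smooth_on U f -> smooth_on V f.
Proof. by move=> VU sf s x /VU; exact: sf. Qed.

Lemma diff_upto_eq U m f g : open U -> (forall x, U x -> f x = g x) ->
  diff_upto U m f -> diff_upto U m g.
Proof.
move=> oU; elim: m f g => [|m IH] f g fg [df pf]; split => //.
- move=> x Ux; apply: near_eq_differentiable (df x Ux).
  by apply: filterS (near_open oU Ux) => y; exact: fg.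
- move=> x Ux; apply: near_eq_differentiable (df x Ux).
  by apply: filterS (near_open oU Ux) => y; exact: fg.
- by move=> i; apply: IH (pf i) => x Ux; exact: partial_eq fg Ux.
Qed.

Lemma diff_upto_cst U m (c : R) : diff_upto U m (fun=> c).
Proof.
elim: m c => [|m IH] c; split; try by move=> x _; exact: differentiable_cst.
- by [].
- move=> i; rewrite (_ : partial _ _ = fun=> 0)//.
  by apply/funext => x; exact: partial_cst.
Qed.

Lemma diff_uptoD U m f g : open U -> diff_upto U m f -> diff_upto U m g ->
  diff_upto U m (fun x => f x + g x).
Proof.
move=> oU; elim: m f g => [|m IH] f g [df pf] [dg pg]; split => //;
  try by move=> x Ux; apply: differentiableD; [exact: df|exact: dg].
move=> i; apply: diff_upto_eq (IH _ _ (pf i) (pg i)) => // x Ux.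
by rewrite partialD//; [exact: df|exact: dg].
Qed.

Lemma diff_uptoM U m f g : open U -> diff_upto U m f -> diff_upto U m g ->
  diff_upto U m (fun x => f x * g x).
Proof.
move=> oU; elim: m f g => [|m IH] f g [df pf] [dg pg]; split => //;
  try by move=> x Ux; apply: differentiableM; [exact: df|exact: dg].
move=> i; have := diff_uptoD oU
  (IH _ _ (diff_uptoW (conj df pf)) (pg i)) (IH _ _ (diff_uptoW (conj dg pg)) (pf i)).
apply: diff_upto_eq => // x Ux.
by rewrite partialM//; [exact: df|exact: dg].
Qed.

Lemma smooth_on_cst U (c : R) : smooth_on U (fun=> c).
Proof. by apply/smooth_onP => m; exact: diff_upto_cst. Qed.

Lemma smooth_onD U f g : open U -> smooth_on U f -> smooth_on U g ->
  smooth_on U (fun x => f x + g x).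
Proof.
by move=> oU /smooth_onP sf /smooth_onP sg; apply/smooth_onP => m; exact: diff_uptoD.
Qed.

Lemma smooth_onM U f g : open U -> smooth_on U f -> smooth_on U g ->
  smooth_on U (fun x => f x * g x).
Proof.
by move=> oU /smooth_onP sf /smooth_onP sg; apply/smooth_onP => m; exact: diff_uptoM.
Qed.

Lemma smooth_onZ U (c : R) f : open U -> smooth_on U f -> smooth_on U (fun x => c * f x).
Proof. by move=> oU; apply: smooth_onM => //; exact: smooth_on_cst. Qed.

Lemma smooth_onN U f : open U -> smooth_on U f -> smooth_on U (fun x => - f x).
Proof.
move=> oU /(smooth_onZ (-1) oU); congr smooth_on.
by apply/funext => x; rewrite mulN1r.
Qed.

Lemma smooth_onB U f g : open U -> smooth_on U f -> smooth_on U g ->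
  smooth_on U (fun x => f x - g x).
Proof. by move=> oU sf sg; apply: smooth_onD => //; exact: smooth_onN. Qed.

Lemma smooth_on_sum U (I : Type) (r : seq I) (P : pred I) (F : I -> 'rV[R]_n -> R) :
  open U -> (forall i, smooth_on U (F i)) ->
  smooth_on U (fun x => \sum_(i <- r | P i) F i x).
Proof.
move=> oU sF; elim: r => [|j r IH].
  by under eq_fun do rewrite big_nil; exact: smooth_on_cst.
case Pj: (P j); last by under eq_fun do rewrite big_cons Pj.
by under eq_fun do rewrite big_cons Pj; exact: smooth_onD.
Qed.

Lemma smooth_on_prod U (I : Type) (r : seq I) (P : pred I) (F : I -> 'rV[R]_n -> R) :
  open U -> (forall i, smooth_on U (F i)) ->
  smooth_on U (fun x => \prod_(i <- r | P i) F i x).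
Proof.
move=> oU sF; elim: r => [|j r IH].
  by under eq_fun do rewrite big_nil; exact: smooth_on_cst.
case Pj: (P j); last by under eq_fun do rewrite big_cons Pj.
by under eq_fun do rewrite big_cons Pj; exact: smooth_onM.
Qed.

Lemma smooth_onX U f m : open U -> smooth_on U f -> smooth_on U (fun x => f x ^+ m).
Proof.
move=> oU sf; elim: m => [|m IH]; first exact: smooth_on_cst.
rewrite (_ : (fun x => _) = fun x => f x * f x ^+ m); first exact: smooth_onM.
by apply/funext => x; rewrite exprS.
Qed.

(* A smooth function of one variable is presented by its successive
   derivatives. *)
Definition derivatives_on (V : set R) (psi : nat -> R -> R) :=
  forall m x, V x -> is_derive x 1 (psi m) (psi m.+1 x).

Lemma differentiable_comp1 (psi : R -> R) (c : R) f x :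
  is_derive (f x) 1 psi c -> differentiable f x -> differentiable (psi \o f) x.
Proof.
by move=> [dpsi _] df; apply: differentiable_comp => //; exact/derivable1_diffP.
Qed.

Lemma partial_comp1 (psi : R -> R) (c : R) f i x : is_derive (f x) 1 psi c ->
  differentiable f x -> partial i (psi \o f) x = c * partial i f x.
Proof.
move=> [dpsi epsi] df; have dp : differentiable psi (f x) by exact/derivable1_diffP.
rewrite !partialE//; last exact: differentiable_comp.
by rewrite diff_comp//= diff1E// derive1E epsi mulrC.
Qed.

Lemma smooth_on_comp1 U V psi f : open U -> derivatives_on V psi ->
  (forall x, U x -> V (f x)) -> smooth_on U f ->
  smooth_on U (fun x => psi 0%N (f x)).
Proof.
move=> oU dpsi UV /smooth_onP sf; apply/smooth_onP => m.
(* All [psi j] are treated at once, because differentiating [psi j (f x)] brings in [psi j.+1]. *)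
suff H j : diff_upto U m (fun x => psi j (f x)) by exact: H.
elim: m j => [|m IH] j; split => //;
  try by move=> x Ux; exact: differentiable_comp1 (dpsi j _ (UV x Ux)) (diff_upto_diff (sf 0%N) Ux).
have [_ pf] := sf m.+1; move=> i.
have := diff_uptoM oU (IH j.+1) (pf i).
apply: diff_upto_eq => // x Ux.
by rewrite (partial_comp1 i (dpsi j _ (UV x Ux)) (diff_upto_diff (sf 0%N) Ux)).
Qed.

End Calculus.

(** * Mean value theorem along lines, and differentiability from continuous partial derivatives *)

Section Lines.
Context {R : realType}.

Lemma is_derive_line (V : normedModType R) (f : V -> R) x v (t : R) :
  derivable f (t *: v + x) v ->
  is_derive t 1 (fun s => f (s *: v + x)) ('D_v f (t *: v + x)).
Proof.
have E : (fun h : R => h^-1 *: (((fun s => f (s *: v + x)) \o shift t) (h *: (1 : R))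
                  - f (t *: v + x))) =
         (fun h => h^-1 *: ((f \o shift (t *: v + x)) (h *: v) - f (t *: v + x))).
  apply/funext => h /=; congr (_ *: (f _ - _)).
  by rewrite addrA -scalerDl [h *: 1]mulr1.
by move=> dv; apply: DeriveDef; rewrite /derivable /derive E.
Qed.

(** The symmetric range of s covers both signs of t; later the segments start on a hyperplane and
    leave it on either side. *)
Lemma mvt_line (V : normedModType R) (f : V -> R) x v (t : R) :
  (forall s : R, `|s| <= `|t| -> derivable f (s *: v + x) v) ->
  exists2 s : R, `|s| <= `|t| & f (t *: v + x) - f x = t * 'D_v f (s *: v + x).
Proof.
move=> df; pose g (s : R) := f (s *: v + x).
have dg (s : R) : `|s| <= `|t| -> is_derive s 1 g ('D_v f (s *: v + x)).
  by move=> /df; exact: is_derive_line.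
have cg (I : interval R) : (forall s : R, s \in I -> `|s| <= `|t|) ->
    {within [set` I], continuous g}.
  by move=> It; apply: derivable_within_continuous => s /It /dg[].
have g0 : g 0 = f x by rewrite /g scale0r add0r.
have [t0|/ltW t0] := leP 0 t.
  have It (s : R) : s \in `[0, t] -> `|s| <= `|t|.
    by rewrite in_itv/= => /andP[s0 st]; rewrite !ger0_norm.
  have [|s /It st E] := @MVT_segment _ g (fun s => 'D_v f (s *: v + x)) _ _ t0 _ (cg _ It).
    by move=> s st; apply/dg/It; exact: subset_itv_oo_cc st.
  by exists s => //; rewrite -g0 -/(g t) E subr0 mulrC.
have It (s : R) : s \in `[t, 0] -> `|s| <= `|t|.
  by rewrite in_itv/= => /andP[st s0]; rewrite !ler0_norm// lerN2.
have [|s /It st E] := @MVT_segment _ g (fun s => 'D_v f (s *: v + x)) _ _ t0 _ (cg _ It).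
  by move=> s st; apply/dg/It; exact: subset_itv_oo_cc st.
by exists s => //; rewrite -g0 -/(g t) -opprB E sub0r mulrN opprK mulrC.
Qed.

Lemma differentiable_approx (V W : normedModType R) (f : V -> W) (L : {linear V -> W}) x :
  continuous L ->
  (forall e, 0 < e -> \forall h \near (0 : V), `|f (h + x) - f x - L h| <= e * `|h|) ->
  differentiable f x /\ 'd f x = L :> (V -> W).
Proof.
move=> cL fL.
have E : f \o shift x = cst (f x) + L +o_ 0 id.
  apply/eqaddoP => e e0; have := fL e e0; apply: filterS => h.
  by rewrite !fctE /= opprD addrA.
have dE := diff_unique cL E.
by split=> //; apply/diff_locallyP; rewrite dE; split.
Qed.

Lemma rV_norm_le n (v : 'rV[R]_n) (c : R) : 0 <= c ->
  (`|v| <= c) <-> (forall j, `|v 0 j| <= c).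
Proof.
move=> c0; rewrite [X in X <= _]/Num.Def.normr/= mx_normrE; split.
  by move=> /bigmax_leP[_ H] j; exact: (H (0, j)).
by move=> H; apply/bigmax_leP; split => // -[i j] _ /=; rewrite ord1.
Qed.

Lemma rV_coord_le n (v : 'rV[R]_n) j : `|v 0 j| <= `|v|.
Proof. by move: j; apply/rV_norm_le. Qed.

Lemma rV_delta_sum n (v : 'rV[R]_n) : v = \sum_j v 0 j *: delta_mx 0 j.
Proof. by rewrite {1}[v]row_sum_delta. Qed.

Lemma rV_linear_continuous n (L : {linear 'rV[R]_n -> R}) : continuous L.
Proof.
move=> x; apply: differentiable_continuous.
rewrite (_ : (L : 'rV[R]_n -> R) = fun y : 'rV[R]_n => \sum_j y 0 j * L (delta_mx 0 j)); last first.
  apply/funext => y; rewrite {1}[y]rV_delta_sum linear_sum.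
  by apply: eq_bigr => j _; rewrite linearZ.
by apply: differentiable_sums => j; apply: differentiableM => //; exact: differentiable_coord.
Qed.

(** Join x to h + x by a path along the coordinate axes and apply the mean value theorem to each
    edge; continuity of the partial derivatives compares each edge with the linear map built from
    the partials at x. *)
Lemma differentiable_partials n (f : 'rV[R]_n -> R) x :
  (\forall y \near x, forall i, derivable f y (delta_mx 0 i)) ->
  (forall i, {for x, continuous (partial i f)}) ->
  differentiable f x.
Proof.
move=> df cf.
pose L0 (h : 'rV[R]_n) := \sum_i h 0 i * partial i f x.
have L0l : linear L0.
  move=> a u v; rewrite /L0 scaler_sumr -big_split/=; apply: eq_bigr => i _.
  by rewrite !mxE mulrDl -mulrA.
pose LM := GRing.isLinear.Build _ _ _ _ _ L0l.
pose L : {linear 'rV[R]_n -> R} := HB.pack L0 LM.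
apply: (proj1 (differentiable_approx (L := L) _ _)); first exact: rV_linear_continuous.
(* Each of the n edges may contribute e / (n + 1) times the norm of h; dividing by n + 1 also covers
   n = 0. *)
move=> e e0; have en0 : 0 < e / n.+1%:R by rewrite divr_gt0.
have N : \forall y \near x, forall i, derivable f y (delta_mx 0 i) /\
    `|partial i f y - partial i f x| <= e / n.+1%:R.
  near=> y => i; split; first by move: i; near: y.
  move: i; near: y; apply: filter_forall => i.
  by have /cvgrPdist_le /(_ _ en0) := cf i; apply: filterS => y; rewrite distrC.
have [d d0 dN] : exists2 d : R, 0 < d & forall y, `|y - x| < d -> forall i,
    derivable f y (delta_mx 0 i) /\ `|partial i f y - partial i f x| <= e / n.+1%:R.
  move/nbhs_ballP : N => [d d0 dN]; exists d => // y yx; apply: dN.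
  by rewrite -ball_normE /ball_/= distrC.
have hd : \forall h \near (0 : 'rV[R]_n), `|h| < d.
  exact: nbhs0_lt.
near=> h.
(* The vertices of the path: the first m coordinates of h, the others zero. *)
pose tr m : 'rV[R]_n := \row_j (if (j < m)%N then h 0 j else 0).
have trS (i : 'I_n) : tr i.+1 = h 0 i *: delta_mx 0 i + tr i.
  apply/rowP => j; rewrite !mxE eqxx ltnS leq_eqVlt -val_eqE /=.
  by case: (ltngtP j i) => [ji|ij|/val_inj ->] /=; rewrite ?mulr0 ?mulr1 ?addr0 ?add0r.
have trd (i : 'I_n) (s : R) : `|s| <= `|h 0 i| -> `|s *: delta_mx 0 i + tr i| <= `|h|.
  move=> sh; apply/rV_norm_le => // j; rewrite !mxE eqxx -val_eqE /=.
  case: (ltngtP j i) => _ /=; rewrite ?mulr0 ?mulr1 ?addr0 ?add0r ?normr0//.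
    exact: rV_coord_le.
  by apply: le_trans sh _; exact: rV_coord_le.
have tr0 : tr 0%N = 0 by apply/rowP => j; rewrite !mxE.
have trn : tr n = h by apply/rowP => j; rewrite !mxE ltn_ord.
have -> : f (h + x) - f x = \sum_(i < n) (f (tr i.+1 + x) - f (tr i + x)).
  rewrite -(big_mkord xpredT (fun i => f (tr i.+1 + x) - f (tr i + x))).
  by rewrite telescope_sumr// trn tr0 add0r.
rewrite /= /L0 -sumrB; apply: le_trans (ler_norm_sum _ _ _) _.
apply: (@le_trans _ _ (\sum_(i < n) (e / n.+1%:R * `|h|))); last first.
  rewrite sumr_const card_ord -[leLHS]mulr_natl mulrA ler_wpM2r//.
  rewrite mulrCA -[leRHS]mulr1 ler_wpM2l ?(ltW e0)// ler_pdivrMr// mul1r ler_nat.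
  by rewrite leqnSn.
apply: ler_sum => i _.
have hlt : `|h| < d by near: h.
have [s|s sh E] := @mvt_line _ f (tr i + x) (delta_mx 0 i) (h 0 i).
  move=> sh; apply: (dN _ _ i).1; rewrite addrA addrK.
  by apply: le_lt_trans (trd i s sh) hlt.
rewrite trS -[_ *: _ + _ + x]addrA E -mulrBr normrM mulrC ler_pM//; last exact: rV_coord_le.
apply: (dN _ _ i).2; rewrite addrA addrK.
by apply: le_lt_trans (trd i s sh) hlt.
Unshelve. all: by end_near. Qed.

End Lines.

(** * Symmetry of second derivatives *)

Section Schwarz.
Context {R : realType} {n : nat}.
Implicit Types (f : 'rV[R]_n -> R) (U : set 'rV[R]_n).

Lemma norm_delta_le (i : 'I_n) (t : R) : `|t *: (delta_mx 0 i : 'rV[R]_n)| <= `|t|.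
Proof.
apply/rV_norm_le => // j; rewrite !mxE eqxx /=.
by case: (_ == _); rewrite ?mulr1 // mulr0 normr0.
Qed.

Lemma derive_translate (V : normedModType R) (f : V -> R) c y v :
  'D_v (fun z => f (c + z)) y = 'D_v f (c + y) /\
  (derivable f (c + y) v -> derivable (fun z => f (c + z)) y v).
Proof.
have E : (fun h : R => h^-1 *: (((fun z => f (c + z)) \o shift y) (h *: v) - f (c + y))) =
         (fun h => h^-1 *: ((f \o shift (c + y)) (h *: v) - f (c + y))).
  by apply/funext => h /=; congr (_ *: (f _ - _)); rewrite addrCA.
by rewrite /derive /derivable E.
Qed.

(** The mean value theorem is applied twice: in direction i to the increment of f along j, then in
    direction j to [partial i f]. *)
Lemma second_difference f i j x (t : R) :
  (forall y, `|y - x| <= 2 * `|t| -> differentiable f y /\ differentiable (partial i f) y) ->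
  exists2 y, `|y - x| <= 2 * `|t| &
    f (t *: delta_mx 0 j + (t *: delta_mx 0 i + x)) - f (t *: delta_mx 0 i + x)
    - (f (t *: delta_mx 0 j + x) - f x) = t * (t * partial j (partial i f) y).
Proof.
move=> df; pose g y := f (t *: delta_mx 0 j + y) - f y.
have near2 (s r : R) : `|s| <= `|t| -> `|r| <= `|t| ->
    `|r *: delta_mx 0 j + (s *: delta_mx 0 i + x) - x| <= 2 * `|t|.
  move=> st rt; rewrite addrA addrK mulr2n mulrDl !mul1r.
  by apply: le_trans (ler_normD _ _) _; apply: lerD;
    apply: le_trans (norm_delta_le _ _) _.
have near1 (s : R) : `|s| <= `|t| -> `|s *: delta_mx 0 i + x - x| <= 2 * `|t|.
  by move=> st; have := near2 s 0 st; rewrite normr0 scale0r add0r; exact.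
have [s st|s st] := @mvt_line _ _ g x (delta_mx 0 i) t.
  apply: derivableB; last exact/diff_derivable/(df _ (near1 s st)).1.
  by apply: (derive_translate _ _ _ _).2; apply/diff_derivable/(df _ (near2 s t st _)).1.
rewrite /g => ->.
rewrite deriveB; last 2 first.
- by apply: (derive_translate _ _ _ _).2; apply/diff_derivable/(df _ (near2 s t st _)).1.
- exact/diff_derivable/(df _ (near1 s st)).1.
rewrite (derive_translate _ _ _ _).1 -!/(partial i f _).
have [r rt|r rt ->] := @mvt_line _ _ (partial i f) (s *: delta_mx 0 i + x) (delta_mx 0 j) t.
  exact/diff_derivable/(df _ (near2 s r st rt)).2.
by exists (r *: delta_mx 0 j + (s *: delta_mx 0 i + x)); first exact: near2.
Qed.

Lemma continuous_pair_ball U (p q : 'rV[R]_n -> R) x (e : R) : open U -> U x ->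
  {for x, continuous p} -> {for x, continuous q} -> 0 < e ->
  exists2 d, 0 < d & forall y, `|y - x| < d ->
    [/\ U y, `|p x - p y| <= e & `|q x - q y| <= e].
Proof.
move=> oU Ux /cvgrPdist_le cp /cvgrPdist_le cq e0.
have [d /= d0 dN] := (nbhs_ballP _ _).1
  (filterI (near_open oU Ux) (filterI (cp e e0) (cq e e0))).
exists d => // y yx; have [|Uy [py qy]] := dN y; last by split.
by rewrite -ball_normE /ball_/= distrC.
Qed.

Lemma dist_le_split (a b a' b' e : R) : `|a - a'| <= e / 2 -> `|b - b'| <= e / 2 ->
  a' = b' -> `|a - b| <= e.
Proof.
move=> aa' bb' E; have -> : a - b = a - a' - (b - b') by rewrite E; ring.
by apply: le_trans (ler_normB _ _) _; rewrite [leRHS]splitr lerD.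
Qed.

(** The second difference is symmetric in i and j, so the two mixed derivatives agree when taken at
    two suitable points near x; their continuity brings both points to x. *)
Lemma partialC U f i j x : open U -> smooth_on U f -> U x ->
  partial i (partial j f) x = partial j (partial i f) x.
Proof.
move=> oU sf Ux; apply/eqP; rewrite -subr_eq0 -normr_le0; apply/ler_addgt0Pl => e e0.
rewrite addr0; have e20 : 0 < e / 2 by rewrite divr_gt0.
have c k l : {for x, continuous (partial k (partial l f))}.
  by apply: smooth_on_continuous Ux; do 2 apply: smooth_on_partial.
have [d d0 dN] := continuous_pair_ball oU Ux (c i j) (c j i) e20.
have t0 : 0 < d / 4 by rewrite divr_gt0.
have yd y : `|y - x| <= 2 * `|d / 4| -> `|y - x| < d.
  by move=> /le_lt_trans; apply; rewrite (gtr0_norm t0); move: d0; lra.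
have df k y : `|y - x| <= 2 * `|d / 4| -> differentiable f y /\ differentiable (partial k f) y.
  move=> /yd /dN [Uy _ _]; split; first exact: smooth_on_diff sf Uy.
  by apply: smooth_on_diff Uy; exact: smooth_on_partial.
have [y /yd /dN[_ _ y1] Ey] := second_difference j (df i).
have [z /yd /dN[_ z1 _] Ez] := second_difference i (df j).
have E : partial j (partial i f) y = partial i (partial j f) z.
  apply: (mulfI (lt0r_neq0 t0)); apply: (mulfI (lt0r_neq0 t0)).
  have AC (p q r s : R) : p - q - (r - s) = p - r - (q - s) by ring.
  apply: (etrans (esym Ey)); apply: (etrans _ Ez).
  by rewrite (addrCA ((d / 4) *: delta_mx 0 j)); exact: AC.
exact: (dist_le_split z1 y1 (esym E)).
Qed.

End Schwarz.

Section ChainRule.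
Context {R : realType} {m n : nat}.
Implicit Types (f : 'rV[R]_n -> R) (y : 'rV[R]_m -> 'rV[R]_n).

Lemma rV_differentiable y x : (forall j, differentiable (fun z => y z 0 j) x) ->
  differentiable y x.
Proof.
move=> dy; rewrite (_ : y = \sum_j (fun z => y z 0 j *: delta_mx 0 j)).
  by apply: differentiable_sum => j; exact: differentiableZl.
by apply/funext => z; rewrite fct_sumE {1}[y z]rV_delta_sum.
Qed.

Lemma jacobianE y x i j : (forall j, differentiable (fun z => y z 0 j) x) ->
  jacobian y x i j = partial i (fun z => y z 0 j) x.
Proof.
move=> dy; have dy' := rV_differentiable dy.
have := derive_mx (diff_derivable (v := delta_mx 0 i) dy').
rewrite deriveEjacobian// -rowE => /matrixP/(_ 0 j).
by rewrite !mxE.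
Qed.

Lemma partial_comp f y i x : differentiable f (y x) ->
  (forall j, differentiable (fun z => y z 0 j) x) ->
  differentiable (f \o y) x /\
  partial i (f \o y) x = \sum_j partial i (fun z => y z 0 j) x * partial j f (y x).
Proof.
move=> df dy; have dy' := rV_differentiable dy.
have dfy : differentiable (f \o y) x by exact: differentiable_comp.
split => //; rewrite partialE// diff_comp//=.
rewrite [X in 'd f _ X]rV_delta_sum linear_sum; apply: eq_bigr => j _.
rewrite linearZ /= -partialE//; congr (_ * _); rewrite -jacobianE//.
by rewrite mxE.
Qed.

End ChainRule.

(** * Division by a coordinate *)

Section Hadamard.
Context {R : realType} {n : nat}.
Variables (i0 : 'I_n) (U : set 'rV[R]_n).
Implicit Types (f g : 'rV[R]_n -> R) (x y : 'rV[R]_n).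

Definition drop_coord y : 'rV[R]_n := y - y 0 i0 *: delta_mx 0 i0.

(** Balls for the maximum norm centred on the hyperplane y_i0 = 0 have this property, by
    [line_dist]. It keeps inside U every segment along which Taylor estimates are made. *)
Definition star_shaped := forall y (s : R), U y -> `|s| <= `|y 0 i0| ->
  U (s *: delta_mx 0 i0 + drop_coord y).

Hypotheses (oU : open U) (starU : star_shaped).

Definition normal_deriv (m : nat) g := iter m (partial i0) g.

(** The value on the hyperplane is the Taylor coefficient of order N in the normal direction, the
    limit of the quotient when g vanishes to order N. *)
Definition quot (N : nat) g y : R :=
  if y 0 i0 == 0 then normal_deriv N g y / N`!%:R else g y / y 0 i0 ^+ N.

Definition vanishes (N : nat) g := forall m y, (m < N)%N -> U y -> y 0 i0 = 0 ->
  normal_deriv m g y = 0.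

(** A directional derivative depends only on the restriction to a line. This is used where two
    functions agree on the hyperplane but not in a neighbourhood. *)
Lemma derive_line_eq f g x v :
  (\forall t \near (0 : R), f (t *: v + x) = g (t *: v + x)) ->
  'D_v f x = 'D_v g x /\ (derivable f x v -> derivable g x v).
Proof.
move=> fg; have E (h : 'rV[R]_n -> R) : 'D_v h x = 'D_1 (fun t : R => h (t *: v + x)) 0.
  have K : (fun t : R => t^-1 *: ((h \o shift x) (t *: v) - h x)) = (fun t : R =>
      t^-1 *: (((fun t : R => h (t *: v + x)) \o shift 0) (t *: 1) - h (0 *: v + x))).
    by apply/funext => t /=; rewrite addr0 scale0r add0r [t%:A]mulr1.
  by rewrite /derive K.
split; first by rewrite (E f) (E g); exact: near_eq_derive.
by move=> /derivable1P df; apply/derivable1P; apply: near_eq_derivable df.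
Qed.

Lemma line_coord0 (s : R) y : (s *: delta_mx 0 i0 + drop_coord y) 0 i0 = s.
Proof. by rewrite !mxE !eqxx /= !mulr1 subrr addr0. Qed.

Lemma drop_coord_line (s : R) y :
  drop_coord (s *: delta_mx 0 i0 + drop_coord y) = drop_coord y.
Proof. by rewrite {1}/drop_coord line_coord0 addrC addKr. Qed.

Lemma drop_coordK y : y 0 i0 *: delta_mx 0 i0 + drop_coord y = y.
Proof. by rewrite addrC subrK. Qed.

Lemma drop_coord_id y : y 0 i0 = 0 -> drop_coord y = y.
Proof. by move=> y0; rewrite /drop_coord y0 scale0r subr0. Qed.

Lemma smooth_normal_deriv m g : smooth_on U g -> smooth_on U (normal_deriv m g).
Proof. by move=> sg; elim: m => //= m IH; exact: smooth_on_partial. Qed.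

(** The mean value theorem replaces integration from the hyperplane: a bound on the normal
    derivative of g - P gains one power of the coordinate. The factor 1 / (N + 1) that an integral
    would give is discarded. *)
Lemma taylor_step g (P P' : R -> R) (e : R) N y : smooth_on U g -> U y -> 0 <= e ->
  (forall s : R, is_derive s 1 P (P' s)) -> g (drop_coord y) = P 0 ->
  (forall s : R, `|s| <= `|y 0 i0| ->
    `|partial i0 g (s *: delta_mx 0 i0 + drop_coord y) - P' s| <= e * `|s| ^+ N) ->
  `|g y - P (y 0 i0)| <= e * `|y 0 i0| ^+ N.+1.
Proof.
move=> sg Uy e0 dP g0 gP.
have dg (s : R) : `|s| <= `|y 0 i0| -> differentiable g (s *: delta_mx 0 i0 + drop_coord y).
  by move=> sy; exact: smooth_on_diff sg (starU Uy sy).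
pose G (s : R) := g (s *: delta_mx 0 i0 + drop_coord y) - P s.
have dG (s : R) : `|s| <= `|y 0 i0| ->
    is_derive s 1 G (partial i0 g (s *: delta_mx 0 i0 + drop_coord y) - P' s).
  move=> sy; apply: is_deriveB; apply: is_derive_line.
  exact/diff_derivable/dg.
have [s|s sy E] := @mvt_line _ R^o G 0 1 (y 0 i0).
  by rewrite addr0 [s *: _]mulr1 => sy; have [] := dG s sy.
move: E; rewrite !addr0 ![_ *: (1 : R^o)]mulr1 /G drop_coordK scale0r add0r g0 subrr subr0.
have -> : 'D_(1 : R^o) (G : R^o -> R) s = _ := @derive_val _ _ _ _ _ _ _ (dG s sy).
move=> ->; rewrite normrM exprS mulrCA ler_wpM2l//.
apply: le_trans (gP s sy) _; rewrite ler_wpM2l//.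
by rewrite lerXn2r ?nnegrE.
Qed.

Lemma is_derive_monomial (c : R) m (s : R) :
  is_derive s 1 (fun t => c * (t ^+ m.+1 / m.+1`!%:R)) (c * (s ^+ m / m`!%:R)).
Proof.
rewrite (_ : c * _ = c *: ((m.+1`!%:R)^-1 *: (m.+1%:R * s ^+ m *: (1 : R)))); last first.
  rewrite factS natrM invfM -!/(_ * _) -![_ *: _]/(_ * _) mulr1.
  have m0 : (m.+1%:R : R) != 0 by rewrite pnatr_eq0.
  have f0 : (m`!%:R : R) != 0 by rewrite pnatr_eq0 -lt0n fact_gt0.
  by move: (m.+1%:R : R) m0 (m`!%:R : R) f0 => a a0 b b0; field; rewrite a0 b0.
rewrite (_ : (fun t => _) = c \*: ((m.+1`!%:R)^-1 \*: (id ^+ m.+1 : R -> R))); last first.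
  apply/funext => t; rewrite exprfctE -[RHS]/(c * ((m.+1`!%:R)^-1 * t ^+ m.+1)).
  by rewrite [_ / _]mulrC.
by apply: is_deriveZ; apply: is_deriveZ.
Qed.

Lemma taylor1 N g (c e : R) y : smooth_on U g -> U y -> 0 <= e ->
  (forall m, (m < N)%N -> normal_deriv m g (drop_coord y) = 0) ->
  (forall s : R, `|s| <= `|y 0 i0| ->
     `|normal_deriv N g (s *: delta_mx 0 i0 + drop_coord y) - c| <= e) ->
  `|g y - c * (y 0 i0 ^+ N / N`!%:R)| <= e * `|y 0 i0| ^+ N.
Proof.
elim: N g y => [|N IH] g y sg Uy e0 g0 gc.
  by rewrite fact0 expr0 divr1 !mulr1 -{1}[y]drop_coordK; exact: gc.
apply: (@taylor_step g (fun s => c * (s ^+ N.+1 / N.+1`!%:R))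
  (fun s => c * (s ^+ N / N`!%:R))) => //.
- by move=> s; exact: is_derive_monomial.
- have -> : g (drop_coord y) = 0 := g0 0%N isT.
  by rewrite expr0n /= mul0r mulr0.
move=> s sy; have Us := starU Uy sy.
have := IH (partial i0 g) (s *: delta_mx 0 i0 + drop_coord y) (smooth_on_partial _ sg) Us e0.
rewrite line_coord0 drop_coord_line; apply.
  by move=> m mN; have := g0 m.+1 mN; rewrite /normal_deriv iterSr.
move=> r rs; have := gc r (le_trans rs sy).
by rewrite /normal_deriv iterSr.
Qed.

(** One order beyond [taylor1], keeping the coefficient of order N: this precision is what the
    normal derivative of [quot N g] on the hyperplane requires. *)
Lemma taylor2 N g (c e : R) y : smooth_on U g -> U y -> 0 <= e ->
  (forall m, (m < N)%N -> normal_deriv m g (drop_coord y) = 0) ->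
  (forall s : R, `|s| <= `|y 0 i0| ->
     `|normal_deriv N.+1 g (s *: delta_mx 0 i0 + drop_coord y) - c| <= e) ->
  `|g y - (normal_deriv N g (drop_coord y) * (y 0 i0 ^+ N / N`!%:R)
     + c * (y 0 i0 ^+ N.+1 / N.+1`!%:R))| <= e * `|y 0 i0| ^+ N.+1.
Proof.
elim: N g y => [|N IH] g y sg Uy e0 g0 gc.
  apply: (@taylor_step g (fun s => g (drop_coord y) * (s ^+ 0 / 0`!%:R) + c * (s ^+ 1 / 1`!%:R))
    (fun s => 0 + c * (s ^+ 0 / 0`!%:R))) => //.
  - move=> s; apply: is_deriveD; last exact: is_derive_monomial.
    by under eq_fun do rewrite expr0; exact: is_derive_cst.
  - by rewrite expr0 expr1 fact0 divr1 mulr1 mul0r mulr0 addr0.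
  - by move=> s sy; rewrite expr0 fact0 divr1 !mulr1 add0r; exact: gc.
apply: (@taylor_step g
  (fun s => normal_deriv N.+1 g (drop_coord y) * (s ^+ N.+1 / N.+1`!%:R) + c * (s ^+ N.+2 / N.+2`!%:R))
  (fun s => normal_deriv N.+1 g (drop_coord y) * (s ^+ N / N`!%:R) + c * (s ^+ N.+1 / N.+1`!%:R))) => //.
- by move=> s; apply: is_deriveD; exact: is_derive_monomial.
- have -> : g (drop_coord y) = 0 := g0 0%N isT.
  by rewrite !expr0n /= !mul0r !mulr0 addr0.
move=> s sy; have Us := starU Uy sy.
have := IH (partial i0 g) (s *: delta_mx 0 i0 + drop_coord y) (smooth_on_partial _ sg) Us e0.
have e1 m z : normal_deriv m (partial i0 g) z = normal_deriv m.+1 g z by rewrite /normal_deriv iterSr.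
rewrite line_coord0 drop_coord_line (e1 N (drop_coord y)); apply.
  by move=> m mN; rewrite e1; exact: g0.
by move=> r rs; rewrite (e1 N.+1); exact: gc (le_trans rs sy).
Qed.

End Hadamard.

Section HadamardQuotient.
Context {R : realType} {n : nat}.
Variables (i0 : 'I_n) (U : set 'rV[R]_n).
Implicit Types (f g : 'rV[R]_n -> R) (x y : 'rV[R]_n).
Hypotheses (oU : open U) (starU : star_shaped i0 U).
Notation d_i0 := (normal_deriv i0).
Notation quot := (quot i0).
Notation vanishes := (vanishes i0 U).

Lemma fact_neq0 (N : nat) : (N`!%:R : R) != 0.
Proof. by rewrite pnatr_eq0 -lt0n fact_gt0. Qed.

Lemma fact_ge1 (N : nat) : 1 <= (N`!%:R : R).
Proof. by rewrite ler1n fact_gt0. Qed.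

Lemma drop_coord_in y : U y -> U (drop_coord i0 y).
Proof.
by move=> Uy; have := starU Uy (s := 0); rewrite scale0r add0r normr0; exact.
Qed.

Lemma drop_coord_coord y : drop_coord i0 y 0 i0 = 0.
Proof. by rewrite !mxE !eqxx mulr1 subrr. Qed.

Lemma vanishes_drop N g y : vanishes N g -> U y ->
  forall m, (m < N)%N -> d_i0 m g (drop_coord i0 y) = 0.
Proof.
move=> vg Uy m mN; apply: vg => //; first exact: drop_coord_in.
exact: drop_coord_coord.
Qed.

Lemma line_dist x y (s : R) : x 0 i0 = 0 -> `|s| <= `|y 0 i0| ->
  `|s *: delta_mx 0 i0 + drop_coord i0 y - x| <= `|y - x|.
Proof.
move=> x0 sy; apply/rV_norm_le => // j; rewrite !mxE eqxx /=.
have [->|ji] := eqVneq j i0; last first.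
  rewrite !mulr0 add0r subr0; have := rV_coord_le (y - x) j; by rewrite !mxE.
rewrite !mulr1 subrr addr0 x0 subr0; apply: le_trans sy _.
by have := rV_coord_le (y - x) i0; rewrite !mxE x0 subr0.
Qed.

Lemma smooth_coord V (i : 'I_n) : smooth_on V (fun y : 'rV[R]_n => y 0 i).
Proof.
apply/smooth_onP => -[|m]; split=> //; try by move=> *; exact: differentiable_coord.
move=> j; rewrite (_ : partial j _ = fun=> ((delta_mx 0 j : 'rV[R]_n) 0 i)).
  exact: diff_upto_cst.
apply/funext => x; rewrite /partial /derive; apply: cvg_lim => //.
apply: cvg_near_cst; near=> t => /=.
have -> : (t *: (delta_mx 0 j : 'rV[R]_n) + x) 0 i - x 0 i = t * (delta_mx 0 j : 'rV[R]_n) 0 i.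
  by rewrite mxE [X in X + _ - _]mxE addrK.
rewrite -[_ *: _]/(t^-1 * (t * _)) mulKf//.
by near: t; exact: nbhs_dnbhs_neq.
Unshelve. all: by end_near. Qed.

Lemma quot_off N g y : y 0 i0 != 0 -> quot N g y = g y / y 0 i0 ^+ N.
Proof. by rewrite /quot => /negbTE ->. Qed.

Lemma quot_on N g y : y 0 i0 = 0 -> quot N g y = d_i0 N g y / N`!%:R.
Proof. by rewrite /quot => ->; rewrite eqxx. Qed.

Lemma near_coord_neq0 y : y 0 i0 != 0 -> nbhs y [set z : 'rV[R]_n | z 0 i0 != 0].
Proof.
move=> y0; have := @coord_continuous R 1 n 0 i0 y.
move=> /cvgrPdist_lt /(_ `|y 0 i0|); rewrite normr_gt0 => /(_ y0).
apply: filterS => z; apply: contraTneq => ->.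
by rewrite subr0 ltxx.
Qed.

(** At a point y of the hyperplane, [taylor1] with c the normal derivative of order N at y bounds
    the variation of the quotient by the oscillation of that derivative near y. *)
Lemma continuous_quot N g y : smooth_on U g -> vanishes N g -> U y ->
  {for y, continuous (quot N g)}.
Proof.
move=> sg vg Uy; have [y0|y0] := eqVneq (y 0 i0) 0; last first.
  apply: (@differentiable_continuous _ _ R^o).
  apply: (@near_eq_differentiable _ _ _ (fun z => g z * (z 0 i0 ^+ N)^-1)).
    by apply: filterS (near_coord_neq0 y0) => z z0; rewrite quot_off.
  apply: differentiableM; first exact: smooth_on_diff sg Uy.
  apply: differentiableV; last by rewrite expf_neq0.
  by apply: smooth_on_diff Uy; apply: smooth_onX => //; exact: smooth_coord.
apply: (iffRL (@cvgrPdist_le _ _ _ (nbhs y) _ (quot N g) (quot N g y))) => e e0.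
have cN : {for y, continuous (d_i0 N g)}.
  by apply: smooth_on_continuous Uy; exact: smooth_normal_deriv.
have [d d0 dN] := continuous_pair_ball oU Uy cN cN e0.
near=> z; have zd : `|z - y| < d.
  by near: z; have := @near_ball _ _ y _ d0; apply: filterS => z; rewrite -ball_normE /ball_/= distrC.
have [Uz zN _] := dN z zd; rewrite (quot_on _ _ y0).
have [z0|z0] := eqVneq (z 0 i0) 0.
  rewrite quot_on// -mulrBl normrM normfV (ger0_norm (ler0n _ _)).
  rewrite ler_pdivrMr ?ltr0n ?fact_gt0//; apply: le_trans zN _.
  by rewrite ler_peMr ?fact_ge1// ltW.
have zN0 : z 0 i0 ^+ N != 0 by rewrite expf_neq0.
have := @taylor1 _ _ i0 U starU N g (d_i0 N g y) e z sg Uz (ltW e0) (vanishes_drop vg Uz).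
rewrite quot_off// => T.
have -> : d_i0 N g y / N`!%:R - g z / z 0 i0 ^+ N =
   - ((g z - d_i0 N g y * (z 0 i0 ^+ N / N`!%:R)) / z 0 i0 ^+ N).
  move: (d_i0 N g y) (g z) (z 0 i0 ^+ N) zN0 (N`!%:R : R) (fact_neq0 N) => a b c c0 f f0.
  by field; rewrite c0 f0.
rewrite normrN normrM normfV ler_pdivrMr ?normr_gt0// [X in _ <= _ * X]normrX.
apply: T => s sz; rewrite distrC.
have [//|_ H _] := dN (s *: delta_mx 0 i0 + drop_coord i0 z).
by apply: le_lt_trans (line_dist y0 sz) zd.
Unshelve. all: by end_near. Qed.

Lemma normal_deriv_partial m g i y : smooth_on U g -> U y ->
  d_i0 m (partial i g) y = partial i (d_i0 m g) y.
Proof.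
move=> sg; elim: m y => [//|m IH] y Uy /=.
apply: (etrans (partial_eq i0 oU IH Uy)).
apply: (partialC _ _ oU _ Uy); exact: smooth_normal_deriv.
Qed.

Lemma partial_coord i y : partial i (fun z : 'rV[R]_n => z 0 i0) y = (i == i0)%:R.
Proof.
rewrite partialE; last exact: differentiable_coord.
rewrite -(deriveE _ (differentiable_coord _ _ _)) /derive; apply: cvg_lim => //.
apply: cvg_near_cst; near=> t => /=.
have -> : (t *: (delta_mx 0 i : 'rV[R]_n) + y) 0 i0 - y 0 i0 = t * (i == i0)%:R.
  by rewrite mxE [X in X + _ - _]mxE addrK mxE eqxx /= eq_sym.
rewrite -[_ *: _]/(t^-1 * (t * _)) mulKf//.
by near: t; exact: nbhs_dnbhs_neq.
Unshelve. all: by end_near. Qed.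

(* The numerator of the normal derivative of g / y_i0 ^ N. *)
Definition euler (N : nat) g y : R := y 0 i0 * partial i0 g y - N%:R * g y.

Lemma smooth_euler N g : smooth_on U g -> smooth_on U (euler N g).
Proof.
move=> sg; apply: smooth_onB => //; last exact: smooth_onZ.
by apply: smooth_onM => //; [exact: smooth_coord|exact: smooth_on_partial].
Qed.

Lemma normal_deriv_euler N m g y : smooth_on U g -> U y ->
  d_i0 m (euler N g) y = y 0 i0 * d_i0 m.+1 g y + (m%:R - N%:R) * d_i0 m g y.
Proof.
move=> sg; elim: m y => [|m IH] y Uy; first by rewrite /= sub0r mulNr.
pose c : R := m%:R - N%:R.
have sm k : smooth_on U (d_i0 k g) by exact: smooth_normal_deriv.
have dm k : differentiable (d_i0 k g) y by exact: smooth_on_diff (sm k) Uy.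
have dc : differentiable (fun z : 'rV[R]_n => z 0 i0) y by exact: differentiable_coord.
rewrite -[LHS]/(partial i0 (d_i0 m (euler N g)) y).
apply: (etrans (partial_eq i0 oU IH Uy)).
have E1 := partialM i0 dc (dm m.+1); have E2 := partialZ (m%:R - N%:R) i0 (dm m).
apply: (etrans (partialD i0 (differentiableM dc (dm m.+1)) (differentiableZ c (dm m)))).
apply: (etrans (congr2 +%R E1 E2)); rewrite partial_coord eqxx mulr1 -(natr1 m).
rewrite -[partial i0 (d_i0 m.+1 g) y]/(d_i0 m.+2 g y) -[partial i0 (d_i0 m g) y]/(d_i0 m.+1 g y).
by move: (d_i0 m.+2 g y) (d_i0 m.+1 g y) => a b; ring.
Qed.

(** The factor m - N in [normal_deriv_euler] kills the derivative of order m = N, the only new one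
    that must vanish. *)
Lemma vanishes_euler N g : smooth_on U g -> vanishes N g -> vanishes N.+1 (euler N g).
Proof.
move=> sg vg m y; rewrite ltnS leq_eqVlt => /orP[/eqP->|mN] Uy y0;
  rewrite normal_deriv_euler// y0 mul0r add0r ?subrr ?mul0r//.
by rewrite vg// mulr0.
Qed.

Lemma line_coord_neq i y (t : R) : i != i0 -> (t *: delta_mx 0 i + y) 0 i0 = y 0 i0.
Proof. by move=> ii0; rewrite !mxE eqxx /= eq_sym (negbTE ii0) mulr0 add0r. Qed.

Lemma near_line v y : U y -> \forall t \near (0 : R), U (t *: v + y).
Proof.
move=> Uy; have : (fun t : R => t *: v + y) @ (0 : R) --> 0 *: v + y.
  apply: cvgD; last exact: cvg_cst.
  by apply: cvgZr_tmp; exact: cvg_id.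
rewrite scale0r add0r => H; exact: H (near_open oU Uy).
Qed.

Lemma vanishes_partial N g i : i != i0 -> smooth_on U g -> vanishes N g ->
  vanishes N (partial i g).
Proof.
move=> ii0 sg vg m y mN Uy y0; rewrite normal_deriv_partial//.
have N0 : \forall t \near (0 : R), d_i0 m g (t *: delta_mx 0 i + y) = 0.
  apply: filterS (near_line (delta_mx 0 i) Uy) => t Ut.
  by apply: vg => //; rewrite line_coord_neq.
have [E _] := @derive_line_eq _ _ (d_i0 m g) (fun=> 0) y (delta_mx 0 i) N0.
exact: (etrans E (derive_cst _ _ _)).
Qed.

(** Along a direction other than i0 the denominator is constant, and a line starting on the
    hyperplane stays in it. There the claim is the commutation of [partial i] with normal
    derivatives. *)
Lemma partial_quot_tangential N g i y : i != i0 -> smooth_on U g -> U y ->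
  derivable (quot N g) y (delta_mx 0 i) /\
  partial i (quot N g) y = quot N (partial i g) y.
Proof.
move=> ii0 sg Uy; have [y0|y0] := eqVneq (y 0 i0) 0.
  have dg : differentiable (d_i0 N g) y.
    by apply: smooth_on_diff Uy; exact: smooth_normal_deriv.
  have N0 : \forall t \near (0 : R), N`!%:R^-1 * d_i0 N g (t *: delta_mx 0 i + y) =
      quot N g (t *: delta_mx 0 i + y).
    by near=> t; rewrite quot_on ?line_coord_neq// mulrC.
  have [E D] := @derive_line_eq _ _ (fun z => N`!%:R^-1 * d_i0 N g z) _ _ _ N0.
  split; first by apply: D; apply: derivableM => //; exact: diff_derivable.
  apply: (etrans (esym E)); apply: (etrans (partialZ _ i dg)).
  by rewrite quot_on// normal_deriv_partial// mulrC.
have dg : differentiable g y by exact: smooth_on_diff sg Uy.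
have N0 : \forall t \near (0 : R), (y 0 i0 ^+ N)^-1 * g (t *: delta_mx 0 i + y) =
    quot N g (t *: delta_mx 0 i + y).
  by near=> t; rewrite quot_off ?line_coord_neq// mulrC.
have [E D] := @derive_line_eq _ _ (fun z => (y 0 i0 ^+ N)^-1 * g z) _ _ _ N0.
split; first by apply: D; apply: derivableM => //; exact: diff_derivable.
apply: (etrans (esym E)); apply: (etrans (partialZ _ i dg)).
by rewrite quot_off// mulrC.
Unshelve. all: by end_near. Qed.

End HadamardQuotient.

Section HadamardSmooth.
Context {R : realType} {n : nat}.
Variables (i0 : 'I_n) (U : set 'rV[R]_n).
Implicit Types (f g : 'rV[R]_n -> R) (x y : 'rV[R]_n).
Hypotheses (oU : open U) (starU : star_shaped i0 U).
Notation d_i0 := (normal_deriv i0).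
Notation quot := (quot i0).
Notation vanishes := (vanishes i0 U).

(** Off the hyperplane this is the quotient rule. On it, [taylor2] shows that the difference
    quotient tends to the Taylor coefficient of order N + 1 of g; this is the value of the
    right-hand side, since the factor m - N equals 1 at m = N + 1. *)
Lemma partial_quot_normal N g y : smooth_on U g -> vanishes N g -> U y ->
  derivable (quot N g) y (delta_mx 0 i0) /\
  partial i0 (quot N g) y = quot N.+1 (euler i0 N g) y.
Proof.
move=> sg vg Uy; have dg : differentiable g y by exact: smooth_on_diff sg Uy.
have [y0|y0] := eqVneq (y 0 i0) 0; last first.
  have cN0 : y 0 i0 ^+ N != 0 by rewrite expf_neq0.
  pose pw (z : 'rV[R]_n) := z 0 i0 ^+ N.
  have dp : differentiable pw y.
    by apply: (smooth_on_diff (U := U)) => //; apply: smooth_onX => //; exact: smooth_coord.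
  have dpV : derivable (fun z => (pw z)^-1) y (delta_mx 0 i0).
    by apply: derivableV => //; exact: diff_derivable.
  have N0 : \forall z \near y, g z * (pw z)^-1 = quot N g z.
    by apply: filterS (near_coord_neq0 y0) => z z0; rewrite quot_off.
  have dq : derivable (fun z => g z * (pw z)^-1) y (delta_mx 0 i0).
    by apply: derivableM dpV; exact: diff_derivable.
  split; first exact: near_eq_derivable N0 dq.
  have E1 := near_eq_derive (delta_mx 0 i0) N0.
  apply: (etrans (esym E1)).
  have E2 := deriveM (diff_derivable (v := delta_mx 0 i0) dg) dpV.
  have E3 := @deriveV _ _ pw y (delta_mx 0 i0) cN0 (diff_derivable dp).
  have E4 : 'D_(delta_mx 0 i0) pw y = N%:R * y 0 i0 ^+ N.-1.
    have := @deriveX _ _ (fun z : 'rV[R]_n => z 0 i0) N y (delta_mx 0 i0)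
      (diff_derivable (differentiable_coord _ _ _)).
    have pc : 'D_(delta_mx 0 i0) (fun z : 'rV[R]_n => z 0 i0) y = 1.
      by apply: (etrans (partial_coord i0 i0 y)); rewrite eqxx.
    rewrite exprfctE pc => E5; apply: (etrans E5).
    by rewrite -[_ *: _]/(_ * _) mulr1 mulr_natl.
  apply: (etrans E2); rewrite E3 E4 quot_off// /euler /partial.
  rewrite -![_ *: _]/(_ * _) exprS /pw.
  move: ('D_(delta_mx 0 i0) g y : R) (g y) => a b.
  case: N cN0 {vg pw dp dpV N0 dq E1 E2 E3 E4} => [|N] cN0.
    by rewrite expr0 !mul0r oppr0; field.
  have yN0 : y 0 i0 ^+ N != 0 by rewrite expf_neq0.
  rewrite expr1 /= !exprS; move: (N.+1%:R : R) (y 0 i0 ^+ N) yN0 => c p p0.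
  by field; rewrite y0 p0.
pose c := d_i0 N.+1 g y; pose L := c / N.+1`!%:R.
have lim : (fun t : R => t^-1 *: ((quot N g \o shift y) (t *: delta_mx 0 i0) - quot N g y))
    @ 0^' --> L.
  apply/cvgrPdist_le => e e0.
  have cN : {for y, continuous (d_i0 N.+1 g)}.
    by apply: smooth_on_continuous Uy; exact: smooth_normal_deriv.
  have [d d0 dN] := continuous_pair_ball oU Uy cN cN e0.
  near=> t => /=; have t0 : t != 0 by near: t; exact: nbhs_dnbhs_neq.
  have td : `|t| < d by near: t; exact: dnbhs0_lt.
  have near_y (s : R) : `|s| <= `|t| -> `|s *: delta_mx 0 i0 + y - y| < d.
    by move=> st; rewrite addrK; apply: le_lt_trans (norm_delta_le _ _) (le_lt_trans st td).
  have [Uty _ _] := dN _ (near_y t (lexx _)).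
  have c0 : (t *: delta_mx 0 i0 + y) 0 i0 = t.
    by rewrite -{1}(drop_coord_id y0) line_coord0.
  have dr : drop_coord i0 (t *: delta_mx 0 i0 + y) = y.
    by rewrite -{1}(drop_coord_id y0) drop_coord_line drop_coord_id.
  have := @taylor2 _ _ i0 U starU N g c e _ sg Uty (ltW e0) (vanishes_drop starU vg Uty).
  rewrite dr c0 => T.
  rewrite quot_off c0// quot_on// -[_ *: _]/(_ * _).
  set q := g _.
  have tN0 : t ^+ N.+1 != 0 by rewrite expf_neq0.
  have -> : L - t^-1 * (q / t ^+ N - d_i0 N g y / N`!%:R) =
     - ((q - (d_i0 N g y * (t ^+ N / N`!%:R) + c * (t ^+ N.+1 / N.+1`!%:R))) / t ^+ N.+1).
    rewrite /L exprS; have tN : t ^+ N != 0 by rewrite expf_neq0.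
    have f0 := @fact_neq0 R N; have f1 := @fact_neq0 R N.+1.
    move: (N`!%:R : R) (N.+1`!%:R : R) (t ^+ N) (d_i0 N g y) f0 f1 tN => a b p h a0 b0 p0.
    by field; rewrite a0 b0 t0 p0.
  rewrite normrN normrM normfV ler_pdivrMr ?normr_gt0// [X in _ <= _ * X]normrX.
  apply: T => s st; rewrite distrC.
  by have [_ H _] := dN _ (near_y s st).
split; first by apply/cvg_ex; exists L.
rewrite quot_on// (normal_deriv_euler i0 oU)// y0 mul0r add0r -natr1 addrAC subrr add0r mul1r.
exact: cvg_lim lim.
Unshelve. all: by end_near. Qed.

(** N is left free because the normal derivative raises it by one: the class is stable under all
    partial derivatives, whereas the quotients with N = 1 alone are not. *)
Definition hadamard_class f :=
  exists N g, [/\ smooth_on U g, vanishes N g & forall y, U y -> f y = quot N g y].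

Lemma derivable_eq f g i y : (forall z, U z -> f z = g z) -> U y ->
  derivable g y (delta_mx 0 i) -> derivable f y (delta_mx 0 i).
Proof.
move=> fg Uy; apply: near_eq_derivable.
by apply: filterS (near_open oU Uy) => z /fg.
Qed.

Lemma hadamard_class_partial f i : hadamard_class f ->
  (forall y, U y -> derivable f y (delta_mx 0 i)) /\ hadamard_class (partial i f).
Proof.
move=> [N [g [sg vg fE]]]; have [->|ii0] := eqVneq i i0.
  split=> [y Uy|].
    by apply: (derivable_eq fE Uy); have [] := partial_quot_normal sg vg Uy.
  exists N.+1, (euler i0 N g); split; [exact: smooth_euler|exact: vanishes_euler|].
  move=> y Uy; apply: (etrans (partial_eq i0 oU fE Uy)).
  by have [] := partial_quot_normal sg vg Uy.
split=> [y Uy|].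
  by apply: (derivable_eq fE Uy); have [] := partial_quot_tangential oU N ii0 sg Uy.
exists N, (partial i g); split; [exact: smooth_on_partial|exact: vanishes_partial|].
move=> y Uy; apply: (etrans (partial_eq i oU fE Uy)).
by have [] := partial_quot_tangential oU N ii0 sg Uy.
Qed.

Lemma hadamard_class_continuous f y : hadamard_class f -> U y -> {for y, continuous f}.
Proof.
move=> [N [g [sg vg fE]]] Uy.
have H1 : quot N g z @[z --> y] --> quot N g y := continuous_quot oU starU sg vg Uy.
have H2 : {near y, quot N g =1 f}.
  by apply: filterS (near_open oU Uy) => z /fE.
suff : f z @[z --> y] --> f y by [].
rewrite (fE y Uy); exact: (cvg_trans (near_eq_cvg H2) H1).
Qed.

Lemma hadamard_class_diff f y : hadamard_class f -> U y -> differentiable f y.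
Proof.
move=> hf Uy; apply: differentiable_partials.
  apply: filterS (near_open oU Uy) => z Uz i.
  by have [+ _] := hadamard_class_partial i hf; exact.
move=> i; have [_ hp] := hadamard_class_partial i hf.
exact: hadamard_class_continuous hp Uy.
Qed.

Lemma hadamard_class_smooth f : hadamard_class f -> smooth_on U f.
Proof.
move=> hf; apply/smooth_onP => m; elim: m f hf => [|m IH] f hf; split => //;
  try by move=> x Ux; exact: hadamard_class_diff.
by move=> i; apply: IH; have [] := hadamard_class_partial i hf.
Qed.

Lemma smooth_quot g : smooth_on U g -> (forall y, U y -> y 0 i0 = 0 -> g y = 0) ->
  smooth_on U (quot 1 g).
Proof.
move=> sg g0; apply: hadamard_class_smooth; exists 1%N, g; split=> //.
by move=> [|//] y _; exact: g0.
Qed.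

End HadamardSmooth.

(** * The Laplacian in coordinates *)

Section SmoothMatrix.
Context {R : realType} {n : nat}.
Implicit Types (f g : 'rV[R]_n -> R) (U : set 'rV[R]_n).

Definition smooth_mx_on U m p (A : 'rV[R]_n -> 'M[R]_(m, p)) :=
  forall i j, smooth_on U (fun x => A x i j).

Lemma smooth_det U m (A : 'rV[R]_n -> 'M[R]_m) : open U -> smooth_mx_on U A ->
  smooth_on U (fun x => \det (A x)).
Proof.
move=> oU sA; apply: smooth_on_sum => // s; apply: smooth_onZ => //.
by apply: smooth_on_prod => // i; exact: sA.
Qed.

Lemma is_derive_inv_pow m (x : R) : x != 0 ->
  is_derive x 1 (fun t : R => (-1) ^+ m * m`!%:R * t ^- m.+1)
    ((-1) ^+ m.+1 * m.+1`!%:R * x ^- m.+2).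
Proof.
move=> x0; have xX : x ^+ m.+1 != 0 by rewrite expf_neq0.
have dX : is_derive x 1 (fun t : R => t ^+ m.+1) (m.+1%:R * x ^+ m).
  have H := @is_deriveX _ _ (id : R -> R) m.+1 x 1 1 (is_derive_id _ _).
  rewrite exprfctE in H.
  by apply: is_derive_eq H _; rewrite -[_ *: _]/(_ * _) mulr1.
have dV := @is_deriveV _ (fun t : R => t ^+ m.+1) x _ 1 xX dX.
have dZ := @is_deriveZ _ _ _ _ ((-1) ^+ m * m`!%:R) x 1 _ dV.
suff <- : ((-1) ^+ m * m`!%:R) *: (- (x ^+ m.+1) ^- 2 *: (m.+1%:R * x ^+ m)) =
  (-1) ^+ m.+1 * m.+1`!%:R * x ^- m.+2 by exact: dZ.
rewrite -![_ *: _]/(_ * _) factS natrM.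
rewrite expr2 !exprS; have xm : x ^+ m != 0 by rewrite expf_neq0.
move: (m.+1%:R : R) (m`!%:R : R) (x ^+ m) xm ((-1 : R) ^+ m) => a b c c0 d.
by field; rewrite x0 c0.
Qed.

Lemma smooth_on_inv U f : open U -> (forall x, U x -> f x != 0) -> smooth_on U f ->
  smooth_on U (fun x => (f x)^-1).
Proof.
move=> oU f0 sf.
pose psi m (t : R) := (-1) ^+ m * m`!%:R * t ^- m.+1.
have dpsi : derivatives_on [set t | t != 0] psi.
  by move=> m t t0; exact: is_derive_inv_pow.
have := smooth_on_comp1 oU dpsi f0 sf; congr smooth_on.
by apply/funext => x; rewrite /psi expr0 fact0 !mul1r expr1.
Qed.

Lemma smooth_invmx U m (A : 'rV[R]_n -> 'M[R]_m) : open U -> smooth_mx_on U A ->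
  (forall x, U x -> A x \in unitmx) -> smooth_mx_on U (fun x => invmx (A x)).
Proof.
move=> oU sA uA i j.
apply: (@smooth_on_eq _ _ _ (fun x => (\det (A x))^-1 * (\adj (A x)) i j)) => //.
  by move=> x Ux; rewrite /invmx uA// [RHS]mxE.
apply: smooth_onM => //.
  apply: smooth_on_inv => //; last exact: smooth_det.
  by move=> x Ux; rewrite -unitfE; have := uA x Ux; rewrite unitmxE.
have -> : (fun x => (\adj (A x)) i j) =
    fun x => (-1) ^+ (j + i) * \det (row' j (col' i (A x))).
  by apply/funext => x; rewrite mxE.
apply: smooth_onZ => //; apply: smooth_det => // a b.
have -> : (fun x => row' j (col' i (A x)) a b) = fun x => A x (lift j a) (lift i b).
  by apply/funext => x; rewrite !mxE.
exact: sA.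
Qed.

Lemma posdef_unitmx m (A : 'M[R]_m) :
  (forall v : 'rV_m, v != 0 -> 0 < (v *m A *m v^T) 0 0) -> A \in unitmx.
Proof.
move=> pA; rewrite -row_free_unit; apply/inj_row_free => v vA.
apply/eqP; apply: contraTT isT => /pA; by rewrite vA mul0mx mxE ltxx.
Qed.

End SmoothMatrix.

Section LaplacianSmooth.
Context {R : realType} {n : nat}.
Implicit Types (f g : 'rV[R]_n -> R) (U : set 'rV[R]_n) (G : 'rV[R]_n -> 'M[R]_n).

Record metric_on U G : Prop := MetricOn {
  metric_on_open : open U;
  metric_on_smooth : smooth_mx_on U G;
  metric_on_sym : forall x, U x -> (G x)^T = G x;
  metric_on_unit : forall x, U x -> G x \in unitmx }.

Lemma metric_on_sub U V G : open V -> V `<=` U -> metric_on U G -> metric_on V G.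
Proof.
move=> oV VU [oU sG yG uG]; split=> // [i j|x /VU|x /VU]; [|exact: yG|exact: uG].
exact: smooth_onS (sG i j).
Qed.

Lemma smooth_christoffel U G l i j : metric_on U G -> smooth_on U (christoffel G l i j).
Proof.
move=> [oU sG _ uG]; apply: smooth_onZ => //; apply: smooth_on_sum => // m.
apply: smooth_onM => //; first exact: smooth_invmx.
apply: smooth_onB => //; last exact: smooth_on_partial.
by apply: smooth_onD => //; exact: smooth_on_partial.
Qed.

Lemma hessianE G f x i j : hessian G f x i j =
  partial i (partial j f) x - \sum_l christoffel G l i j x * partial l f x.
Proof. by rewrite mxE. Qed.

Lemma smooth_laplacian U G f : metric_on U G -> smooth_on U f ->
  smooth_on U (coord_laplacian G f).
Proof.
move=> mG sf; have [oU sG _ uG] := mG.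
apply: smooth_on_sum => // i; apply: smooth_on_sum => // j.
apply: smooth_onM => //; first exact: smooth_invmx.
have -> : (fun x => hessian G f x i j) = fun x =>
    partial i (partial j f) x - \sum_l christoffel G l i j x * partial l f x.
  by apply/funext => x; rewrite hessianE.
apply: smooth_onB => //; first by do 2 apply: smooth_on_partial.
apply: smooth_on_sum => // l; apply: smooth_onM => //; first exact: smooth_christoffel.
exact: smooth_on_partial.
Qed.

Lemma laplacian_eq U G f g x : open U -> U x -> (forall y, U y -> f y = g y) ->
  coord_laplacian G f x = coord_laplacian G g x.
Proof.
move=> oU Ux fg; apply: eq_bigr => i _; apply: eq_bigr => j _.
have H1 : partial i (partial j f) x = partial i (partial j g) x.
  by apply: (partial_eq i oU _ Ux) => y Uy; exact: partial_eq fg Uy.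
have H2 l : partial l f x = partial l g x by exact: partial_eq fg Ux.
have H3 : \sum_l christoffel G l i j x * partial l f x =
    \sum_l christoffel G l i j x * partial l g x.
  by apply: eq_bigr => l _; exact: congr2.
have H4 := etrans (hessianE G f x i j) (congr2 (fun a b => a - b) H1 H3).
exact: (congr1 ( *%R (invmx (G x) i j)) (etrans H4 (esym (hessianE G g x i j)))).
Qed.

Lemma laplacian_comb U G (c d : R) f g x : open U -> U x -> smooth_on U f -> smooth_on U g ->
  coord_laplacian G (fun y => c * f y + d * g y) x =
  c * coord_laplacian G f x + d * coord_laplacian G g x.
Proof.
move=> oU Ux sf sg.
have P1 i p q y : smooth_on U p -> smooth_on U q -> U y ->
    partial i (fun y => c * p y + d * q y) y = c * partial i p y + d * partial i q y.
  move=> sp sq Uy; have dp := smooth_on_diff sp Uy; have dq := smooth_on_diff sq Uy.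
  by rewrite -(partialZ c i dp) -(partialZ d i dq); apply: partialD;
    apply: differentiableM.
rewrite /coord_laplacian !mulr_sumr -big_split; apply: eq_bigr => i _.
rewrite !mulr_sumr -big_split; apply: eq_bigr => j _ /=.
have H1 : partial i (partial j (fun y => c * f y + d * g y)) x =
    c * partial i (partial j f) x + d * partial i (partial j g) x.
  apply: (etrans (partial_eq i oU (fun y => P1 j f g y sf sg) Ux)).
  by apply: P1 => //; exact: smooth_on_partial.
have H2 : \sum_l christoffel G l i j x * partial l (fun y => c * f y + d * g y) x =
    c * (\sum_l christoffel G l i j x * partial l f x) +
    d * (\sum_l christoffel G l i j x * partial l g x).
  rewrite !mulr_sumr -big_split; apply: eq_bigr => l _ /=.
  rewrite (P1 l f g x sf sg Ux) mulrDr; congr (_ + _); exact: mulrCA.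
have H3 := congr2 (fun a b => a - b) H1 H2.
rewrite (etrans (hessianE _ _ _ _ _) H3) !hessianE.
move: (partial i _ x) (partial i _ x) (\sum_l _) (\sum_l _) => a b a' b'.
by ring.
Qed.

End LaplacianSmooth.

(** * Transformation of Christoffel symbols, Hessian and Laplacian under a change of coordinates *)

Section BilinearSums.
Context {R : realType} {n : nat}.
Implicit Types (u v w : 'I_n -> R) (B : 'I_n -> 'I_n -> R) (D : 'I_n -> 'I_n -> 'I_n -> R).

Definition bil B u v : R := \sum_b \sum_c B b c * (u b * v c).
Definition tril D w u v : R := \sum_d \sum_b \sum_c D d b c * (w d * (u b * v c)).

Lemma bil_sym B u v : (forall b c, B b c = B c b) -> bil B u v = bil B v u.
Proof.
move=> sB; rewrite /bil exchange_big; apply: eq_bigr => b _; apply: eq_bigr => c _.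
by rewrite sB [u c * _]mulrC.
Qed.

Lemma tril_christoffel D u v w :
  \sum_b \sum_c \sum_d 2^-1 * (D b c d + D c b d - D d b c) * (u b * (v c * w d)) =
  2^-1 * (tril D u v w + tril D v u w - tril D w u v).
Proof.
have E1 : tril D v u w = \sum_b \sum_c \sum_d D c b d * (u b * (v c * w d)).
  rewrite /tril exchange_big; do 3 (apply: eq_bigr => ? _).
  by congr (_ * _); exact: mulrCA.
have E2 : tril D w u v = \sum_b \sum_c \sum_d D d b c * (u b * (v c * w d)).
  rewrite /tril exchange_big; apply: eq_bigr => b _ /=.
  rewrite exchange_big; do 2 (apply: eq_bigr => ? _) => /=.
  by congr (_ * _); rewrite mulrCA; congr (_ * _); exact: mulrC.
rewrite E1 E2 -big_split -sumrB mulr_sumr; apply: eq_bigr => b _ /=.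
rewrite -big_split -sumrB mulr_sumr; apply: eq_bigr => c _ /=.
rewrite -big_split -sumrB mulr_sumr; apply: eq_bigr => d _ /=.
by rewrite -mulrA; congr (_ * _); rewrite mulrBl mulrDl.
Qed.

(** Of the six terms with second derivatives of the coordinate change, four cancel in pairs and two
    coincide, by symmetry of the metric and of second derivatives. *)
Lemma koszul_sum B (Hij Hji Him Hmi Hjm Hmj Ji Jj Jm : 'I_n -> R) (t1 t2 t3 p q r : R) :
  (forall b c, B b c = B c b) -> Hji = Hij -> Hmi = Him -> Hmj = Hjm ->
  p = bil B Hij Jm + bil B Jj Him + t1 ->
  q = bil B Hji Jm + bil B Ji Hjm + t2 ->
  r = bil B Hmi Jj + bil B Ji Hmj + t3 ->
  2^-1 * (p + q - r) = bil B Hij Jm + 2^-1 * (t1 + t2 - t3).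
Proof. by move=> sB -> -> -> -> -> ->; rewrite (bil_sym Him Jj sB); field. Qed.

Lemma mulmx_bil (A B : 'M[R]_n) i j : (A *m B *m A^T) i j = bil B (A i) (A j).
Proof.
rewrite mxE /bil exchange_big; apply: eq_bigr => c _.
rewrite mxE [X in _ * X]mxE mulr_suml; apply: eq_bigr => b _.
by rewrite mulrAC mulrC.
Qed.

Lemma bil_sub_contract B D (p : 'I_n -> R) u v :
  bil B u v - \sum_a (\sum_b \sum_c D a b c * (u b * v c)) * p a =
  bil (fun b c => B b c - \sum_a D a b c * p a) u v.
Proof.
have -> : \sum_a (\sum_b \sum_c D a b c * (u b * v c)) * p a =
    \sum_b \sum_c (\sum_a D a b c * p a) * (u b * v c).
  rewrite (eq_bigr (fun a => \sum_b \sum_c D a b c * p a * (u b * v c))).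
    rewrite exchange_big; apply: eq_bigr => b _; rewrite exchange_big.
    by apply: eq_bigr => c _; rewrite mulr_suml.
  move=> a _; rewrite mulr_suml; apply: eq_bigr => b _; rewrite mulr_suml.
  by apply: eq_bigr => c _; rewrite mulrAC.
rewrite /bil -sumrB; apply: eq_bigr => b _; rewrite -sumrB; apply: eq_bigr => c _.
by rewrite mulrBl.
Qed.

Lemma eq_bil B B' u v u' v' : (forall b c, B b c = B' b c) -> u =1 u' -> v =1 v' ->
  bil B u v = bil B' u' v'.
Proof.
by move=> BB' uu' vv'; do 2 (apply: eq_bigr => ? _); rewrite BB' uu' vv'.
Qed.

Lemma contract_mxtrace (A B : 'M[R]_n) :
  \sum_i \sum_j A i j * B i j = \tr (A^T *m B).
Proof.
rewrite /mxtrace exchange_big; apply: eq_bigr => j _.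
by rewrite mxE; apply: eq_bigr => i _; rewrite mxE.
Qed.

End BilinearSums.

Section Invariance.
Context {R : realType} {n : nat}.
Variables (U V : set 'rV[R]_n) (y : 'rV[R]_n -> 'rV[R]_n).
Variables (G G' : 'rV[R]_n -> 'M[R]_n).
Hypotheses (mG : metric_on U G) (mG' : metric_on V G').
Hypotheses (sy : smooth_map_on U y) (UV : forall x, U x -> V (y x)).
Hypothesis GE : forall x, U x -> G x = pullback G' y x.

Let oU := metric_on_open mG.
Let J i a x := partial i (fun z => y z 0 a) x.
Let H i j a x := partial i (partial j (fun z => y z 0 a)) x.

Let dy x j : U x -> differentiable (fun z => y z 0 j) x.
Proof. by move=> Ux; exact: smooth_on_diff (sy j) Ux. Qed.

Let sJ j a : smooth_on U (J j a).
Proof. exact: smooth_on_partial. Qed.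

Let dJ x j a : U x -> differentiable (J j a) x.
Proof. by move=> Ux; exact: smooth_on_diff (sJ j a) Ux. Qed.

Lemma partial_comp_map (f : 'rV[R]_n -> R) i x : smooth_on V f -> U x ->
  differentiable (f \o y) x /\
  partial i (f \o y) x = \sum_a J i a x * partial a f (y x).
Proof.
move=> sf Ux; apply: partial_comp; last by move=> j; exact: dy.
exact: smooth_on_diff sf (UV Ux).
Qed.

Lemma partial2_comp_map (f : 'rV[R]_n -> R) i j x : smooth_on V f -> U x ->
  partial i (partial j (f \o y)) x =
    \sum_a H i j a x * partial a f (y x)
    + bil (fun a b => partial a (partial b f) (y x)) (J i ^~ x) (J j ^~ x).
Proof.
move=> sf Ux.
have E1 : forall z, U z -> partial j (f \o y) z = \sum_a J j a z * (partial a f \o y) z.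
  by move=> z Uz; have [] := partial_comp_map j sf Uz.
apply: (etrans (partial_eq i oU E1 Ux)).
have dpf a : differentiable (partial a f \o y) x.
  by have [] := partial_comp_map i (smooth_on_partial a sf) Ux.
have E2 := partial_sum (index_enum 'I_n) xpredT i (fun a => differentiableM (dJ j a Ux) (dpf a)).
apply: (etrans E2); rewrite /bil exchange_big -big_split; apply: eq_bigr => a _ /=.
apply: (etrans (partialM i (dJ j a Ux) (dpf a))).
rewrite [RHS]addrC; apply: congr2; last exact: mulrC.
have [_ ->] := partial_comp_map i (smooth_on_partial a sf) Ux.
rewrite mulr_sumr; apply: eq_bigr => b _.
by move: (partial b _ _) (J i b x) (J j a x) => p q r; ring.
Qed.

Lemma metric_pullbackE i j x : U x ->
  G x i j = bil (fun b c => G' (y x) b c) (J i ^~ x) (J j ^~ x).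
Proof.
move=> Ux; rewrite GE// /pullback mxE /bil exchange_big; apply: eq_bigr => c _.
rewrite mxE [X in _ * X]mxE mulr_suml; apply: eq_bigr => b _.
have dk k : differentiable (fun z => y z 0 k) x by exact: dy.
rewrite (jacobianE i b dk) (jacobianE j c dk) -/(J i b x) -/(J j c x).
by move: (J i b x) (J j c x) => p q; ring.
Qed.

Lemma partial_metricE i j m x : U x ->
  partial i (fun z => G z j m) x =
    bil (fun b c => G' (y x) b c) (H i j ^~ x) (J m ^~ x)
    + bil (fun b c => G' (y x) b c) (J j ^~ x) (H i m ^~ x)
    + tril (fun d b c => partial d (fun z => G' z b c) (y x)) (J i ^~ x) (J j ^~ x) (J m ^~ x).
Proof.
move=> Ux.
have E1 z : U z -> G z j m = \sum_b \sum_c ((fun z => G' z b c) \o y) z * (J j b z * J m c z).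
  by move=> Uz; rewrite metric_pullbackE.
apply: (etrans (partial_eq i oU E1 Ux)).
have dG b c : differentiable ((fun z => G' z b c) \o y) x.
  by have [] := partial_comp_map i (metric_on_smooth mG' b c) Ux.
have dJJ b c : differentiable (fun z => J j b z * J m c z) x.
  by apply: differentiableM; exact: dJ.
have dF b c := differentiableM (dG b c) (dJJ b c).
have dS b := differentiable_sums (index_enum 'I_n) xpredT (dF b).
apply: (etrans (partial_sum (index_enum 'I_n) xpredT i dS)).
rewrite /bil /tril [X in _ + X]exchange_big -!big_split; apply: eq_bigr => b _ /=.
apply: (etrans (partial_sum (index_enum 'I_n) xpredT i (dF b))).
rewrite [X in _ + X]exchange_big -!big_split; apply: eq_bigr => c _ /=.
apply: (etrans (partialM i (dG b c) (dJJ b c))).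
have E2 := partialM i (dJ j b Ux) (dJ m c Ux).
have [_ E3] := partial_comp_map i (metric_on_smooth mG' b c) Ux.
rewrite E2 E3 mulr_sumr; apply: congr2.
  rewrite -/(H i m c x) -/(H i j b x) /=.
  by move: (H i m c x) (H i j b x) (J j b x) (J m c x) (G' _ _ _) => p q r s t; ring.
apply: eq_bigr => d _.
by move: (partial d _ _) (J i d x) (J j b x) (J m c x) => p q r s; ring.
Qed.

(** Christoffel symbols of the first kind. Their transformation law involves no inverse metric, so
    it is proved first. *)
Definition christoffel1 (g : 'rV[R]_n -> 'M[R]_n) (i j m : 'I_n) x : R := 2^-1 *
  (partial i (fun z => g z j m) x + partial j (fun z => g z i m) x
   - partial m (fun z => g z i j) x).

Lemma christoffelE (g : 'rV[R]_n -> 'M[R]_n) l i j x :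
  christoffel g l i j x = \sum_m invmx (g x) l m * christoffel1 g i j m x.
Proof. by rewrite /christoffel mulr_sumr; apply: eq_bigr => m _; exact: mulrCA. Qed.

Lemma christoffel1_pullback i j m x : U x ->
  christoffel1 G i j m x = bil (fun b c => G' (y x) b c) (H i j ^~ x) (J m ^~ x)
    + \sum_b \sum_c \sum_d christoffel1 G' b c d (y x) * (J i b x * (J j c x * J m d x)).
Proof.
move=> Ux; pose D d b c := partial d (fun z => G' z b c) (y x).
have -> := @tril_christoffel _ _ D (J i ^~ x) (J j ^~ x) (J m ^~ x).
have Ei := partial_metricE i j m Ux; have Ej := partial_metricE j i m Ux.
have Em := partial_metricE m i j Ux.
have sG b c : G' (y x) b c = G' (y x) c b.
  by have /matrixP/(_ c b) := metric_on_sym mG' (UV Ux); rewrite mxE.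
have sH k l a : H k l a x = H l k a x by exact: partialC (sy a) Ux.
have sHf k l : (fun a => H k l a x) = (fun a => H l k a x) by apply/funext => a; exact: sH.
exact: (koszul_sum sG (sHf j i) (sHf m i) (sHf m j) Ei Ej Em).
Qed.

Let Jm x : 'M[R]_n := \matrix_(i, a) J i a x.

Lemma pullback_jacobianE x : U x -> G x = Jm x *m G' (y x) *m (Jm x)^T.
Proof.
move=> Ux; rewrite GE// /pullback; suff -> : jacobian y x = Jm x by [].
apply/matrixP => i a; rewrite [RHS]mxE; apply: jacobianE => k; exact: dy.
Qed.

Lemma invmx_pullback x : U x -> (Jm x)^T *m invmx (G x) *m Jm x = invmx (G' (y x)).
Proof.
move=> Ux; have uG := metric_on_unit mG Ux; have uG' := metric_on_unit mG' (UV Ux).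
have E := pullback_jacobianE Ux.
have uJ : Jm x \in unitmx by move: uG; rewrite E !unitmx_mul => /andP[/andP[]].
have uJT : (Jm x)^T \in unitmx by rewrite unitmx_tr.
apply: (can_inj (mulmxK uG')); rewrite mulVmx//.
apply: (can_inj (mulmxK uJT)); rewrite mul1mx -!mulmxA (mulmxA (Jm x)) -E.
by rewrite mulVmx// mulmx1.
Qed.

(** The classical law, contracted with the Jacobian so that no inverse Jacobian occurs. The index of
    the law of the first kind is raised with [invmx_pullback], that is J^T G^-1 J = G'^-1. *)
Lemma christoffel_pullback i j a x : U x ->
  \sum_l christoffel G l i j x * J l a x = H i j a x +
    \sum_b \sum_c christoffel G' a b c (y x) * (J i b x * J j c x).
Proof.
move=> Ux; pose h : 'rV[R]_n := \row_b H i j b x.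
pose e : 'rV[R]_n := \row_d \sum_b \sum_c christoffel1 G' b c d (y x) * (J i b x * J j c x).
pose C : 'rV[R]_n := \row_m christoffel1 G i j m x.
pose Gam : 'rV[R]_n := \row_l christoffel G l i j x.
have CE : C = (h *m G' (y x) + e) *m (Jm x)^T.
  apply/rowP => m; rewrite mxE christoffel1_pullback// mxE.
  rewrite [RHS](eq_bigr (fun c => (\sum_b G' (y x) b c * (H i j b x * J m c x)) +
    \sum_b \sum_d christoffel1 G' b d c (y x) * (J i b x * (J j d x * J m c x)))).
    rewrite big_split /=; congr (_ + _); first by rewrite /bil exchange_big.
    rewrite [RHS]exchange_big; apply: eq_bigr => b _ /=; exact: exchange_big.
  move=> c _; rewrite mxE [e _ _]mxE [X in _ * X]mxE [X in _ * X]mxE mulrDl; congr (_ + _).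
    rewrite mxE mulr_suml; apply: eq_bigr => b _; rewrite mxE.
    by rewrite mulrAC mulrC.
  rewrite mulr_suml; apply: eq_bigr => b _; rewrite mulr_suml; apply: eq_bigr => d _.
  by rewrite -!mulrA.
have GamE : Gam = C *m (invmx (G x))^T.
  apply/rowP => l; rewrite mxE christoffelE mxE; apply: eq_bigr => m _.
  by rewrite !mxE mulrC.
have E : Gam *m Jm x = h + e *m (invmx (G' (y x)))^T.
  rewrite GamE CE -!mulmxA.
  have -> : (Jm x)^T *m ((invmx (G x))^T *m Jm x) = (invmx (G' (y x)))^T.
    by rewrite -invmx_pullback// !trmx_mul trmxK mulmxA.
  rewrite mulmxDl -mulmxA; congr (_ + _).
  rewrite -{1}(metric_on_sym mG' (UV Ux)) -trmx_mul mulVmx ?trmx1 ?mulmx1//.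
  exact: (metric_on_unit mG' (UV Ux)).
have := congr1 (fun A : 'rV[R]_n => A 0 a) E; rewrite /= mxE [RHS]mxE [h _ _]mxE [X in _ + X]mxE => E1.
have E0 : \sum_l christoffel G l i j x * J l a x = \sum_l Gam 0 l * Jm x l a.
  by apply: eq_bigr => l _; rewrite /Gam /Jm !mxE.
rewrite E0 E1; congr (_ + _).
rewrite (eq_bigr (fun d => \sum_b \sum_c invmx (G' (y x)) a d * christoffel1 G' b c d (y x) * (J i b x * J j c x))).
  rewrite exchange_big; apply: eq_bigr => b _; rewrite exchange_big; apply: eq_bigr => c _.
  by rewrite christoffelE mulr_suml.
move=> d _; rewrite [e _ _]mxE [X in _ * X]mxE mulrC mulr_sumr; apply: eq_bigr => b _.
by rewrite mulr_sumr; apply: eq_bigr => c _; exact: mulrA.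
Qed.

(** The second derivatives of y appear once from the chain rule and once from
    [christoffel_pullback], and cancel. *)
Lemma hessian_pullback (f : 'rV[R]_n -> R) x : smooth_on V f -> U x ->
  hessian G (f \o y) x = Jm x *m hessian G' f (y x) *m (Jm x)^T.
Proof.
move=> sf Ux; apply/matrixP => i j.
have E1 := partial2_comp_map i j sf Ux.
have E2 : \sum_l christoffel G l i j x * partial l (f \o y) x =
    \sum_a (H i j a x + \sum_b \sum_c christoffel G' a b c (y x) * (J i b x * J j c x))
      * partial a f (y x).
  rewrite (eq_bigr (fun l => \sum_a christoffel G l i j x * J l a x * partial a f (y x))).
    rewrite exchange_big; apply: eq_bigr => a _.
    by rewrite -christoffel_pullback// mulr_suml.
  move=> l _; have [_ ->] := partial_comp_map l sf Ux.
  by rewrite mulr_sumr; apply: eq_bigr => a _; rewrite mulrA.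
apply: (etrans (hessianE _ _ _ _ _)); apply: (etrans (congr2 (fun p q => p - q) E1 E2)).
have E3 : \sum_a (H i j a x + \sum_b \sum_c christoffel G' a b c (y x) * (J i b x * J j c x))
      * partial a f (y x) = \sum_a H i j a x * partial a f (y x) +
    \sum_a (\sum_b \sum_c christoffel G' a b c (y x) * (J i b x * J j c x)) * partial a f (y x).
  by rewrite -big_split; apply: eq_bigr => a _; exact: mulrDl.
rewrite E3 opprD addrACA subrr add0r mulmx_bil.
apply: (etrans (bil_sub_contract _ _ _ _ _)).
by apply: eq_bil => [b c|b|c]; rewrite mxE.
Qed.

Lemma laplacian_invariant (f : 'rV[R]_n -> R) x : smooth_on V f -> U x ->
  coord_laplacian G (f \o y) x = coord_laplacian G' f (y x).
Proof.
move=> sf Ux; have sG' : (invmx (G' (y x)))^T = invmx (G' (y x)).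
  by rewrite trmx_inv (metric_on_sym mG' (UV Ux)).
have sG : (invmx (G x))^T = invmx (G x) by rewrite trmx_inv (metric_on_sym mG Ux).
apply: (etrans (contract_mxtrace _ _)).
apply: (etrans _ (esym (contract_mxtrace (invmx (G' (y x))) (hessian G' f (y x))))).
apply: (etrans (congr1 (fun A => \tr ((invmx (G x))^T *m A)) (hessian_pullback sf Ux))).
by rewrite sG' sG -invmx_pullback// !mulmxA mxtrace_mulC !mulmxA.
Qed.

End Invariance.

(** * The Laplacian of a metric a(r) H + b(r) dr^2 *)

Section ProductMetric.
Context {R : realType} {k : nat}.
Notation pt x r := (row_mx x r%:M : 'rV[R]_(k + 1)).
Notation rI := (rshift k (0 : 'I_1)).

Lemma partial_lshift (u : 'rV[R]_(k + 1) -> R) i (x : 'rV[R]_k) (r : R) :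
  partial (lshift 1 i) u (pt x r) = partial i (fun x' => u (pt x' r)) x.
Proof.
have K : (fun h : R => h^-1 *: ((u \o shift (pt x r)) (h *: delta_mx 0 (lshift 1 i)) - u (pt x r))) =
    (fun h => h^-1 *: (((fun x' => u (pt x' r)) \o shift x) (h *: delta_mx 0 i) - u (pt x r))).
  apply/funext => h /=; congr (_ *: (u _ - _)).
  rewrite -[X in X + _]hsubmxK add_row_mx; congr row_mx.
    by congr (_ + _); apply/rowP => j; rewrite !mxE /= (inj_eq (@lshift_inj _ _)).
  rewrite -[RHS]add0r; congr (_ + _); apply/rowP => j.
  by rewrite !mxE /= eq_rlshift mulr0.
by rewrite /partial /derive K.
Qed.

Lemma partial_rshift (u : 'rV[R]_(k + 1) -> R) (x : 'rV[R]_k) (r : R) :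
  partial rI u (pt x r) = 'D_1 (fun t : R => u (pt x t)) r.
Proof.
have K : (fun h : R => h^-1 *: ((u \o shift (pt x r)) (h *: delta_mx 0 rI) - u (pt x r))) =
    (fun h => h^-1 *: (((fun t : R => u (pt x t)) \o shift r) (h *: 1) - u (pt x r))).
  apply/funext => h /=; congr (_ *: (u _ - _)).
  rewrite -[X in X + _]hsubmxK add_row_mx; congr row_mx.
    rewrite -[RHS]add0r; congr (_ + _); apply/rowP => j.
    by rewrite !mxE /= eq_lrshift mulr0.
  apply/rowP => j; rewrite !ord1 !mxE /= !eqxx [h *: 1]mulr1.
  by rewrite !mulr1 !mulr1n.
by rewrite /partial /derive K.
Qed.

Variables (Ux : set 'rV[R]_k) (I : set R) (H : 'rV[R]_k -> 'M[R]_k).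
Variables (a b a' b' : R -> R) (G : 'rV[R]_(k + 1) -> 'M[R]_(k + 1)).
Hypotheses (mH : metric_on Ux H) (oI : open I).
Hypotheses (a0 : forall r, I r -> a r != 0) (b0 : forall r, I r -> b r != 0).
Hypotheses (da : forall r, I r -> is_derive r 1 a (a' r)).
Hypotheses (db : forall r, I r -> is_derive r 1 b (b' r)).
Hypothesis GE : forall x r, Ux x -> I r ->
  G (pt x r) = block_mx (a r *: H x) 0 0 (b r)%:M.

Variables (x : 'rV[R]_k) (r : R).
Hypotheses (Uxx : Ux x) (Ir : I r).

Let oU := metric_on_open mH.

Let dH j m : differentiable (fun z => H z j m) x.
Proof. exact: smooth_on_diff (metric_on_smooth mH j m) Uxx. Qed.

Lemma invmx_product :
  invmx (G (pt x r)) = block_mx ((a r)^-1 *: invmx (H x)) 0 0 (b r)^-1%:M.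
Proof.
have uH := metric_on_unit mH Uxx.
have E : G (pt x r) *m block_mx ((a r)^-1 *: invmx (H x)) 0 0 (b r)^-1%:M = 1%:M.
  rewrite GE// mulmx_block !mulmx0 !mul0mx !addr0 !add0r.
  rewrite -scalemxAl -scalemxAr scalerA divff ?a0// scale1r mulmxV//.
  by rewrite -scalar_mxM divff ?b0// -scalar_mx_block.
have [uG _] := mulmx1_unit E.
by rewrite -[LHS]mulmx1 -E mulmxA mulVmx// mul1mx.
Qed.

Lemma near_I : \forall t \near r, I t.
Proof. exact: near_open. Qed.

Lemma partial_ll i j m :
  partial (lshift 1 i) (fun z => G z (lshift 1 j) (lshift 1 m)) (pt x r)
    = a r * partial i (fun z => H z j m) x.
Proof.
apply: (etrans (partial_lshift _ i x r)); rewrite -(partialZ (a r) i (dH j m)).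
by apply: partial_eq oU _ Uxx => z Uz; rewrite GE// block_mxEul mxE.
Qed.

Lemma partial_lr i j :
  partial (lshift 1 i) (fun z => G z (lshift 1 j) rI) (pt x r) = 0 /\
  partial (lshift 1 i) (fun z => G z rI (lshift 1 j)) (pt x r) = 0.
Proof.
split; apply: (etrans (partial_lshift _ i x r)); apply: etrans (partial_cst 0 i x);
  apply: partial_eq oU _ Uxx => z Uz; rewrite GE//.
  by rewrite block_mxEur mxE.
by rewrite block_mxEdl mxE.
Qed.

Lemma partial_lrr i : partial (lshift 1 i) (fun z => G z rI rI) (pt x r) = 0.
Proof.
apply: (etrans (partial_lshift _ i x r)); apply: etrans (partial_cst (b r) i x).
by apply: partial_eq oU _ Uxx => z Uz; rewrite GE// block_mxEdr !mxE eqxx mulr1n.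
Qed.

Lemma partial_rll j m :
  partial rI (fun z => G z (lshift 1 j) (lshift 1 m)) (pt x r) = a' r * H x j m.
Proof.
apply: (etrans (partial_rshift _ x r)).
have D : is_derive r 1 (fun t => H x j m * a t) (H x j m * a' r).
  exact: (@is_deriveZ _ _ _ a (H x j m) r 1 _ (da Ir)).
rewrite mulrC -(@derive_val _ _ _ _ _ _ _ D); apply: near_eq_derive.
by apply: filterS near_I => t It; rewrite GE// block_mxEul mxE mulrC.
Qed.

Lemma partial_rrr : partial rI (fun z => G z rI rI) (pt x r) = b' r.
Proof.
apply: (etrans (partial_rshift _ x r)).
rewrite -(@derive_val _ _ _ _ _ _ _ (db Ir)); apply: near_eq_derive.
by apply: filterS near_I => t It; rewrite GE// block_mxEdr !mxE eqxx mulr1n.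
Qed.

Lemma christoffel_lll l i j :
  christoffel G (lshift 1 l) (lshift 1 i) (lshift 1 j) (pt x r) = christoffel H l i j x.
Proof.
rewrite /christoffel invmx_product; congr (_ * _).
rewrite big_split_ord /= big_ord1 [X in _ + X * _]block_mxEur mxE mul0r addr0.
apply: eq_bigr => m _; rewrite block_mxEul mxE.
rewrite (partial_ll i j m) (partial_ll j i m) (partial_ll m i j).
move: (invmx _ _ _) (partial i _ x) (partial j _ x) (partial m _ x) => p q s t.
by have := a0 Ir; move: (a r) => c c0; field.
Qed.

Lemma christoffel_rll i j :
  christoffel G rI (lshift 1 i) (lshift 1 j) (pt x r) = - (a' r * H x i j / (2 * b r)).
Proof.
rewrite /christoffel invmx_product big_split_ord /= big_ord1 big1; last first.
  by move=> m _; rewrite block_mxEdl mxE mul0r.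
rewrite block_mxEdr !mxE eqxx mulr1n (partial_lr i j).1 (partial_lr j i).1 (partial_rll i j).
by have := b0 Ir; move: (b r) => c c0; field.
Qed.

Lemma partial_rlr j : partial rI (fun z => G z (lshift 1 j) rI) (pt x r) = 0 /\
  partial rI (fun z => G z rI (lshift 1 j)) (pt x r) = 0.
Proof.
split; apply: (etrans (partial_rshift _ x r)); apply: etrans (derive_cst (0 : R) r 1);
  apply: near_eq_derive; apply: filterS near_I => t It; rewrite GE//.
  by rewrite block_mxEur mxE.
by rewrite block_mxEdl mxE.
Qed.

Lemma christoffel_lrr l : christoffel G (lshift 1 l) rI rI (pt x r) = 0.
Proof.
rewrite /christoffel invmx_product big_split_ord /= big_ord1.
rewrite [X in _ + X * _]block_mxEur mxE mul0r addr0 big1 ?mulr0// => m _.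
by rewrite (partial_rlr m).2 partial_lrr addr0 subr0 mulr0.
Qed.

Lemma christoffel_rrr : christoffel G rI rI rI (pt x r) = b' r / (2 * b r).
Proof.
rewrite /christoffel invmx_product big_split_ord /= big_ord1 big1; last first.
  by move=> m _; rewrite block_mxEdl mxE mul0r.
rewrite block_mxEdr !mxE eqxx mulr1n partial_rrr.
by have := b0 Ir; move: (b r) => c c0; field.
Qed.

Lemma contract_metric : \sum_i \sum_j invmx (H x) i j * H x i j = k%:R.
Proof.
rewrite contract_mxtrace trmx_inv (metric_on_sym mH Uxx) mulVmx ?mxtrace1//.
exact: (metric_on_unit mH Uxx).
Qed.

(** The symbol - a' H_ij / (2 b) is the only one that brings the radial derivative into the
    tangential Hessian; traced with the inverse of a H it gives the last term, where k is the trace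
    of the identity ([contract_metric]). *)
Lemma laplacian_product (u : 'rV[R]_(k + 1) -> R) :
  let ur t := 'D_1 (fun s : R => u (pt x s)) t in
  coord_laplacian G u (pt x r) =
    (a r)^-1 * coord_laplacian H (fun x' => u (pt x' r)) x
    + (b r)^-1 * ('D_1 ur r - b' r / (2 * b r) * ur r)
    + k%:R * a' r / (2 * a r * b r) * ur r.
Proof.
move=> ur; have urE : partial rI u (pt x r) = ur r by exact: partial_rshift.
have H_ll i j : hessian G u (pt x r) (lshift 1 i) (lshift 1 j) =
    hessian H (fun x' => u (pt x' r)) x i j + a' r / (2 * b r) * ur r * H x i j.
  have E1 : partial (lshift 1 i) (partial (lshift 1 j) u) (pt x r) =
      partial i (partial j (fun x' => u (pt x' r))) x.
    apply: (etrans (partial_lshift _ i x r)); congr (partial i _ x).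
    by apply/funext => z; exact: partial_lshift.
  rewrite (hessianE H) hessianE E1 big_split_ord /= big_ord1 christoffel_rll urE.
  rewrite (eq_bigr (fun l => christoffel H l i j x * partial l (fun x' => u (pt x' r)) x)).
    move: (partial i _ x) (\sum_l _) => p q; have := b0 Ir; move: (b r) => c c0.
    by field.
  by move=> l _; rewrite christoffel_lll partial_lshift.
have H_rr : hessian G u (pt x r) rI rI = 'D_1 ur r - b' r / (2 * b r) * ur r.
  have E1 : partial rI (partial rI u) (pt x r) = 'D_1 ur r.
    apply: (etrans (partial_rshift _ x r)); congr ('D_1 _ r).
    by apply/funext => t; exact: partial_rshift.
  rewrite hessianE E1 big_split_ord /= big_ord1 big1 ?add0r.
    by rewrite christoffel_rrr urE.
  by move=> l _; rewrite christoffel_lrr mul0r.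
rewrite /coord_laplacian invmx_product big_split_ord /= big_ord1.
rewrite [X in _ + X]big_split_ord /= big_ord1 [X in _ + (X + _)]big1 ?add0r; last first.
  by move=> j _; rewrite block_mxEdl mxE mul0r.
have E2 : ((b r)^-1%:M : 'M[R]_1) 0 0 = (b r)^-1 by rewrite mxE eqxx mulr1n.
rewrite block_mxEdr H_rr E2.
rewrite addrAC; congr (_ + _).
rewrite (eq_bigr (fun i => (a r)^-1 * (\sum_j invmx (H x) i j * hessian H (fun x' => u (pt x' r)) x i j)
  + a' r / (2 * b r) * ur r * (a r)^-1 * \sum_j invmx (H x) i j * H x i j)); last first.
  move=> i _; rewrite big_split_ord /= big_ord1 [X in _ + X * _]block_mxEur mxE mul0r addr0.
  rewrite !mulr_sumr -big_split; apply: eq_bigr => j _ /=.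
  rewrite block_mxEul mxE H_ll.
  move: (hessian _ _ _ _ _) (ur r : R) => p q.
  by have := a0 Ir; have := b0 Ir; move: (a r) (b r) => c d c0 d0; field; rewrite c0 d0.
rewrite big_split -!mulr_sumr /= contract_metric; congr (_ + _).
by have := a0 Ir; have := b0 Ir; move: (a r) (b r) => c d c0 d0; field; rewrite c0 d0.
Qed.

End ProductMetric.

(** * The Laplacian on the cylinder *)

Section ManifoldLaplacian.
Context {R : realType} {k : nat} {S : smooth_space R k} (h : riem_metric S).
Implicit Types (f g : S -> R) (phi psi : chart R k S).

Lemma chart_image_open phi : open (cimg phi).
Proof. exact: cimg_open. Qed.

Lemma chart_metric_on phi : atlas phi -> metric_on (cimg phi) (h phi).
Proof.
move=> aphi; split; first exact: cimg_open.
- exact: (@metric_smooth _ _ _ h phi aphi).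
- by move=> x px; exact: (@Defs.metric_sym _ _ _ h phi x aphi px).
- by move=> x px; apply: posdef_unitmx; exact: (@metric_pos _ _ _ h phi x aphi px).
Qed.

Lemma cinvK phi x : cimg phi x -> cdom phi (cinv phi x) /\ cmap phi (cinv phi x) = x.
Proof. by move=> [p dp <-]; rewrite cmapK. Qed.

(** Frees the Laplacian from the chart chosen at p: the transition map is a change of coordinates to
    which [laplacian_invariant] applies. *)
Lemma laplacian_chartE f phi p : smooth_fun f -> atlas phi -> cdom phi p ->
  laplacian h f p = coord_laplacian (h phi) (f \o cinv phi) (cmap phi p).
Proof.
move=> sf aphi dp; rewrite /laplacian.
have [apsi dpsi] : atlas (chart_at p) /\ cdom (chart_at p) p.
  by rewrite /chart_at; case: cid2.
move: (chart_at p) apsi dpsi => psi apsi dpsi.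
pose U := cmap psi @` (cdom psi `&` cdom phi).
have oU : open U by apply: open_chart_image; exact: cdom_open.
have Up : U (cmap psi p) by exists p.
have US : U `<=` cimg psi by move=> _ [q [dq _] <-]; exists q.
have fE x : U x -> (f \o cinv psi) x = ((f \o cinv phi) \o (cmap phi \o cinv psi)) x.
  by move=> [q [dq1 dq2] <-] /=; rewrite !cmapK.
rewrite (laplacian_eq (h psi) oU Up fE).
have mG := metric_on_sub oU US (chart_metric_on apsi).
have sy : smooth_map_on U (cmap phi \o cinv psi) by exact: atlas_compat.
have UV x : U x -> cimg phi ((cmap phi \o cinv psi) x).
  by move=> [q [dq1 dq2] <-] /=; rewrite cmapK//; exists q.
have GE x : U x -> h psi x = pullback (h phi) (cmap phi \o cinv psi) x.
  by move=> [q [dq1 dq2] <-]; exact: metric_transform.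
have := laplacian_invariant mG (chart_metric_on aphi) sy UV GE (sf phi aphi) Up.
by rewrite /= cmapK.
Qed.

Lemma smooth_fun_laplacian f : smooth_fun f -> smooth_fun (laplacian h f).
Proof.
move=> sf phi aphi.
apply: (@smooth_on_eq _ _ _ (coord_laplacian (h phi) (f \o cinv phi))).
- exact: cimg_open.
- by move=> x px; have [dp E] := cinvK px; rewrite /= (laplacian_chartE sf aphi dp) E.
- by apply: smooth_laplacian (sf phi aphi); exact: chart_metric_on.
Qed.

Lemma smooth_fun_comb (c d : R) f g : smooth_fun f -> smooth_fun g ->
  smooth_fun (fun p => c * f p + d * g p).
Proof.
move=> sf sg phi aphi.
have oC := @chart_image_open phi.
exact: (smooth_onD oC (smooth_onZ c oC (sf phi aphi)) (smooth_onZ d oC (sg phi aphi))).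
Qed.

Lemma smooth_fun_cst (c : R) : smooth_fun (fun _ : S => c).
Proof. by move=> phi _; exact: smooth_on_cst. Qed.

Lemma laplacian_lin (c d : R) f g p : smooth_fun f -> smooth_fun g ->
  laplacian h (fun p => c * f p + d * g p) p = c * laplacian h f p + d * laplacian h g p.
Proof.
move=> sf sg; have [phi aphi dp] := atlas_cover p.
rewrite !(laplacian_chartE _ aphi dp)//; last exact: smooth_fun_comb.
apply: (laplacian_comb _ _ _ (@chart_image_open phi)); [by exists p|exact: sf|exact: sg].
Qed.

Lemma smooth_fun_sum m (F : nat -> S -> R) : (forall i, smooth_fun (F i)) ->
  smooth_fun (fun p => \sum_(0 <= i < m) F i p).
Proof.
move=> sF phi aphi.
exact: (smooth_on_sum (index_iota 0 m) xpredT (@chart_image_open phi) (fun i => sF i phi aphi)).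
Qed.

Lemma laplacian_sum m (c : nat -> R) (F : nat -> S -> R) p : (forall i, smooth_fun (F i)) ->
  laplacian h (fun p => \sum_(0 <= i < m) c i * F i p) p =
  \sum_(0 <= i < m) c i * laplacian h (F i) p.
Proof.
move=> sF; elim: m => [|m IH].
  have E := laplacian_lin 0 0 p (smooth_fun_cst 0) (smooth_fun_cst 0).
  rewrite !mul0r addr0 in E; rewrite big_nil -[RHS]E; congr (laplacian h _ p).
  by apply/funext => q; rewrite big_nil ?mul0r ?addr0.
rewrite big_nat_recr//= -IH.
have sS : smooth_fun (fun p => \sum_(0 <= i < m) c i * F i p).
  apply: (@smooth_fun_sum m (fun i p => c i * F i p)) => i.
  have := smooth_fun_comb (c i) 0 (sF i) (smooth_fun_cst 0); congr smooth_fun.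
  by apply/funext => q; rewrite mul0r addr0.
have := laplacian_lin 1 (c m) p sS (sF m); rewrite mul1r => <-.
congr (laplacian h _ p); apply/funext => q.
by rewrite big_nat_recr//= mul1r.
Qed.

End ManifoldLaplacian.

Section Slices.
Context {R : realType} {k : nat}.
Notation pt x r := (row_mx x r%:M : 'rV[R]_(k + 1)).
Notation rI := (rshift k (0 : 'I_1)).
Implicit Types u : 'rV[R]_(k + 1) -> R.

Lemma row_mx_sub (z : 'rV[R]_(k + 1)) : pt (lsubmx z) (rsubmx z 0 0) = z.
Proof.
rewrite -[RHS]hsubmxK; congr row_mx.
by apply/rowP => j; rewrite !ord1 [LHS]mxE eqxx mulr1n.
Qed.

Lemma rsubmx_pt (x : 'rV[R]_k) (r : R) : rsubmx (pt x r) 0 0 = r.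
Proof. by rewrite row_mxKr mxE eqxx mulr1n. Qed.

Lemma iter_partial_slice u s (r : R) : iter_partial s (fun x => u (pt x r)) =
  fun x => iter_partial (map (lshift 1) s) u (pt x r).
Proof.
elim: s => //= i s ->; apply/funext => x; exact/esym/partial_lshift.
Qed.

Lemma differentiable_slice (x : 'rV[R]_k) (r : R) : differentiable (fun x => pt x r) x.
Proof.
apply: rV_differentiable => j; case: (split_ordP j) => i ->.
  rewrite (_ : (fun z => _) = fun z : 'rV[R]_k => z 0 i); first exact: differentiable_coord.
  by apply/funext => z; rewrite row_mxEl.
rewrite (_ : (fun z => _) = fun z : 'rV[R]_k => (r%:M : 'M[R]_1) 0 i).
  exact: differentiable_cst.
by apply/funext => z; rewrite row_mxEr.
Qed.

Lemma smooth_slice (W : set 'rV[R]_(k + 1)) u (r : R) : smooth_on W u ->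
  smooth_on [set x | W (pt x r)] (fun x => u (pt x r)).
Proof.
move=> su s x Wx; rewrite iter_partial_slice.
apply: (@differentiable_comp _ _ _ _ (fun x => pt x r)); first exact: differentiable_slice.
exact: su Wx.
Qed.

Lemma derivable_rslice u (x : 'rV[R]_k) (r : R) : differentiable u (pt x r) ->
  is_derive r 1 (fun t : R => u (pt x t)) (partial rI u (pt x r)).
Proof.
move=> du; have D : derivable u (0 *: delta_mx 0 rI + pt x r) (delta_mx 0 rI).
  by rewrite scale0r add0r; exact: diff_derivable.
apply: DeriveDef; last by rewrite partial_rshift.
have := diff_derivable (v := delta_mx 0 rI) du.
rewrite /derivable.
have -> : (fun h : R => h^-1 *: ((u \o shift (pt x r)) (h *: delta_mx 0 rI) - u (pt x r))) =
    (fun h => h^-1 *: (((fun t : R => u (pt x t)) \o shift r) (h *: 1) - u (pt x r))).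
  apply/funext => h /=; congr (_ *: (u _ - _)).
  rewrite -[X in X + _]row_mx_sub add_row_mx; congr row_mx.
    rewrite -[RHS]add0r; congr (_ + _); apply/rowP => j.
    by rewrite !mxE /= eq_lrshift mulr0.
  apply/rowP => j; rewrite !ord1 !mxE /= !eqxx [h *: 1]mulr1.
  by rewrite !mulr1n mulr1.
by [].
Qed.

End Slices.

Section CylinderLaplacian.
Context {R : realType} {k : nat} {S : smooth_space R k} {e : {posnum R}}.
Notation pt x r := (row_mx x r%:M : 'rV[R]_(k + 1)).
Notation rI := (rshift k (0 : 'I_1)).
Implicit Types (V W : S -> R -> R) (phi : chart R k S).

Definition chart_fun phi V (z : 'rV[R]_(k + 1)) : R := V (cinv phi (lsubmx z)) (rsubmx z 0 0).

Definition chart_cyl (e : {posnum R}) phi : set 'rV[R]_(k + 1) :=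
  [set z | cimg phi (lsubmx z) /\ itv0 e (rsubmx z 0 0)].

Lemma chart_cyl_open phi : open (chart_cyl e phi).
Proof. by have := cyl_img_open (e := e) (phi := phi); rewrite cyl_imgE. Qed.

Lemma itv0_open : open (itv0 e).
Proof.
have -> : itv0 e = `]0, e%:num[%classic by apply/seteqP; split => x /=; rewrite in_itv.
exact: interval_open.
Qed.

Definition smooth_interior V := forall phi, atlas phi ->
  smooth_on (chart_cyl e phi) (chart_fun phi V).

Definition dr V : S -> R -> R := fun p r => 'D_1 (V p) r.

Lemma chart_fun_pt phi V p r : cdom phi p -> chart_fun phi V (pt (cmap phi p) r) = V p r.
Proof. by move=> dp; rewrite /chart_fun row_mxKl rsubmx_pt cmapK. Qed.

Lemma chart_fun_dr phi V z : chart_fun phi (dr V) z = partial rI (chart_fun phi V) z.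
Proof.
rewrite -[in RHS](row_mx_sub z) partial_rshift /chart_fun /dr.
rewrite (_ : (fun t => V _ _) = V (cinv phi (lsubmx z)))//.
by apply/funext => t; rewrite row_mxKl rsubmx_pt.
Qed.

Lemma smooth_interior_dr V : smooth_interior V -> smooth_interior (dr V).
Proof.
move=> sV phi aphi; apply: (@smooth_on_eq _ _ _ (partial rI (chart_fun phi V))).
- exact: chart_cyl_open.
- by move=> z _; rewrite chart_fun_dr.
- exact: smooth_on_partial (sV phi aphi).
Qed.

Lemma smooth_interior_derivable V p (r : R) : smooth_interior V -> itv0 e r ->
  is_derive r 1 (V p) (dr V p r).
Proof.
move=> sV re; have [phi aphi dp] := atlas_cover p.
have D : differentiable (chart_fun phi V) (pt (cmap phi p) r).
  apply: smooth_on_diff (sV phi aphi) _; split; last by rewrite rsubmx_pt.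
  by rewrite row_mxKl; exists p.
have := derivable_rslice D; rewrite -chart_fun_dr chart_fun_pt//.
by congr is_derive; apply/funext => t; rewrite chart_fun_pt.
Qed.

Lemma smooth_interior_slice V (r : R) : smooth_interior V -> itv0 e r ->
  smooth_fun (fun p => V p r).
Proof.
move=> sV re phi aphi.
have := smooth_slice (r := r) (sV phi aphi).
rewrite (_ : (fun x => chart_fun phi V _) = (fun p => V p r) \o cinv phi); last first.
  by apply/funext => x; rewrite /chart_fun row_mxKl rsubmx_pt.
by apply: smooth_onS => x px; split; rewrite ?row_mxKl ?rsubmx_pt.
Qed.

Variables (h : riem_metric S) (hp : riem_metric (cyl S e)) (lambda : R).

Definition conf (lambda r : R) : R := 1 - lambda / 4 * r ^+ 2.

Hypothesis conf_gt0 : forall r, 0 <= r < e%:num -> 0 < conf lambda r.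
Hypothesis hpE : forall phi x r, atlas phi -> cimg phi x -> itv0 e r ->
  hp (cyl_chart e phi) (pt x r) =
    block_mx ((conf lambda r ^+ 2 / r ^+ 2) *: h phi x) 0 0 (r ^- 2)%:M.

Lemma is_derive_conf (r : R) : is_derive r 1 (conf lambda) (- (lambda / 2 * r)).
Proof.
have D := @is_deriveX _ _ (id : R -> R) 2 r 1 1 (is_derive_id _ _).
rewrite exprfctE in D.
have D2 := @is_deriveB _ _ _ _ _ _ _ _ _ (is_derive_cst (1 : R) r (1 : R))
   (@is_deriveZ _ _ _ _ (lambda / 4) r 1 _ D).
suff <- : 0 - (lambda / 4) *: ((2%:R * r ^+ 2.-1) *: 1) = - (lambda / 2 * r) by exact: D2.
by rewrite -![_ *: _]/(_ * _) /= expr1; field.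
Qed.

Lemma is_derive_sqr_inv (r : R) : r != 0 -> is_derive r 1 (fun t : R => t ^- 2) (- 2 * r ^- 3).
Proof.
move=> r0; have := is_derive_inv_pow 1 r0.
have -> : (fun t : R => (-1) ^+ 1 * 1`!%:R * t ^- 2) = fun t => - (t ^- 2).
  by apply/funext => t; rewrite expr1 -[1`!]/1%N mulr1 mulN1r.
move=> D; have := is_deriveN D.
have -> : - (fun t : R => - t ^- 2) = fun t => t ^- 2.
  by apply/funext => t; rewrite !fctE opprK.
by congr is_derive; rewrite sqrrN expr1n mul1r -[2`!]/2%N mulNr.
Qed.

(** [laplacian_product] with a = conf^2 / r^2 and b = r^-2. In the first-order coefficient, r comes
    from - b' / (2 b^2), and k a' / (2 a b) splits into - k r and a term from the derivative of
    conf. *)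
Lemma cylinder_laplacian V (q : cyl S e) : smooth_interior V ->
  let p := q.1 in let r := \val q.2 in
  laplacian hp (interior_restr V : cyl S e -> R) q =
    r ^+ 2 / conf lambda r ^+ 2 * laplacian h (fun p => V p r) p
    + r ^+ 2 * dr (dr V) p r
    + ((1 - k%:R) * r - k%:R * lambda / 2 * r ^+ 3 / conf lambda r) * dr V p r.
Proof.
move=> sV; case: q => p rt /=; set r := \val rt.
have re : itv0 e r by exact: set_mem (valP rt).
have r0 : r != 0 by case/andP: re => /lt0r_neq0.
have c0 : conf lambda r != 0.
  by apply/lt0r_neq0/conf_gt0; case/andP: re => /ltW -> ->.
rewrite /laplacian; set q : cyl S e := (p, rt).
have [[phi aphi <-] /= dp] : atlas (chart_at q) /\ cdom (chart_at q) q.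
  by rewrite /chart_at; case: cid2.
have Uq : chart_cyl e phi (pt (cmap phi p) r).
  by split; rewrite ?rsubmx_pt// row_mxKl; exists p.
have cp : cimg phi (cmap phi p) by exists p.
rewrite -[cyl_map phi q]/(pt (cmap phi p) r).
have E1 : coord_laplacian (hp (cyl_chart e phi)) (interior_restr V \o cyl_inv e phi) (pt (cmap phi p) r) =
    coord_laplacian (hp (cyl_chart e phi)) (chart_fun phi V) (pt (cmap phi p) r).
  apply: (laplacian_eq _ (@chart_cyl_open phi) Uq) => z [z1 z2].
  by rewrite /= /interior_restr /cyl_inv /chart_fun /= val_to_itv0.
rewrite E1.
pose a r := conf lambda r ^+ 2 * r ^- 2; pose b (r : R) := r ^- 2.
pose a' r := conf lambda r ^+ 2 * (- 2 * r ^- 3) + r ^- 2 * (- (lambda * r) * conf lambda r).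
pose b' (r : R) := - 2 * r ^- 3.
have pos (t : R) : itv0 e t -> t != 0 /\ conf lambda t != 0.
  move=> te; split; first by case/andP: te => /lt0r_neq0.
  by apply/lt0r_neq0/conf_gt0; case/andP: te => /ltW -> ->.
have a0 t : itv0 e t -> a t != 0.
  by move=> /pos[t0 ct]; rewrite mulf_neq0// ?invr_eq0 expf_neq0.
have b0 t : itv0 e t -> b t != 0.
  by move=> /pos[t0 ct]; rewrite invr_eq0 expf_neq0.
have db t : itv0 e t -> is_derive t 1 b (b' t).
  by move=> /pos[t0 _]; exact: is_derive_sqr_inv.
have da t : itv0 e t -> is_derive t 1 a (a' t).
  move=> te; have D := @is_deriveX _ _ (conf lambda) 2 t 1 _ (is_derive_conf t).
  rewrite exprfctE in D; have D2 := is_deriveM D (db t te).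
  suff <- : conf lambda t ^+ 2 *: b' t +
      b t *: (2%:R * conf lambda t ^+ 2.-1 *: - (lambda / 2 * t)) = a' t by exact: D2.
  rewrite -![_ *: _]/(_ * _) /a' /b /b' /= expr1; congr (_ + _).
  by congr (_ * _); field.
have GE z t : cimg phi z -> itv0 e t ->
    hp (cyl_chart e phi) (pt z t) = block_mx (a t *: h phi z) 0 0 (b t)%:M.
  by move=> zc te; exact: hpE.
have := laplacian_product (chart_metric_on h aphi) itv0_open a0 b0 da db GE cp re (chart_fun phi V).
move=> /= ->.
have -> : (fun x' => chart_fun phi V (pt x' r)) = (fun p => V p r) \o cinv phi.
  by apply/funext => x; rewrite /chart_fun row_mxKl rsubmx_pt.
rewrite -(laplacian_chartE h (smooth_interior_slice sV re) aphi dp) -/(laplacian h _ p).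
have -> : (fun s : R => chart_fun phi V (pt (cmap phi p) s)) = V p.
  by apply/funext => s; rewrite chart_fun_pt.
rewrite -[fun t => 'D_1 (V p) t]/(dr V p) -[in LHS]/(dr V p r) -[in LHS]/(dr (dr V) p r).
rewrite /a /b /a' /b'.
move: (dr (dr V) p r) (dr V p r) (laplacian h _ p) (conf lambda r) c0 => v2 v1 v0 c c0.
by field; rewrite r0 c0.
Qed.

End CylinderLaplacian.

(** * The metric induced on Y in product coordinates *)

Section InducedCylinder.
Context {R : realType} {k n : nat} {S : smooth_space R k} {M : smooth_space R n}.
Context {e : {posnum R}}.
Notation pt x r := (row_mx x r%:M).

(** The lifted embedding leaves r unchanged, so its Jacobian is block diagonal with lower block 1,
    and the pullback of the product metric is computed block by block. *)
Lemma induced_cylinder_metric (iota : S -> M) (g : riem_metric M) (h : riem_metric S)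
    (gp : riem_metric (cyl M e)) (hp : riem_metric (cyl S e)) (lambda : R) :
  smooth_map iota -> is_induced_metric iota g h -> canonical_poincare g lambda gp ->
  is_induced_metric (cyl_lift iota) gp hp ->
  forall (phi : chart R k S) (x : 'rV[R]_k) (r : R), atlas phi -> cimg phi x -> itv0 e r ->
  hp (cyl_chart e phi) (pt x r) =
    block_mx ((conf lambda r ^+ 2 / r ^+ 2) *: h phi x) 0 0 (r ^- 2)%:M.
Proof.
move=> [ciota siota] hh hgp hhp phi x r aphi [p dp <-] re.
have [psi apsi dpsi] := atlas_cover (iota p).
have aPhi : atlas (cyl_chart e phi : chart R (k + 1) (cyl S e)) by exists phi.
have aPsi : atlas (cyl_chart e psi : chart R (n + 1) (cyl M e)) by exists psi.
pose q : cyl S e := (p, to_itv0 e r).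
have qE : cyl_map phi q = pt (cmap phi p) r by rewrite /cyl_map /= val_to_itv0.
have := hhp _ _ q aPhi aPsi dp dpsi; rewrite [cmap _ q]qE => ->.
set y := coord_map _ _ _; pose y0 := coord_map phi psi iota.
have yE x' (t : R) : y (pt x' t) = pt (y0 x') (\val (to_itv0 e t)).
  by rewrite /y /coord_map /= /cyl_map /cyl_inv /cyl_lift /= row_mxKl rsubmx_pt.
have yE1 x' t j : y (pt x' t) 0 (lshift 1 j) = y0 x' 0 j by rewrite yE row_mxEl.
have yE2 x' t : y (pt x' t) 0 (rshift n 0) = \val (to_itv0 e t).
  by rewrite yE row_mxEr mxE eqxx mulr1n.
pose D := cmap phi @` (cdom phi `&` iota @^-1` cdom psi).
have oD : open D.
  apply: open_chart_image; apply: open_comp; last exact: cdom_open.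
  by move=> z _; exact: ciota.
have Dp : D (cmap phi p) by exists p.
have sy0 j : smooth_on D (fun x => y0 x 0 j) by exact: siota.
(* The lift passes through [to_itv0], which is the identity only on (0, e); radial derivatives
   therefore rest on agreement near r. *)
have Dt : \forall t \near r, itv0 e t by exact: (near_open itv0_open re).
have yz1 z j : y z 0 (lshift 1 j) = y0 (lsubmx z) 0 j by rewrite -[z in LHS]row_mx_sub yE1.
have yz2 z : y z 0 (rshift n 0) = \val (to_itv0 e (rsubmx z 0 0)).
  by rewrite -[z in LHS]row_mx_sub yE2.
have Dc : \forall z \near (pt (cmap phi p) r : 'rV[R]_(k + 1)), itv0 e (rsubmx z 0 0).
  have := @rcoord_continuous R k (pt (cmap phi p) r : 'rV[R]_(k + 1)).
  by apply; rewrite rsubmx_pt.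
have dy N : differentiable (fun z => y z 0 N) (pt (cmap phi p) r).
  case: (split_ordP N) => j ->.
    rewrite (_ : (fun z => _) = (fun x => y0 x 0 j) \o lsubmx); last first.
      by apply/funext => z; exact: yz1.
    by apply: (smooth_on_diff (smooth_on_lsubmx (sy0 j))); rewrite /= row_mxKl.
  apply: (near_eq_differentiable (f := fun z => rsubmx z 0 0)).
    by apply: filterS Dc => z ze; rewrite (ord1 j) yz2 val_to_itv0.
  exact: (smooth_on_diff (@smooth_on_rcoord R k setT)).
have JE : jacobian y (pt (cmap phi p) r) = block_mx (jacobian y0 (cmap phi p)) 0 0 1%:M.
  have dy0 j : differentiable (fun x => y0 x 0 j) (cmap phi p) by exact: smooth_on_diff (sy0 j) Dp.
  apply/matrixP => i' j'; rewrite jacobianE//.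
  case: (split_ordP i') => i ->; case: (split_ordP j') => j ->.
  - rewrite block_mxEul jacobianE// partial_lshift; congr (partial i _ _).
    by apply/funext => x'; rewrite yE1.
  - rewrite block_mxEur mxE partial_lshift (ord1 j).
    rewrite (_ : (fun x' => _) = fun=> \val (to_itv0 e r)); first exact: partial_cst.
    by apply/funext => x'; rewrite yE2.
  - rewrite block_mxEdl mxE (ord1 i) partial_rshift.
    rewrite (_ : (fun t => _) = fun=> y0 (cmap phi p) 0 j); first exact: derive_cst.
    by apply/funext => t; rewrite yE1.
  rewrite block_mxEdr mxE (ord1 i) (ord1 j) eqxx partial_rshift.
  rewrite -[RHS](@derive_id _ _ r (1 : R)); apply: near_eq_derive.
  by apply: filterS Dt => t te; rewrite yE2 val_to_itv0.
rewrite /pullback JE.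
have -> : y (pt (cmap phi p) r) = pt (y0 (cmap phi p)) r by rewrite yE val_to_itv0.
have cpsi : cimg psi (y0 (cmap phi p)) by rewrite /y0 /coord_map /= cmapK//; exists (iota p).
rewrite (hgp _ _ _ apsi cpsi re) tr_block_mx !trmx0 trmx1 -scalemxAr -scalemxAl.
rewrite !mulmx_block !(mulmx0, mul0mx, addr0, add0r, mulmx1, mul1mx).
have := hh phi psi p aphi apsi dp dpsi; rewrite /pullback -/y0 => ->.
rewrite scale_block_mx !scaler0; congr block_mx; last by rewrite scale_scalar_mx mulr1.
by rewrite -scalemxAr -scalemxAl scalerA /conf mulrC.
Qed.

End InducedCylinder.

(** * Functions smooth up to the boundary *)

Section SmoothExt.
Context {R : realType} {n : nat}.
Implicit Types (A U : set 'rV[R]_n) (f g : 'rV[R]_n -> R).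

Lemma smooth_ext_onW U A f : open U -> A `<=` U -> smooth_on U f -> smooth_ext_on A f.
Proof. by move=> oU AU sf x Ax; exists U, f; split => //; exact: AU. Qed.

Lemma smooth_ext_on_eq A f g : (forall x, A x -> f x = g x) -> smooth_ext_on A f ->
  smooth_ext_on A g.
Proof.
move=> fg sf x Ax; have [U [k [oU Ux sk fk]]] := sf x Ax.
by exists U, k; split=> // y Uy Ay; rewrite -fg// fk.
Qed.

Lemma smooth_ext_onD A f g : smooth_ext_on A f -> smooth_ext_on A g ->
  smooth_ext_on A (fun x => f x + g x).
Proof.
move=> sf sg x Ax; have [U [f' [oU Ux sf' ff']]] := sf x Ax.
have [V [g' [oV Vx sg' gg']]] := sg x Ax.
exists (U `&` V), (fun y => f' y + g' y); split=> //; first exact: openI.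
- apply: smooth_onD; first exact: openI.
  + by apply: smooth_onS sf' => y [].
  + by apply: smooth_onS sg' => y [].
- by move=> y [Uy Vy] Ay; rewrite ff'// gg'.
Qed.

Lemma smooth_ext_onM A f g : smooth_ext_on A f -> smooth_ext_on A g ->
  smooth_ext_on A (fun x => f x * g x).
Proof.
move=> sf sg x Ax; have [U [f' [oU Ux sf' ff']]] := sf x Ax.
have [V [g' [oV Vx sg' gg']]] := sg x Ax.
exists (U `&` V), (fun y => f' y * g' y); split=> //; first exact: openI.
- apply: smooth_onM; first exact: openI.
  + by apply: smooth_onS sf' => y [].
  + by apply: smooth_onS sg' => y [].
- by move=> y [Uy Vy] Ay; rewrite ff'// gg'.
Qed.

Lemma smooth_ext_on_comp1 A (V : set R) (psi : nat -> R -> R) f : open V ->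
  derivatives_on V psi -> (forall x, A x -> V (f x)) -> smooth_ext_on A f ->
  smooth_ext_on A (fun x => psi 0%N (f x)).
Proof.
move=> oV dpsi AV sf x Ax; have [U [f' [oU Ux sf' ff']]] := sf x Ax.
pose W := U `&` [set y | V (f' y)].
have oW : open W.
  rewrite openE => y [Uy Vy].
  have cf : f' z @[z --> y] --> f' y by exact: smooth_on_continuous sf' Uy.
  exact: filterI (near_open oU Uy) (cf _ (near_open oV Vy)).
exists W, (fun y => psi 0%N (f' y)); split=> //.
- by split=> //=; rewrite -ff'//; exact: AV.
- apply: (smooth_on_comp1 oW dpsi) => [y []//|].
  by apply: smooth_onS sf' => y [].
- by move=> y [Uy _] Ay; rewrite ff'.
Qed.

End SmoothExt.

Section TowardBoundary.
Context {R : realType} {k : nat} {S : smooth_space R k} {e : {posnum R}}.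
Notation pt x r := (row_mx x r%:M : 'rV[R]_(k + 1)).
Notation rI := (rshift k (0 : 'I_1)).
Notation tb p := (@toward_boundary R k S e p).
Notation smooth_bd := (@smooth_to_boundary R k S e).
Notation restr V := (@interior_restr R k S e V).
Implicit Types (V W : S -> R -> R) (phi : chart R k S) (p : S).

Global Instance toward_boundary_filter p : Filter (tb p).
Proof.
split.
- by exists setT => //; exact: filterT.
- move=> A B [W1 n1 h1] [W2 n2 h2]; exists (W1 `&` W2); first exact: filterI.
  by move=> q [q1 q2]; split; [exact: h1|exact: h2].
- move=> A B AB [W nW hW]; exists W => // q /hW; exact: AB.
Qed.

Lemma rV_norm_lt n (v : 'rV[R]_n) (c : R) : 0 < c -> (forall j, `|v 0 j| < c) -> `|v| < c.
Proof.
move=> c0 H; rewrite [X in X < _]/Num.Def.normr/= mx_normrE.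
by apply/bigmax_ltP; split => // -[i j] _ /=; rewrite ord1.
Qed.

Definition bd_pt phi p : 'rV[R]_(k + 1) := pt (cmap phi p) 0.

Lemma near_toward_boundary phi p (d : R) : cdom phi p -> 0 < d ->
  \forall q \near tb p, [/\ cdom phi q.1, \val q.2 < d &
    `|pt (cmap phi q.1) (\val q.2) - bd_pt phi p| < d].
Proof.
move=> dp d0.
exists [set pr : S * R | (cdom phi pr.1 /\ `|cmap phi pr.1 - cmap phi p| < d) /\ `|pr.2| < d].
  exists ([set p' | cdom phi p' /\ `|cmap phi p' - cmap phi p| < d], [set r : R | `|r| < d]).
    have N0 : \forall r \near (0 : R), `|r| < d by exact: nbhs0_lt.
    split => /=; last exact: N0.
    apply: filterI; first by apply: near_open dp; exact: cdom_open.
    have := cmap_continuous dp => /cvgrPdist_lt /(_ d d0).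
    by apply: filterS => z; rewrite distrC.
  by move=> [p' r] [] /= [H1 H2] H3.
move=> [p' rt] /= [[dp' pd] rd]; split=> //; first exact: le_lt_trans (ler_norm _) rd.
apply: rV_norm_lt => // j; rewrite /bd_pt opp_row_mx add_row_mx.
case: (split_ordP j) => i ->; rewrite ?row_mxEl ?row_mxEr.
  exact: le_lt_trans (rV_coord_le _ i) pd.
by rewrite !mxE (ord1 i) eqxx !mulr1n subr0.
Qed.

Lemma near_cimg phi p : cdom phi p ->
  \forall z \near bd_pt phi p, cimg phi (lsubmx z) /\ rsubmx z 0 0 < e%:num.
Proof.
move=> dp; have o1 : open (lsubmx @^-1` cimg phi : set 'rV[R]_(k + 1)).
  apply: (open_comp (f := lsubmx : 'rV[R]_(k + 1) -> 'rV[R]_k)); last exact: cimg_open.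
  by move=> z _; exact: continuous_lsubmx.
have o2 : open [set z : 'rV[R]_(k + 1) | rsubmx z 0 0 < e%:num].
  apply: (open_comp (f := fun z : 'rV[R]_(k + 1) => rsubmx z 0 0) (D := [set x : R | x < e%:num])); last first.
    have -> : [set x | x < e%:num] = `]-oo, e%:num[%classic by apply/seteqP; split => x /=; rewrite in_itv.
    exact: interval_open.
  by move=> z _; exact: rcoord_continuous.
apply: (near_open (openI o1 o2)); split => /=; last by rewrite rsubmx_pt.
by rewrite row_mxKl; exists p.
Qed.

(** The ball stays over the chart and below e, so that its points with r > 0 represent points of the
    interior of Y. *)
Definition bd_extension phi p V (d : R) (g : 'rV[R]_(k + 1) -> R) :=
  [/\ 0 < d, smooth_on [set z | `|z - bd_pt phi p| < d] g,
      forall z, `|z - bd_pt phi p| < d -> cimg phi (lsubmx z) /\ rsubmx z 0 0 < e%:num &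
      forall z, `|z - bd_pt phi p| < d -> 0 <= rsubmx z 0 0 -> chart_fun phi V z = g z].

Lemma smooth_bd_extension phi p V : atlas phi -> cdom phi p -> smooth_bd V ->
  exists d g, bd_extension phi p V d g.
Proof.
move=> aphi dp sV.
have [|U [g [oU Uz sg Vg]]] := sV phi aphi (bd_pt phi p).
  by split; rewrite /bd_pt ?row_mxKl ?rsubmx_pt ?lexx//=; exists p.
have [d /= d0 dN] := (nbhs_ballP _ _).1 (filterI (near_open oU Uz) (near_cimg dp)).
have dN' z : `|z - bd_pt phi p| < d -> U z /\ (cimg phi (lsubmx z) /\ rsubmx z 0 0 < e%:num).
  by move=> zd; apply: dN; rewrite -ball_normE /ball_/= distrC.
exists d, g; split=> //.
- by apply: smooth_onS sg => z /dN'[].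
- by move=> z /dN'[].
- move=> z /dN'[Uz' [zc ze]] z0; apply: Vg => //.
  by split=> //; rewrite z0.
Qed.

Lemma ball_open (m : nat) (z0 : 'rV[R]_m) (d : R) : open [set z | `|z - z0| < d].
Proof.
rewrite (_ : [set z | _] = ball z0 d); first exact: ball_open.
by apply/seteqP; split => z /=; rewrite -ball_normE /ball_/= distrC.
Qed.

(** Boundary limits are read off from a function g continuous across r = 0. Agreement is asked only
    for r > 0, so that W may be a derivative, which has no meaning at r = 0. *)
Lemma cvg_chart phi p W (d : R) (g : 'rV[R]_(k + 1) -> R) : cdom phi p -> 0 < d ->
  {for bd_pt phi p, continuous g} ->
  (forall z, `|z - bd_pt phi p| < d -> cimg phi (lsubmx z) -> itv0 e (rsubmx z 0 0) ->
     chart_fun phi W z = g z) ->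
  restr W q @[q --> tb p] --> g (bd_pt phi p).
Proof.
move=> dp d0 cg Wg; apply/cvgrPdist_lt => eps eps0.
have cg' : g z @[z --> bd_pt phi p] --> g (bd_pt phi p) by exact: cg.
have /cvgrPdist_lt /(_ eps eps0) N := cg'.
have [d' /= d'0 dN] := (nbhs_ballP _ _).1 N.
have m0 : 0 < Num.min d d' by rewrite lt_min d0.
apply: filterS (near_toward_boundary dp m0) => q [dq _].
rewrite lt_min => /andP[zd zd'].
have qe : itv0 e (\val q.2) by exact: set_mem (valP q.2).
have -> : restr W q = g (pt (cmap phi q.1) (\val q.2)).
  rewrite -Wg ?row_mxKl ?rsubmx_pt//; first by rewrite chart_fun_pt.
  by exists q.1.
by apply: dN; rewrite -ball_normE /ball_/= distrC.
Qed.

Lemma smooth_bd_interior V : smooth_bd V -> @smooth_interior R k S e V.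
Proof.
move=> sV phi aphi s z [zc ze].
have [|U [g [oU Uz sg Vg]]] := sV phi aphi z.
  by split=> //; case/andP: ze => /ltW -> ->.
have oW : open (U `&` chart_cyl e phi) by apply: openI => //; exact: chart_cyl_open.
suff : smooth_on (U `&` chart_cyl e phi) (chart_fun phi V) by apply.
apply: (@smooth_on_eq _ _ _ g) => // [y [Uy [yc ye]]|].
  by symmetry; apply: Vg => //; split=> //; case/andP: ye => /ltW -> ->.
by apply: smooth_onS sg => y [].
Qed.

(** The limit is left unnamed: these quantities will be multiplied by positive powers of r. *)
Definition converges p W := exists l : R, restr W q @[q --> tb p] --> l.

Lemma smooth_bd_cvg V p : smooth_bd V -> restr V q @[q --> tb p] --> V p 0.
Proof.
move=> sV; have [phi aphi dp] := atlas_cover p.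
have [d [g [d0 sg _ Vg]]] := smooth_bd_extension aphi dp sV.
have z0 : `|bd_pt phi p - bd_pt phi p| < d by rewrite subrr normr0.
have -> : V p 0 = g (bd_pt phi p).
  by rewrite -Vg ?rsubmx_pt ?lexx// chart_fun_pt.
apply: (cvg_chart dp d0); first exact: smooth_on_continuous sg z0.
by move=> z zd _ /andP[/ltW z1 _]; exact: Vg.
Qed.

Lemma dr_chart_eq phi V p (d : R) g :
  (forall z, `|z - bd_pt phi p| < d -> cimg phi (lsubmx z) -> itv0 e (rsubmx z 0 0) ->
     chart_fun phi V z = g z) ->
  forall z, `|z - bd_pt phi p| < d -> cimg phi (lsubmx z) -> itv0 e (rsubmx z 0 0) ->
     chart_fun phi (dr V) z = partial rI g z.
Proof.
move=> Vg z zd zc ze; rewrite chart_fun_dr.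
apply: (@partial_eq _ _ ([set z | `|z - bd_pt phi p| < d] `&` chart_cyl e phi)).
- by apply: openI; [exact: ball_open|exact: chart_cyl_open].
- by move=> y [yd [yc ye]]; exact: Vg.
- by [].
Qed.

Lemma dr_converges V p : smooth_bd V -> converges p (dr V) /\ converges p (dr (dr V)).
Proof.
move=> sV; have [phi aphi dp] := atlas_cover p.
have [d [g [d0 sg _ Vg]]] := smooth_bd_extension aphi dp sV.
have z0 : `|bd_pt phi p - bd_pt phi p| < d by rewrite subrr normr0.
have E1 : forall z, `|z - bd_pt phi p| < d -> cimg phi (lsubmx z) -> itv0 e (rsubmx z 0 0) ->
    chart_fun phi V z = g z.
  by move=> z zd _ /andP[/ltW z1 _]; exact: Vg.
have s1 := smooth_on_partial rI sg; have s2 := smooth_on_partial rI s1.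
have E2 := dr_chart_eq E1; have E3 := dr_chart_eq E2.
split; [exists (partial rI g (bd_pt phi p))|exists (partial rI (partial rI g) (bd_pt phi p))].
- exact: cvg_chart dp d0 (smooth_on_continuous s1 z0) E2.
- exact: cvg_chart dp d0 (smooth_on_continuous s2 z0) E3.
Qed.

End TowardBoundary.

Section BoundaryRegularity.
Context {R : realType} {k : nat} {S : smooth_space R k} {e : {posnum R}}.
Notation pt x r := (row_mx x r%:M : 'rV[R]_(k + 1)).
Notation rI := (rshift k (0 : 'I_1)).
Notation tb p := (@toward_boundary R k S e p).
Notation smooth_bd := (@smooth_to_boundary R k S e).
Notation restr V := (@interior_restr R k S e V).
Implicit Types (V W : S -> R -> R) (phi : chart R k S) (p : S).

(** The Laplacian in the first k variables, kept as an operator on functions of all k + 1 variables: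
    the result is then jointly smooth, in particular across r = 0. *)
Definition slice_laplacian (H : 'rV[R]_k -> 'M[R]_k) (u : 'rV[R]_(k + 1) -> R) z : R :=
  \sum_i \sum_j invmx (H (lsubmx z)) i j *
    (partial (lshift 1 i) (partial (lshift 1 j) u) z
     - \sum_l christoffel H l i j (lsubmx z) * partial (lshift 1 l) u z).

Lemma slice_laplacianE H u (x : 'rV[R]_k) (r : R) :
  coord_laplacian H (fun x => u (pt x r)) x = slice_laplacian H u (pt x r).
Proof.
apply: eq_bigr => i _; apply: eq_bigr => j _; rewrite row_mxKl.
have E1 : partial (lshift 1 i) (partial (lshift 1 j) u) (pt x r) =
    partial i (partial j (fun x' => u (pt x' r))) x.
  apply: (etrans (partial_lshift _ i x r)).
  rewrite (_ : (fun x' => partial (lshift 1 j) u _) = partial j (fun x' => u (pt x' r)))//.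
  by apply/funext => z; exact: partial_lshift.
congr (_ * _); rewrite hessianE E1; congr (_ - _).
by apply: eq_bigr => l _; rewrite partial_lshift.
Qed.

Lemma smooth_slice_laplacian D (U : set 'rV[R]_k) H u : open D -> metric_on U H ->
  D `<=` lsubmx @^-1` U -> smooth_on D u -> smooth_on D (slice_laplacian H u).
Proof.
move=> oD mH DU su; have [oU sH _ uH] := mH.
have lift (f : 'rV[R]_k -> R) : smooth_on U f -> smooth_on D (fun z => f (lsubmx z)).
  by move=> sf; apply: smooth_onS DU _; exact: smooth_on_lsubmx.
apply: smooth_on_sum => // i; apply: smooth_on_sum => // j.
apply: smooth_onM => //; first by apply: (lift (fun x => invmx (H x) i j)); exact: smooth_invmx.
apply: smooth_onB => //; first by do 2 apply: smooth_on_partial.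
apply: smooth_on_sum => // l; apply: smooth_onM => //; last exact: smooth_on_partial.
by apply: lift; exact: smooth_christoffel mH.
Qed.

Lemma slice_laplacian_eq (D : set 'rV[R]_(k + 1)) H u v z : open D -> D z ->
  (forall y, D y -> u y = v y) -> slice_laplacian H u z = slice_laplacian H v z.
Proof.
move=> oD Dz uv; apply: eq_bigr => i _; apply: eq_bigr => j _.
have H1 : partial (lshift 1 i) (partial (lshift 1 j) u) z = partial (lshift 1 i) (partial (lshift 1 j) v) z.
  by apply: (partial_eq (lshift 1 i) oD _ Dz) => y Dy; exact: partial_eq uv Dy.
have H2 : \sum_l christoffel H l i j (lsubmx z) * partial (lshift 1 l) u z =
    \sum_l christoffel H l i j (lsubmx z) * partial (lshift 1 l) v z.
  by apply: eq_bigr => l _; rewrite (partial_eq (lshift 1 l) oD uv Dz).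
exact: (congr1 ( *%R _) (congr2 (fun a b => a - b) H1 H2)).
Qed.

Lemma laplacian_converges (h : riem_metric S) V p : smooth_bd V ->
  converges (e := e) p (fun p r => laplacian h (fun p => V p r) p).
Proof.
move=> sV; have [phi aphi dp] := atlas_cover p.
have [d [g [d0 sg cd Vg]]] := smooth_bd_extension aphi dp sV.
have z0 : `|bd_pt phi p - bd_pt phi p| < d by rewrite subrr normr0.
exists (slice_laplacian (h phi) g (bd_pt phi p)); apply: (cvg_chart dp d0).
  apply: smooth_on_continuous z0.
  apply: smooth_slice_laplacian (chart_metric_on h aphi) _ sg; first exact: ball_open.
  by move=> z /cd[].
move=> z zd zc ze.
have [dz zE] := cinvK zc.
rewrite /chart_fun (laplacian_chartE h (smooth_interior_slice (smooth_bd_interior sV) ze) aphi dz) zE.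
rewrite (_ : _ \o _ = fun x => chart_fun phi V (pt x (rsubmx z 0 0))); last first.
  by apply/funext => x; rewrite /chart_fun row_mxKl rsubmx_pt.
rewrite slice_laplacianE row_mx_sub.
apply: (@slice_laplacian_eq ([set z | `|z - bd_pt phi p| < d] `&` chart_cyl e phi)).
- by apply: openI; [exact: ball_open|exact: chart_cyl_open].
- by [].
- by move=> y [yd [_ /andP[/ltW y0 _]]]; exact: Vg.
Qed.

(** A right limit is taken at r = 0 because the values of V at negative r carry no information. *)
Definition bd_quot V : S -> R -> R := fun p r =>
  if r == 0 then lim (V p t / t @[t --> 0^'+]) else V p r / r.

Lemma coord_rI (z : 'rV[R]_(k + 1)) : z 0 rI = rsubmx z 0 0.
Proof. by rewrite mxE. Qed.

(** Where r > 0 the division is smooth. At a boundary point the Hadamard quotient of a local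
    extension g is used: g vanishes on r = 0 because it agrees with V there. *)
Lemma smooth_bd_quot V : smooth_bd V -> (forall p, V p 0 = 0) -> smooth_bd (bd_quot V).
Proof.
move=> sV V0 phi aphi z [zc /andP[]]; rewrite le_eqVlt => /orP[/eqP r0|r0] ze; last first.
  exists (chart_cyl e phi), (fun z => chart_fun phi V z * (rsubmx z 0 0)^-1); split.
  - exact: chart_cyl_open.
  - by split=> //; rewrite /itv0 /= r0.
  - apply: smooth_onM; [exact: chart_cyl_open|exact: smooth_bd_interior|].
    apply: smooth_on_inv; [exact: chart_cyl_open| |exact: smooth_on_rcoord].
    by move=> y [_ /andP[/lt0r_neq0]].
  - move=> y [_ /andP[/lt0r_neq0 y0 _]] _.
    by rewrite /bd_quot (negbTE y0).
have [dz zE] := cinvK zc; set p := cinv phi (lsubmx z) in dz zE.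
have [d [g [d0 sg cd Vg]]] := smooth_bd_extension aphi dz sV.
have z0E : bd_pt phi p = z by rewrite /bd_pt zE r0 row_mx_sub.
rewrite z0E in sg cd Vg.
pose B := [set y : 'rV[R]_(k + 1) | `|y - z| < d].
have oB : open B by exact: ball_open.
have starB : star_shaped rI B.
  move=> y s yd sy; apply: le_lt_trans yd; apply: line_dist => //.
  by rewrite coord_rI.
have g0 y : B y -> y 0 rI = 0 -> g y = 0.
  rewrite coord_rI => By y0; rewrite -Vg ?y0//.
  by rewrite /chart_fun y0 V0.
have sq := smooth_quot oB starB sg g0.
exists B, (quot rI 1 g); split=> //; first by rewrite /B /= subrr normr0.
move=> y By [yc /andP[yr ye]].
have [y0|y0] := eqVneq (rsubmx y 0 0) 0; last first.
  by rewrite /bd_quot (negbTE y0) quot_off coord_rI// expr1 -Vg.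
rewrite /bd_quot y0 eqxx.
have By' : B (pt (lsubmx y) 0) by rewrite -y0 row_mx_sub.
apply: cvg_lim => //.
have D := derivable_rslice (smooth_on_diff sq By').
have C : {for 0, continuous (fun t : R => quot rI 1 g (pt (lsubmx y) t))}.
  by apply: differentiable_continuous; apply/derivable1_diffP; case: D.
have N : \forall t \near (0 : R), B (pt (lsubmx y) t).
  have cpt : {for 0, continuous (fun t : R => pt (lsubmx y) t)}.
    apply: differentiable_continuous; apply/derivable1_diffP.
    apply/derivable_mxP => i j; rewrite ord1.
    have D1 := @derivable_rslice _ _ (fun w : 'rV[R]_(k + 1) => w 0 j) (lsubmx y) 0 (differentiable_coord _ _ _).
    by case: D1.
  by have := cpt; apply; exact: near_open oB By'.
(* Continuity of the smooth quotient identifies the right limit in [bd_quot] with its value on the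
   hyperplane. *)
have C' : quot rI 1 g (pt (lsubmx y) t) @[t --> 0^'+] --> quot rI 1 g (pt (lsubmx y) 0).
  by apply: cvg_at_right_filter; exact: C.
rewrite -[X in pt (lsubmx y) X]y0 row_mx_sub in C'.
pose F t := V (cinv phi (lsubmx y)) t / t.
suff E : {near 0^'+, (fun t : R => quot rI 1 g (pt (lsubmx y) t)) =1 F}.
  exact: cvg_trans (near_eq_cvg E) C'.
near=> t; have t0 : 0 < t by [].
have Bt : B (pt (lsubmx y) t) by near: t; apply: cvg_within; exact: N.
rewrite quot_off ?coord_rI ?rsubmx_pt ?gt_eqF// expr1 -Vg//; last by rewrite rsubmx_pt ltW.
by rewrite /chart_fun row_mxKl rsubmx_pt.
Unshelve. all: by end_near. Qed.

Lemma bd_quotE V p (r : R) : r != 0 -> bd_quot V p r = V p r / r.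
Proof. by rewrite /bd_quot => /negbTE ->. Qed.

Lemma smooth_bd_eq V W : (forall p (r : R), 0 <= r < e%:num -> V p r = W p r) ->
  smooth_bd V -> smooth_bd W.
Proof.
move=> VW sV phi aphi; apply: smooth_ext_on_eq (sV phi aphi) => z [_ z0].
exact: VW.
Qed.

Lemma smooth_bdD V W : smooth_bd V -> smooth_bd W -> smooth_bd (fun p r => V p r + W p r).
Proof. by move=> sV sW phi aphi; exact: smooth_ext_onD (sV phi aphi) (sW phi aphi). Qed.

Lemma smooth_bdM V W : smooth_bd V -> smooth_bd W -> smooth_bd (fun p r => V p r * W p r).
Proof. by move=> sV sW phi aphi; exact: smooth_ext_onM (sV phi aphi) (sW phi aphi). Qed.

Lemma smooth_bd_r : smooth_bd (fun _ r => r).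
Proof.
move=> phi aphi; apply: (@smooth_ext_onW _ _ setT) => //; first exact: openT.
exact: smooth_on_rcoord.
Qed.

Lemma smooth_bd_cst (c : R) : smooth_bd (fun _ _ => c).
Proof.
move=> phi aphi; apply: (@smooth_ext_onW _ _ setT) => //; first exact: openT.
exact: smooth_on_cst.
Qed.

Lemma smooth_bd_fun (a : S -> R) : smooth_fun a -> smooth_bd (fun p _ => a p).
Proof.
move=> sa phi aphi; apply: (smooth_ext_onW _ _ (smooth_on_lsubmx (sa phi aphi))).
  apply: (open_comp (f := lsubmx : 'rV[R]_(k + 1) -> 'rV[R]_k)); last exact: cimg_open.
  by move=> z _; exact: continuous_lsubmx.
by move=> z [].
Qed.

Lemma smooth_bdX V m : smooth_bd V -> smooth_bd (fun p r => V p r ^+ m).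
Proof.
move=> sV; elim: m => [|m IH]; first exact: smooth_bd_cst.
by apply: smooth_bd_eq (smooth_bdM sV IH) => p r _; rewrite exprS.
Qed.

Lemma smooth_bd_sum m (F : nat -> S -> R -> R) : (forall i, smooth_bd (F i)) ->
  smooth_bd (fun p r => \sum_(0 <= i < m) F i p r).
Proof.
move=> sF; elim: m => [|m IH].
  by apply: smooth_bd_eq (smooth_bd_cst 0) => p r _; rewrite big_nil.
by apply: smooth_bd_eq (smooth_bdD IH (sF m)) => p r _; rewrite big_nat_recr.
Qed.

Lemma smooth_bd_comp1 (D : set R) (psi : nat -> R -> R) V : open D -> derivatives_on D psi ->
  (forall p (r : R), 0 <= r < e%:num -> D (V p r)) -> smooth_bd V ->
  smooth_bd (fun p r => psi 0%N (V p r)).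
Proof.
move=> oD dpsi DV sV phi aphi.
apply: (smooth_ext_on_comp1 oD dpsi _ (sV phi aphi)) => z [_ ze]; exact: DV.
Qed.

Definition powR_derivs (a : R) (m : nat) (x : R) : R :=
  (\prod_(i < m) (a - i%:R)) * x `^ (a - m%:R).

Lemma derivatives_powR (a : R) : derivatives_on [set x | 0 < x] (powR_derivs a).
Proof.
move=> m x x0; have D := @is_derive1_powR R (a - m%:R) x x0.
have := @is_deriveZ _ _ _ _ (\prod_(i < m) (a - i%:R)) x 1 _ D.
suff -> : (\prod_(i < m) (a - i%:R)) *: ((a - m%:R) * x `^ (a - m%:R - 1)) =
  powR_derivs a m.+1 x by [].
rewrite /powR_derivs big_ord_recr /= -[_ *: _]/(_ * _) mulrA; congr (_ * _).
by congr (_ `^ _); rewrite -natr1; ring.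
Qed.

Lemma gt0_open : open [set x : R | 0 < x].
Proof.
rewrite (_ : [set x | _] = `]0, +oo[%classic); first exact: interval_open.
by apply/seteqP; split => x /=; rewrite in_itv/= andbT.
Qed.

Lemma smooth_bd_powR V (a : R) : (forall p (r : R), 0 <= r < e%:num -> 0 < V p r) ->
  smooth_bd V -> smooth_bd (fun p r => V p r `^ a).
Proof.
move=> V0 sV; have := smooth_bd_comp1 gt0_open (@derivatives_powR a) V0 sV.
by apply: smooth_bd_eq => p r _; rewrite /powR_derivs big_ord0 mul1r subr0.
Qed.

Definition ln_derivs (m : nat) (x : R) : R :=
  if m is m'.+1 then (-1) ^+ m' * m'`!%:R * x ^- m'.+1 else ln x.

Lemma derivatives_ln : derivatives_on [set x | 0 < x] ln_derivs.
Proof.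
move=> [|m] x x0 /=; last by apply: is_derive_inv_pow; rewrite gt_eqF.
by rewrite expr0 fact0 !mul1r expr1; exact: is_derive1_ln.
Qed.

Lemma smooth_bd_ln V : (forall p (r : R), 0 <= r < e%:num -> 0 < V p r) ->
  smooth_bd V -> smooth_bd (fun p r => ln (V p r)).
Proof. by move=> V0 sV; exact: smooth_bd_comp1 gt0_open derivatives_ln V0 sV. Qed.

Lemma smooth_bd_conf lambda : smooth_bd (fun _ r => conf lambda r).
Proof.
have := smooth_bdD (smooth_bd_cst 1) (smooth_bdM (smooth_bd_cst (- (lambda / 4))) (smooth_bdX 2 smooth_bd_r)).
by apply: smooth_bd_eq => p r _; rewrite /conf mulNr.
Qed.

End BoundaryRegularity.

(** * Vanishing to the order of the obstruction *)

Section Vanishing.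
Context {R : realType} {k : nat} {S : smooth_space R k} {e : {posnum R}}.
Notation tb p := (@toward_boundary R k S e p).
Notation smooth_bd := (@smooth_to_boundary R k S e).
Notation restr V := (@interior_restr R k S e V).
Notation smooth_int := (@smooth_interior R k S e).
Implicit Types (V W : S -> R -> R) (p : S) (q : cyl S e).

(** The points (p, r) with r small lie in every set of the filter. Properness makes boundary values
    unique. *)
Global Instance toward_boundary_proper p : ProperFilter (tb p).
Proof.
split; last exact: toward_boundary_filter.
move=> [W nW hW].
have N : \forall r \near (0 : R)^'+, W (p, r) /\ itv0 e r.
  have [[A B] /= [nA nB] AB] := nW.
  near=> r; split.
    apply: AB; split => /=; first exact: nbhs_singleton nA.
    by near: r; exact: cvg_within nB.
  apply/andP; split; first by near: r; exact: nbhs_right_gt.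
  by near: r; exact: nbhs_right_lt.
near (0 : R)^'+ => r; have [Wr re] : W (p, r) /\ itv0 e r by near: r.
by apply: (hW (p, to_itv0 e r)); rewrite /= val_to_itv0.
Unshelve. all: by end_near. Qed.

Lemma tb_cvgM p (f g : cyl S e -> R) (a b : R) : f q @[q --> tb p] --> a ->
  g q @[q --> tb p] --> b -> f q * g q @[q --> tb p] --> a * b.
Proof. by move=> fa gb; apply: cvgM. Qed.

Lemma tb_cvgD p (f g : cyl S e -> R) (a b : R) : f q @[q --> tb p] --> a ->
  g q @[q --> tb p] --> b -> f q + g q @[q --> tb p] --> a + b.
Proof. by move=> fa gb; apply: cvgD. Qed.

Lemma tb_cvgZ p (f : cyl S e -> R) (a c : R) : f q @[q --> tb p] --> a ->
  c * f q @[q --> tb p] --> c * a.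
Proof. by move=> fa; apply: tb_cvgM => //; exact: cvg_cst. Qed.

Lemma tb_cvgB p (f g : cyl S e -> R) (a b : R) : f q @[q --> tb p] --> a ->
  g q @[q --> tb p] --> b -> f q - g q @[q --> tb p] --> a - b.
Proof. by move=> fa gb; apply: cvgB. Qed.

Lemma tb_cvgX p (f : cyl S e -> R) (a : R) m : f q @[q --> tb p] --> a ->
  f q ^+ m @[q --> tb p] --> a ^+ m.
Proof.
move=> fa; elim: m => [|m IH]; first exact: cvg_cst.
by rewrite exprS; under eq_fun do rewrite exprS; exact: tb_cvgM.
Qed.

Lemma tb_cvg_unique p (f : cyl S e -> R) (a b : R) : f q @[q --> tb p] --> a ->
  f q @[q --> tb p] --> b -> a = b.
Proof. by move=> fa fb; apply: (cvg_unique _ fa fb). Qed.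

Lemma tb_cvg_eq p (f g : cyl S e -> R) (a b : R) : (forall q, f q = g q) -> a = b ->
  f q @[q --> tb p] --> a -> g q @[q --> tb p] --> b.
Proof. by move=> /funext -> ->. Qed.

Lemma tb_cvg_bound p (f : cyl S e -> R) (C : R) (g : cyl S e -> R) :
  (\forall q \near tb p, `|f q| <= C * g q) -> g q @[q --> tb p] --> (0 : R) ->
  f q @[q --> tb p] --> (0 : R).
Proof.
move=> fg g0; apply: (squeeze_cvgr (f := fun q => - (C * g q)) (h := fun q => C * g q)).
- by apply: filterS fg => q; rewrite ler_norml.
- apply: (tb_cvg_eq (f := fun q => - C * g q) _ (mulr0 (- C))); last exact: tb_cvgZ.
  by move=> q; exact: mulNr.
- by apply: (tb_cvg_eq (f := fun q => C * g q) _ (mulr0 C)) => //; exact: tb_cvgZ.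
Qed.

Lemma val_itv0 q : itv0 e (\val q.2).
Proof. exact: set_mem (valP q.2). Qed.

Lemma val_gt0 q : 0 < \val q.2.
Proof. by case/andP: (val_itv0 q). Qed.

Lemma smooth_int_eq V W : (forall p (r : R), itv0 e r -> V p r = W p r) ->
  smooth_int V -> smooth_int W.
Proof.
move=> VW sV phi aphi; apply: (smooth_on_eq (@chart_cyl_open _ _ _ e phi) _ (sV phi aphi)).
by move=> z [_ ze]; exact: VW.
Qed.

Lemma smooth_intM V W : smooth_int V -> smooth_int W -> smooth_int (fun p r => V p r * W p r).
Proof.
move=> sV sW phi aphi.
exact: (smooth_onM (@chart_cyl_open _ _ _ e phi) (sV phi aphi) (sW phi aphi)).
Qed.

Lemma smooth_intD V W : smooth_int V -> smooth_int W -> smooth_int (fun p r => V p r + W p r).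
Proof.
move=> sV sW phi aphi.
exact: (smooth_onD (@chart_cyl_open _ _ _ e phi) (sV phi aphi) (sW phi aphi)).
Qed.

Lemma smooth_int_comp1 (D : set R) (psi : nat -> R -> R) V : derivatives_on D psi ->
  (forall p (r : R), itv0 e r -> D (V p r)) -> smooth_int V ->
  smooth_int (fun p r => psi 0%N (V p r)).
Proof.
move=> dpsi DV sV phi aphi.
apply: (smooth_on_comp1 (@chart_cyl_open _ _ _ e phi) dpsi _ (sV phi aphi)) => z [_ ze].
exact: DV.
Qed.

Lemma smooth_int_powR V (s : R) : (forall p (r : R), itv0 e r -> 0 < V p r) ->
  smooth_int V -> smooth_int (fun p r => V p r `^ s).
Proof.
move=> V0 sV; have := smooth_int_comp1 (@derivatives_powR _ s) V0 sV.
by apply: smooth_int_eq => p r _; rewrite /powR_derivs big_ord0 mul1r subr0.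
Qed.

Lemma smooth_int_ln V : (forall p (r : R), itv0 e r -> 0 < V p r) ->
  smooth_int V -> smooth_int (fun p r => ln (V p r)).
Proof. by move=> V0 sV; exact: smooth_int_comp1 (@derivatives_ln _) V0 sV. Qed.

Lemma smooth_int_r : smooth_int (fun _ r => r).
Proof. exact/smooth_bd_interior/smooth_bd_r. Qed.

Lemma smooth_int_rpow (s : R) : smooth_int (fun _ r => r `^ s).
Proof. by apply: smooth_int_powR smooth_int_r => p r /andP[]. Qed.

Lemma smooth_fun_restr V : smooth_int V -> smooth_fun (restr V).
Proof.
move=> sV _ [phi aphi <-].
have E : cimg (cyl_chart e phi) = chart_cyl e phi by exact: cyl_imgE.
rewrite E; apply: (smooth_on_eq (@chart_cyl_open _ _ _ e phi) _ (sV phi aphi)).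
by move=> z [z1 z2]; rewrite /= /interior_restr /cyl_inv /chart_fun /= val_to_itv0.
Qed.

Variables (h : riem_metric S) (hp : riem_metric (cyl S e)) (lambda : R).
Hypothesis conf_gt0 : forall r, 0 <= r < e%:num -> 0 < conf lambda r.
Hypothesis hpE : forall (phi : chart R k S) x r, atlas phi -> cimg phi x -> itv0 e r ->
  hp (cyl_chart e phi) (row_mx x r%:M : 'rV[R]_(k + 1)) =
    block_mx ((conf lambda r ^+ 2 / r ^+ 2) *: h phi x) 0 0 (r ^- 2)%:M.

Definition lap_h V : S -> R -> R := fun p r => laplacian h (fun p => V p r) p.

(* the terms of r^-s Delta (r^s V) that vanish on the boundary *)
Definition lower_terms (s : R) V : S -> R -> R := fun p r =>
  r ^+ 2 / conf lambda r ^+ 2 * lap_h V p r + r ^+ 2 * dr (dr V) p r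
  + (2 * s + 1 - k%:R) * r * dr V p r
  - k%:R * lambda / 2 * (r ^+ 2 / conf lambda r) * (r * dr V p r + s * V p r).

Lemma conf_neq0 r : itv0 e r -> conf lambda r != 0.
Proof. by case/andP=> r0 re; apply/lt0r_neq0/conf_gt0; rewrite ltW. Qed.

Lemma dr_rpowM (s : R) V p (r : R) : smooth_int V -> itv0 e r ->
  dr (fun p r => r `^ s * V p r) p r = r `^ s * dr V p r + s * r `^ (s - 1) * V p r.
Proof.
move=> sV re; have r0 : 0 < r by case/andP: re.
have := is_deriveM (is_derive1_powR s r0) (smooth_interior_derivable p sV re).
move=> [_ E]; apply: (etrans E); rewrite -![_ *: _]/(_ * _).
by congr (_ + _); exact: mulrC.
Qed.

Lemma dr_eq V W p (r : R) : (forall r, itv0 e r -> V p r = W p r) -> itv0 e r ->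
  dr V p r = dr W p r.
Proof.
move=> VW re; apply: near_eq_derive.
by apply: filterS (near_open itv0_open re) => t; exact: VW.
Qed.

(** The terms r^2 d^2/dr^2 and (1 - k) r d/dr of the Laplacian act on r^s by s (s - 1) + (1 - k) s =
    s (s - k), the indicial polynomial; everything else goes into [lower_terms]. *)
Lemma laplacian_rpow (s : R) V q : smooth_int V ->
  laplacian hp (restr (fun p r => r `^ s * V p r)) q =
  \val q.2 `^ s * (restr (lower_terms s V) q + s * (s - k%:R) * restr V q).
Proof.
move=> sV; have sr := smooth_int_rpow s.
rewrite (cylinder_laplacian conf_gt0 hpE q (smooth_intM sr sV)).
have re := val_itv0 q; have r0 := val_gt0 q.
rewrite /interior_restr; move: (q.1) (\val q.2) re r0 => p r re r0.
have E1 := dr_rpowM s p sV re.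
have E2 : dr (dr (fun p r => r `^ s * V p r)) p r =
    r `^ s * dr (dr V) p r + s * r `^ (s - 1) * dr V p r
    + s * (r `^ (s - 1) * dr V p r + (s - 1) * r `^ (s - 1 - 1) * V p r).
  have D1 := smooth_interior_derivable p (smooth_interior_dr sV) re.
  have D0 := smooth_interior_derivable p sV re.
  have H1 := is_deriveM (is_derive1_powR s r0) D1.
  have H2 := is_deriveZ (s) (is_deriveM (is_derive1_powR (s - 1) r0) D0).
  have [_ H3] := is_deriveD H1 H2.
  have E4 : forall r, itv0 e r -> dr (fun p r => r `^ s * V p r) p r =
      r `^ s * dr V p r + s * (r `^ (s - 1) * V p r).
    by move=> t te; rewrite (dr_rpowM s p sV te) mulrA.
  apply: (etrans (@dr_eq _ (fun p r => r `^ s * dr V p r + s * (r `^ (s - 1) * V p r)) p r E4 re)).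
  apply: (etrans H3); rewrite -![_ *: _]/(_ * _).
  move: (r `^ s) (r `^ (s - 1)) (r `^ (s - 1 - 1)) (dr (dr V) p r) (dr V p r) (V p r) => *.
  by ring.
have E3 : laplacian h (fun p => r `^ s * V p r) p = r `^ s * lap_h V p r.
  have sVr := smooth_interior_slice sV re.
  have E := laplacian_lin h (r `^ s) 0 p sVr (smooth_fun_cst 0).
  rewrite !mul0r addr0 in E; rewrite /lap_h -E; congr (laplacian h _ p).
  by apply/funext => p'; ring.
rewrite E1 E2 E3 /lower_terms.
have P1 x : r `^ (x - 1) = r `^ x / r.
  have c : (x == 1) ==> (r != 0) by rewrite (gt_eqF r0) implybT.
  by rewrite (powRB c) powRr1// ltW.
rewrite !P1; have c0 := conf_neq0 re; have r1 := lt0r_neq0 r0.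
move: (conf lambda r) c0 (r `^ s) (dr (dr V) p r) (dr V p r) (V p r) (lap_h V p r).
by move=> c c0 x v2 v1 v0 w; field; rewrite r1 c0.
Qed.

Lemma cvg_r p : restr (fun _ r => r) q @[q --> tb p] --> (0 : R).
Proof. exact: (@smooth_bd_cvg R k S e (fun _ r => r) p (@smooth_bd_r _ _ _ _)). Qed.

Lemma conf0 : conf lambda 0 = 1.
Proof. by rewrite /conf expr0n mulr0 subr0. Qed.

Lemma cvg_conf p : restr (fun _ r => conf lambda r) q @[q --> tb p] --> (1 : R).
Proof.
rewrite -conf0; exact: (@smooth_bd_cvg R k S e (fun _ r => conf lambda r) p (@smooth_bd_conf _ _ _ _ _)).
Qed.

Lemma cvg_lower_terms s V p : smooth_bd V ->
  restr (lower_terms s V) q @[q --> tb p] --> (0 : R).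
Proof.
move=> sV; have cr := cvg_r p; have cc := cvg_conf p.
have [l0 c0] := laplacian_converges h p sV.
have [[l1 c1] [l2 c2]] := dr_converges p sV.
have cV := smooth_bd_cvg (p := p) sV.
have cci : (restr (fun _ r => conf lambda r) q)^-1 @[q --> tb p] --> (1^-1 : R).
  by apply: cvgV => //; exact: oner_neq0.
have r2 := tb_cvgM cr cr.
have H1 := tb_cvgM (tb_cvgM r2 (tb_cvgM cci cci)) c0.
have H2 := tb_cvgM r2 c2.
have H3 := tb_cvgM (tb_cvgZ (c := 2 * s + 1 - k%:R) cr) c1.
have H4 := tb_cvgM (tb_cvgZ (c := k%:R * lambda / 2) (tb_cvgM r2 cci))
  (tb_cvgD (tb_cvgM cr c1) (tb_cvgZ (c := s) cV)).
apply: tb_cvg_eq (tb_cvgB (tb_cvgD (tb_cvgD H1 H2) H3) H4).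
  by move=> q; rewrite /lower_terms /interior_restr /= -invfM !expr2.
by rewrite !(mulr0, mul0r, addr0, subr0).
Qed.

Lemma cvg_laplacian_rpow (s c : R) V p : smooth_bd V ->
  \val q.2 `^ (- s) * (laplacian hp (restr (fun p r => r `^ s * V p r)) q
    + c * (\val q.2 `^ s * restr V q)) @[q --> tb p] --> (s * (s - k%:R) + c) * V p 0.
Proof.
move=> sV; have cl := cvg_lower_terms s p sV; have cV := smooth_bd_cvg (p := p) sV.
apply: tb_cvg_eq (tb_cvgD cl (tb_cvgZ (c := s * (s - k%:R) + c) cV)) => [q|]; last by rewrite add0r.
rewrite (laplacian_rpow s q (smooth_bd_interior sV)).
have : \val q.2 `^ (- s) * \val q.2 `^ s = 1.
  by rewrite powRN mulVf// powR_eq0 (gt_eqF (val_gt0 q)).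
move: (\val q.2 `^ (- s)) (\val q.2 `^ s) (restr _ q) (restr _ q) => a b x y ab.
by rewrite -[LHS]mul1r -ab; ring.
Qed.

(* A solution which vanishes on the boundary vanishes to order 2 l: writing
   u = r^(s + m) H, the leading coefficient of the defect of u is m (m - 2 l) H. *)
Lemma indicial_vanishing (l : nat) (s c : R) V : smooth_bd V -> (forall p, V p 0 = 0) ->
  s * (s - k%:R) + c = 0 -> 2 * s - k%:R = - (2 * l%:R) ->
  (forall p, exists C, \forall q \near tb p,
     `|laplacian hp (restr (fun p r => r `^ s * V p r)) q + c * (\val q.2 `^ s * restr V q)|
       <= C * \val q.2 `^ (s + 2 * l%:R)) ->
  forall m, (m <= 2 * l)%N -> exists H, [/\ smooth_bd H,
    forall p (r : R), itv0 e r -> r `^ s * V p r = r `^ (s + m%:R) * H p r &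
    (m < 2 * l)%N -> forall p, H p 0 = 0].
Proof.
move=> sV V0 ind sl bV; elim=> [_|m IH mlt].
  by exists V; split=> // p r re; rewrite addr0.
have [H [sH VH H0]] := IH (ltnW mlt).
exists (bd_quot H); have sQ := smooth_bd_quot sH (H0 mlt).
have VQ p (r : R) : itv0 e r -> r `^ s * V p r = r `^ (s + m.+1%:R) * bd_quot H p r.
  move=> re; have r0 : 0 < r by case/andP: re.
  have PE : r `^ (s + m.+1%:R) = r `^ (s + m%:R) * r.
    have -> : s + m.+1%:R = s + m%:R + 1 by rewrite -natr1 addrA.
    have c0 : (s + m%:R + 1 == 0) ==> (r != 0) by rewrite (gt_eqF r0) implybT.
    by rewrite (powRD c0) (powRr1 (ltW r0)).
  rewrite VH// bd_quotE ?gt_eqF// PE -mulrA [r * _]mulrC divfK//.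
  by rewrite gt_eqF.
split=> // m1l p.
have T := @cvg_laplacian_rpow (s + m.+1%:R) c (bd_quot H) p sQ.
(* The polynomial x (x - k) + c has the roots s and k - s = s + 2 l, hence this factorisation. *)
have coefE : (s + m.+1%:R) * (s + m.+1%:R - k%:R) + c = m.+1%:R * (m.+1%:R - 2 * l%:R).
  have -> : c = - (s * (s - k%:R)) by move: ind; lra.
  have -> : k%:R = 2 * s + 2 * l%:R by move: sl; lra.
  by ring.
have coef0 : (s + m.+1%:R) * (s + m.+1%:R - k%:R) + c != 0.
  rewrite coefE mulf_neq0 ?pnatr_eq0// subr_eq0 -natrM eqr_nat.
  by rewrite neq_ltn m1l.
suff Z : \val q.2 `^ (- (s + m.+1%:R)) *
    (laplacian hp (restr (fun p r => r `^ (s + m.+1%:R) * bd_quot H p r)) q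
     + c * (\val q.2 `^ (s + m.+1%:R) * restr (bd_quot H) q)) @[q --> tb p] --> (0 : R).
  by apply: (mulfI coef0); rewrite (tb_cvg_unique T Z) mulr0.
have [C bC] := bV p.
have uE : restr (fun p r => r `^ s * V p r) = restr (fun p r => r `^ (s + m.+1%:R) * bd_quot H p r).
  by apply/funext => q; exact: VQ (val_itv0 q).
(* The defect is O(r^(s + 2 l)); after multiplication by r^(- s - m - 1) a positive power r^j
   remains, so the limit is 0, while T gives it as a nonzero multiple of the boundary value of the
   quotient. *)
pose j := (2 * l - m.+1)%N; have j0 : (0 < j)%N by rewrite subn_gt0.
apply: (@tb_cvg_bound p _ C (fun q => \val q.2 ^+ j)); last first.
  by have := tb_cvgX (m := j) (cvg_r p); rewrite expr0n gtn_eqF.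
apply: filterS bC => q; rewrite uE.
have -> : \val q.2 `^ s * restr V q = \val q.2 `^ (s + m.+1%:R) * restr (bd_quot H) q.
  exact: VQ (val_itv0 q).
have r0 := val_gt0 q; have rp x : 0 < \val q.2 `^ x by exact: powR_gt0.
move: (laplacian _ _ _ + _) => X bX; rewrite normrM gtr0_norm//.
have -> : C * \val q.2 ^+ j = \val q.2 `^ (- (s + m.+1%:R)) * (C * \val q.2 `^ (s + 2 * l%:R)).
  rewrite mulrCA; congr (_ * _); rewrite -powRD; last by rewrite (gt_eqF r0) implybT.
  rewrite -powR_mulrn ?ltW//; congr (_ `^ _).
  by rewrite /j natrB// natrM; ring.
by rewrite ler_wpM2l// ltW.
Qed.

(** Once r^s V = r^(s + 2 l) H, the exponent s + 2 l is the second indicial root, so the limit is 0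
    whatever the boundary value of H. *)
Lemma obstruction_vanishing (l : nat) (s c : R) V p : smooth_bd V -> (forall p, V p 0 = 0) ->
  s * (s - k%:R) + c = 0 -> 2 * s - k%:R = - (2 * l%:R) ->
  (forall p, exists C, \forall q \near tb p,
     `|laplacian hp (restr (fun p r => r `^ s * V p r)) q + c * (\val q.2 `^ s * restr V q)|
       <= C * \val q.2 `^ (s + 2 * l%:R)) ->
  \val q.2 `^ (- (s + 2 * l%:R)) *
    (laplacian hp (restr (fun p r => r `^ s * V p r)) q + c * (\val q.2 `^ s * restr V q))
    @[q --> tb p] --> (0 : R).
Proof.
move=> sV V0 ind sl bV.
have [H [sH VH _]] := indicial_vanishing sV V0 ind sl bV (leqnn _).
have T := @cvg_laplacian_rpow (s + (2 * l)%:R) c H p sH.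
have uE : restr (fun p r => r `^ s * V p r) = restr (fun p r => r `^ (s + (2 * l)%:R) * H p r).
  by apply/funext => q; exact: VH (val_itv0 q).
apply: tb_cvg_eq T => [q|].
  rewrite uE natrM; congr (_ * (_ + c * _)).
  by rewrite -natrM; symmetry; exact: VH (val_itv0 q).
rewrite (_ : _ + c = 0) ?mul0r//.
have -> : c = - (s * (s - k%:R)) by move: ind; lra.
have -> : k%:R = 2 * s + 2 * l%:R by move: sl; lra.
by rewrite natrM; ring.
Qed.

End Vanishing.

(** * Exact extensions *)

Section ExactSolutions.
Context {R : realType} {k : nat} {S : smooth_space R k} {e : {posnum R}}.
Notation restr V := (@interior_restr R k S e V).
Notation smooth_int := (@smooth_interior R k S e).
Notation smooth_bd := (@smooth_to_boundary R k S e).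
Implicit Types (a : S -> R) (p : S) (q : cyl S e).

Variables (h : riem_metric S) (hp : riem_metric (cyl S e)) (lambda : R).
Hypothesis conf_gt0 : forall r, 0 <= r < e%:num -> 0 < conf lambda r.
Hypothesis hpE : forall (phi : chart R k S) x r, atlas phi -> cimg phi x -> itv0 e r ->
  hp (cyl_chart e phi) (row_mx x r%:M : 'rV[R]_(k + 1)) =
    block_mx ((conf lambda r ^+ 2 / r ^+ 2) *: h phi x) 0 0 (r ^- 2)%:M.

(* In the geodesic coordinate [dt = - dr / r] of [h_+], for [lambda = 1], this is
   [1 / sinh t]; the Laplacian acts on its powers with two terms only. *)
Definition sinh_inv (r : R) : R := r / conf lambda r.

(** The logarithmic derivative of [sinh_inv]; for lambda = 1, [r * coth_r r] is coth t. *)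
Definition coth_r (r : R) : R := (1 + lambda / 4 * r ^+ 2) / (r * conf lambda r).

Let conf0' r : itv0 e r -> conf lambda r != 0.
Proof. exact: conf_neq0. Qed.

Lemma sinh_inv_gt0 r : itv0 e r -> 0 < sinh_inv r.
Proof. by move=> /andP[r0 re]; rewrite divr_gt0// conf_gt0// ltW. Qed.

Lemma is_derive_sinh_inv r : itv0 e r -> is_derive r 1 sinh_inv (sinh_inv r * coth_r r).
Proof.
move=> re; have c0 := conf0' re; have r0 : r != 0 by case/andP: re => /lt0r_neq0.
have D := is_deriveM (is_derive_id r 1) (is_deriveV c0 (is_derive_conf lambda r)).
suff <- : r *: (- conf lambda r ^- 2 *: - (lambda / 2 * r)) + (conf lambda r)^-1 *: 1 =
  sinh_inv r * coth_r r by exact: D.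
rewrite -![_ *: _]/(_ * _) /sinh_inv /coth_r.
have -> : 1 + lambda / 4 * r ^+ 2 = conf lambda r + lambda / 2 * r ^+ 2 by rewrite /conf; field.
by move: (conf lambda r) c0 => c c0; field; rewrite r0 c0.
Qed.

Lemma is_derive_coth_r r : itv0 e r -> is_derive r 1 coth_r
  ((lambda / 2 * r - coth_r r * (1 - 3 * (lambda / 4) * r ^+ 2)) / (r * conf lambda r)).
Proof.
move=> re; have c0 := conf0' re; have r0 : r != 0 by case/andP: re => /lt0r_neq0.
have rc0 : r * conf lambda r != 0 by rewrite mulf_neq0.
have D1 : is_derive r 1 (fun t => t * conf lambda t) (1 - 3 * (lambda / 4) * r ^+ 2).
  have D := is_deriveM (is_derive_id r 1) (is_derive_conf lambda r).
  suff <- : r *: - (lambda / 2 * r) + conf lambda r *: 1 = 1 - 3 * (lambda / 4) * r ^+ 2 by exact: D.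
  by rewrite -![_ *: _]/(_ * _) /conf; field.
have D2 : is_derive r 1 (fun t => 1 + lambda / 4 * t ^+ 2) (lambda / 2 * r).
  have D := is_derive_conf (- lambda) r.
  have -> : (fun t => 1 + lambda / 4 * t ^+ 2) = conf (- lambda).
    by apply/funext => t; rewrite /conf !mulNr opprK.
  by move: D; rewrite !mulNr opprK.
have D := is_deriveM D2 (@is_deriveV _ (fun t => t * conf lambda t) r _ 1 rc0 D1).
suff <- : (1 + lambda / 4 * r ^+ 2) *: (- (r * conf lambda r) ^- 2 *: (1 - 3 * (lambda / 4) * r ^+ 2))
  + (r * conf lambda r)^-1 *: (lambda / 2 * r) =
  (lambda / 2 * r - coth_r r * (1 - 3 * (lambda / 4) * r ^+ 2)) / (r * conf lambda r) by exact: D.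
rewrite -![_ *: _]/(_ * _) /coth_r.
by move: (conf lambda r) c0 => c c0; field; rewrite r0 c0.
Qed.

Lemma laplacian_cst (c : R) p : laplacian h (fun=> c) p = 0.
Proof.
rewrite /laplacian; move: (chart_at p) => phi.
rewrite /coord_laplacian big1// => i _; rewrite big1// => j _.
have P1 l : partial l ((fun=> c) \o cinv phi) = fun=> 0.
  by apply/funext => x; exact: partial_cst.
rewrite hessianE (P1 j) partial_cst big1 ?subr0 ?mulr0// => l _.
by rewrite (P1 l) mulr0.
Qed.

Lemma laplacian_separated (c c1 c2 : R -> R) a q :
  smooth_int (fun _ r => c r) -> smooth_fun a ->
  (forall r, itv0 e r -> is_derive r 1 c (c1 r)) ->
  (forall r, itv0 e r -> is_derive r 1 c1 (c2 r)) ->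
  laplacian hp (restr (fun p r => c r * a p)) q =
    let p := q.1 in let r := \val q.2 in
    r ^+ 2 / conf lambda r ^+ 2 * (c r * laplacian h a p) + r ^+ 2 * (c2 r * a p)
    + ((1 - k%:R) * r - k%:R * lambda / 2 * r ^+ 3 / conf lambda r) * (c1 r * a p).
Proof.
move=> sc sa dc dc1.
have sca : smooth_int (fun p r => c r * a p).
  by apply: smooth_intM sc _; exact/smooth_bd_interior/smooth_bd_fun.
rewrite (cylinder_laplacian conf_gt0 hpE q sca).
have re := val_itv0 q; move: (q.1) (\val q.2) re => p r re /=.
have E0 : laplacian h (fun p => c r * a p) p = c r * laplacian h a p.
  have E := laplacian_lin h (c r) 0 p sa (smooth_fun_cst 0).
  rewrite !mul0r addr0 in E; rewrite -E; congr (laplacian h _ p).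
  by apply/funext => p'; ring.
have D (f f1 : R -> R) (t : R) : is_derive t 1 f (f1 t) -> 'D_1 (fun t => f t * a p) t = f1 t * a p.
  move=> df; have [_ H] := is_deriveM df (is_derive_cst (a p) t 1).
  by apply: (etrans H); rewrite -![_ *: _]/(_ * _) mulr0 add0r mulrC.
have E1 t : itv0 e t -> dr (fun p r => c r * a p) p t = c1 t * a p.
  by move=> te; exact: D (dc t te).
have E2 : dr (dr (fun p r => c r * a p)) p r = c2 r * a p.
  apply: (etrans (@dr_eq _ _ _ _ _ (fun p r => c1 r * a p) p r E1 re)).
  exact: D (dc1 r re).
by rewrite E0 E2 (E1 r re).
Qed.

Lemma smooth_bd_sinh_inv : smooth_bd (fun _ r => sinh_inv r).
Proof.
have := smooth_bd_powR (-1) (fun (p : S) => conf_gt0) (@smooth_bd_conf R k S e lambda).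
move=> /(smooth_bdM (@smooth_bd_r R k S e)); apply: smooth_bd_eq => p r re.
by rewrite powR_inv1// ltW// conf_gt0.
Qed.

Lemma smooth_int_sinh_pow (s : R) : smooth_int (fun _ r => sinh_inv r `^ s).
Proof.
apply: smooth_int_powR; first by move=> _ r; exact: sinh_inv_gt0.
exact/smooth_bd_interior/smooth_bd_sinh_inv.
Qed.

(** Write sigma for [sinh_inv], D = r d/dr and C = r [coth_r]. Then D sigma = C sigma, C^2 = 1 +
    lambda sigma^2, D C = lambda sigma^2, and the Laplacian is D^2 - k C D + sigma^2 Delta_h. On
    sigma^s the radial part is s (s - k) C^2 + s lambda sigma^2, which leaves only two powers of
    sigma. *)
Lemma laplacian_sinh_pow (s : R) a q : smooth_fun a ->
  laplacian hp (restr (fun p r => sinh_inv r `^ s * a p)) q =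
    s * (s - k%:R) * (sinh_inv (\val q.2) `^ s * a q.1)
    + sinh_inv (\val q.2) `^ (s + 2)
      * (laplacian h a q.1 + lambda * (s * (s + 1 - k%:R)) * a q.1).
Proof.
move=> sa.
pose c1 r := s * (sinh_inv r `^ s * coth_r r).
pose c2 r := s * (sinh_inv r `^ s * ((lambda / 2 * r - coth_r r * (1 - 3 * (lambda / 4) * r ^+ 2))
   / (r * conf lambda r)) + coth_r r * c1 r).
have dc r : itv0 e r -> is_derive r 1 (fun r => sinh_inv r `^ s) (c1 r).
  move=> re; have S0 := sinh_inv_gt0 re.
  have D := is_derive1_comp (is_derive1_powR s S0) (is_derive_sinh_inv re).
  suff <- : s * sinh_inv r `^ (s - 1) * (sinh_inv r * coth_r r) = c1 r by exact: D.
  have c0 : (s == 1) ==> (sinh_inv r != 0) by rewrite (gt_eqF S0) implybT.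
  rewrite /c1 (powRB c0) (powRr1 (ltW S0)); have := lt0r_neq0 S0.
  by move: (sinh_inv r) (sinh_inv r `^ s) => x y x0; field.
have dc1 r : itv0 e r -> is_derive r 1 c1 (c2 r).
  move=> re; have D := is_deriveZ s (is_deriveM (dc r re) (is_derive_coth_r re)).
  exact: D.
rewrite (laplacian_separated q (smooth_int_sinh_pow s) sa dc dc1).
have re := val_itv0 q; move: (q.1) (\val q.2) re => p r re /=.
have S0 := sinh_inv_gt0 re.
have -> : sinh_inv r `^ (s + 2) = sinh_inv r `^ s * (r / conf lambda r) ^+ 2.
  have c0 : (s + 2 == 0) ==> (sinh_inv r != 0) by rewrite (gt_eqF S0) implybT.
  by rewrite (powRD c0) -(powR_mulrn 2 (ltW S0)).
rewrite /c2 /c1 /coth_r.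
have r0 : r != 0 by case/andP: re => /lt0r_neq0.
have c0 := conf0' re.
(* Eliminating lambda in favour of conf makes the claim a rational identity in the independent
   variables r and c. *)
have lE : lambda = 4 * (1 - conf lambda r) / r ^+ 2 by rewrite /conf; field.
move: (sinh_inv r `^ s) (laplacian h a p) (a p) => y L x.
move: (conf lambda r) c0 lE => c c0 ->.
by field; rewrite r0 c0.
Qed.

Lemma smooth_int_ln_sinh : smooth_int (fun _ r => ln (sinh_inv r)).
Proof.
apply: smooth_int_ln; first by move=> _ r; exact: sinh_inv_gt0.
exact/smooth_bd_interior/smooth_bd_sinh_inv.
Qed.

(** This is the derivative at s = 0 of [laplacian_sinh_pow] with a = 1: the factor s (s - k)
    contributes - k, and s (s + 1 - k) contributes 1 - k. *)
Lemma laplacian_ln_sinh q :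
  laplacian hp (restr (fun p r => ln (sinh_inv r))) q + k%:R =
    (1 - k%:R) * lambda * sinh_inv (\val q.2) ^+ 2.
Proof.
pose c2 r := (lambda / 2 * r - coth_r r * (1 - 3 * (lambda / 4) * r ^+ 2)) / (r * conf lambda r).
have dc r : itv0 e r -> is_derive r 1 (fun r => ln (sinh_inv r)) (coth_r r).
  move=> re; have S0 := sinh_inv_gt0 re.
  have D := is_derive1_comp (is_derive1_ln S0) (is_derive_sinh_inv re).
  suff <- : (sinh_inv r)^-1 * (sinh_inv r * coth_r r) = coth_r r by exact: D.
  by rewrite mulKf// gt_eqF.
have dc1 r : itv0 e r -> is_derive r 1 coth_r (c2 r) by exact: is_derive_coth_r.
have -> : restr (fun p r => ln (sinh_inv r)) = restr (fun p r => ln (sinh_inv r) * 1).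
  by apply/funext => q'; rewrite /interior_restr mulr1.
rewrite (laplacian_separated q smooth_int_ln_sinh (smooth_fun_cst 1) dc dc1).
have re := val_itv0 q; move: (q.1) (\val q.2) re => p r re /=.
rewrite laplacian_cst !mulr0 add0r !mulr1 /c2 /sinh_inv /coth_r.
have r0 : r != 0 by case/andP: re => /lt0r_neq0.
have c0 := conf0' re.
have lE : lambda = 4 * (1 - conf lambda r) / r ^+ 2 by rewrite /conf; field.
move: (conf lambda r) c0 lE => c c0 ->.
by field; rewrite r0 c0.
Qed.

End ExactSolutions.

(** * Products of commuting second-order operators and the reordering of their constants *)

Section OperatorProduct.
Context {R : realType} {k : nat} {S : smooth_space R k} (h : riem_metric S) (lambda : R).
Implicit Types (f g : S -> R) (s : seq R).
Notation N := (neg_laplacian_plus h).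

Lemma smooth_fun_neg_laplacian c f : smooth_fun f -> smooth_fun (N c f).
Proof.
move=> sf; have := smooth_fun_comb (-1) c (smooth_fun_laplacian h sf) sf.
by congr smooth_fun; apply/funext => p; rewrite /neg_laplacian_plus mulN1r.
Qed.

Lemma neg_laplacian_comm c d f : smooth_fun f -> N c (N d f) = N d (N c f).
Proof.
move=> sf; have sL := smooth_fun_laplacian h sf.
have E b : N b f = fun p => (-1) * laplacian h f p + b * f p.
  by apply/funext => p; rewrite /neg_laplacian_plus mulN1r.
apply/funext => p; rewrite {1 3}/neg_laplacian_plus !E.
rewrite (laplacian_lin h (-1) d p sL sf) (laplacian_lin h (-1) c p sL sf).
by move: (laplacian h (laplacian h f) p) (laplacian h f p) => x y; ring.
Qed.

Definition op_chain s f : S -> R := foldr (fun c g => N c g) f s.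

Lemma smooth_op_chain s f : smooth_fun f -> smooth_fun (op_chain s f).
Proof. by move=> sf; elim: s => //= c s IH; exact: smooth_fun_neg_laplacian. Qed.

Lemma op_chain_cat s t f : op_chain (s ++ t) f = op_chain s (op_chain t f).
Proof. exact: foldr_cat. Qed.

Lemma op_chain_comm1 c s f : smooth_fun f -> op_chain s (N c f) = N c (op_chain s f).
Proof.
move=> sf; elim: s => //= d s ->; rewrite neg_laplacian_comm//.
exact: smooth_op_chain.
Qed.

Lemma op_chain_comm s t f : smooth_fun f ->
  op_chain s (op_chain t f) = op_chain t (op_chain s f).
Proof.
move=> sf; elim: t => //= c t IH; rewrite op_chain_comm1 ?IH//.
exact: smooth_op_chain.
Qed.

Lemma op_chain_perm s t f : smooth_fun f -> perm_eq s t -> op_chain s f = op_chain t f.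
Proof.
move=> sf st.
have H := @catCA_perm_ind _ (fun u => op_chain u f = op_chain t f).
apply: (H _ t) => //; last by rewrite perm_sym.
move=> s1 s2 s3; rewrite !op_chain_cat op_chain_comm//.
exact: smooth_op_chain.
Qed.

(** Equal to lambda c_j at y = j. Other arguments are allowed because the recursion yields y = 1 -
    l, 3 - l, ..., l - 1. *)
Definition gjms_const (y : R) : R := lambda * ((k%:R / 2 + y - 1) * (k%:R / 2 - y)).

Lemma gjms_const_sym y : gjms_const (1 - y) = gjms_const y.
Proof. by rewrite /gjms_const; field. Qed.

Definition stepped (l : nat) : seq R :=
  [seq gjms_const ((2 * j)%:R - l%:R + 1) | j <- iota 0 l].

(* The arguments 1 - l, 3 - l, ..., l - 1 become 1, ..., l under [y |-> 1 - y]. *)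
Lemma stepped_perm (l : nat) : perm_eq (stepped l) [seq gjms_const j%:R | j <- iota 1 l].
Proof.
have [m] := ubnP l; elim: m l => // m IH [|[|l]] lm; first by [].
  by rewrite /stepped /= muln0 sub0r addNr -(gjms_const_sym 1) subrr.
have -> : iota 1 l.+2 = iota 1 l ++ [:: l.+1; l.+2].
  by rewrite -[in LHS](addn2 l) iotaD add1n.
(* Passing from l to l + 2 adds the argument - (l + 1) in front, which reflects to l + 2, and l + 1
   at the end. *)
have -> : stepped l.+2 = gjms_const l.+2%:R :: stepped l ++ [:: gjms_const l.+1%:R].
  rewrite /stepped; have -> : iota 0 l.+2 = 0%N :: [seq j.+1 | j <- iota 0 l] ++ [:: l.+1].
    have -> : l.+2 = (1 + (l + 1))%N by rewrite addn1.
    by rewrite !iotaD -(iotaDl 1 0 l) add0n add1n.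
  rewrite /= map_cat /=; congr (_ :: _ ++ [:: _]).
  - by rewrite -gjms_const_sym muln0; congr gjms_const; rewrite -[l.+2]addn1 natrD; ring.
  - rewrite -map_comp; apply: eq_map => j /=; congr gjms_const.
    by rewrite mulnS natrD -(addn2 l) natrD; ring.
  - by congr gjms_const; rewrite -(addn2 l) -(addn1 l) mulnDr !natrD natrM; ring.
rewrite map_cat /= -cat1s perm_catC -catA perm_cat2r.
exact: IH (ltnW lm).
Qed.

(** Up to the scalar [chain_coef l m], the coefficient of the power k/2 - l + 2 m of [sinh_inv] in
    the exact solution. Each new constant is the one that [laplacian_sinh_pow] gives at the exponent
    k/2 - l + 2 m'. *)
Fixpoint gjms_chain (l m : nat) f : S -> R :=
  if m is m'.+1 then N (gjms_const ((2 * m')%:R - l%:R + 1)) (gjms_chain l m' f) else f.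

Lemma smooth_gjms_chain l m f : smooth_fun f -> smooth_fun (gjms_chain l m f).
Proof. by move=> sf; elim: m => //= m IH; exact: smooth_fun_neg_laplacian. Qed.

Lemma gjms_chainE l f : smooth_fun f -> gjms_chain l l f =
  (\big[comp/id]_(1 <= j < l.+1) N (gjms_const j%:R)) f.
Proof.
move=> sf; transitivity (op_chain [seq gjms_const j%:R | j <- iota 1 l] f).
  rewrite -(op_chain_perm sf (stepped_perm l)).
  (* [gjms_chain] applies the constant of index 0 first, whereas [op_chain] applies the head of the
     list last. *)
  have -> : op_chain (stepped l) f = op_chain (rev (stepped l)) f.
    by apply: op_chain_perm => //; rewrite perm_sym perm_rev.
  rewrite /stepped; move: {2 4}l => m.
  elim: m => [//|m IH]; have -> : iota 0 m.+1 = iota 0 m ++ [:: m].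
    by rewrite -[in LHS](addn1 m) iotaD.
  by rewrite map_cat rev_cat /= IH.
rewrite unlock /index_iota subn1 /=; elim: (iota 1 l) => //= j t IH.
by rewrite IH.
Qed.

End OperatorProduct.

(** * Explicit solutions of both extension problems and their leading defects *)

Section ExactExtensions.
Context {R : realType} {k : nat} {S : smooth_space R k} {e : {posnum R}}.
Notation restr V := (@interior_restr R k S e V).
Notation smooth_int := (@smooth_interior R k S e).
Notation smooth_bd := (@smooth_to_boundary R k S e).
Implicit Types (f : S -> R) (p : S) (q : cyl S e).

Variables (h : riem_metric S) (hp : riem_metric (cyl S e)) (lambda : R).
Hypothesis conf_gt0 : forall r, 0 <= r < e%:num -> 0 < conf lambda r.
Hypothesis hpE : forall (phi : chart R k S) x r, atlas phi -> cimg phi x -> itv0 e r ->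
  hp (cyl_chart e phi) (row_mx x r%:M : 'rV[R]_(k + 1)) =
    block_mx ((conf lambda r ^+ 2 / r ^+ 2) *: h phi x) 0 0 (r ^- 2)%:M.
Notation sinh_inv := (sinh_inv lambda).
Notation chain := (gjms_chain h lambda).

Lemma laplacian_int_sum m (V : nat -> S -> R -> R) q : (forall i, smooth_int (V i)) ->
  laplacian hp (restr (fun p r => \sum_(0 <= i < m) V i p r)) q =
  \sum_(0 <= i < m) laplacian hp (restr (V i)) q.
Proof.
move=> sV; have := laplacian_sum hp m (fun=> 1) q (fun i => smooth_fun_restr (sV i)).
rewrite (eq_bigr (fun i => laplacian hp (restr (V i)) q)); last by move=> i _; rewrite mul1r.
move=> <-; congr (laplacian hp _ q); apply/funext => q'.
by apply: eq_bigr => i _; rewrite mul1r.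
Qed.

Lemma laplacian_intD (V W : S -> R -> R) q : smooth_int V -> smooth_int W ->
  laplacian hp (restr (fun p r => V p r + W p r)) q =
  laplacian hp (restr V) q + laplacian hp (restr W) q.
Proof.
move=> sV sW; have := laplacian_lin hp 1 1 q (smooth_fun_restr sV) (smooth_fun_restr sW).
rewrite !mul1r => <-; congr (laplacian hp _ q); apply/funext => q'.
by rewrite !mul1r.
Qed.

(** Each factor is minus the indicial value at the exponent k/2 - l + 2 (i + 1). The product is
    nonzero for m < l, the range in which it is inverted. *)
Definition chain_norm (l m : nat) : R := \prod_(i < m) (4 * i.+1%:R * (l%:R - i.+1%:R)).

Definition chain_coef (l m : nat) : R := (-1) ^+ m / chain_norm l m.

Lemma chain_norm_neq0 l m : (m < l)%N -> chain_norm l m != 0.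
Proof.
move=> ml; apply/prodf_neq0 => i _; rewrite !mulf_neq0 ?pnatr_eq0// subr_eq0 eqr_nat.
by rewrite gtn_eqF// (leq_trans _ ml)// ltnS ltn_ord.
Qed.

Definition gjms_terms l f (m : nat) : S -> R -> R := fun p r =>
  sinh_inv r `^ (k%:R / 2 - l%:R + (2 * m)%:R) * (chain_coef l m * chain l m f p).

Lemma smooth_fun_scale (c : R) f : smooth_fun f -> smooth_fun (fun p => c * f p).
Proof.
move=> sf; have := smooth_fun_comb c 0 sf (smooth_fun_cst 0); congr smooth_fun.
by apply/funext => p; rewrite mul0r addr0.
Qed.

Lemma smooth_int_terms l f m : smooth_fun f -> smooth_int (gjms_terms l f m).
Proof.
move=> sf; apply: smooth_intM; first exact: smooth_int_sinh_pow.
apply/smooth_bd_interior/smooth_bd_fun/smooth_fun_scale; exact: smooth_gjms_chain.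
Qed.

(** A term reproduces itself with the indicial factor, which is zero for m = 0, and feeds the next
    exponent through [gjms_chain] at m + 1. The next coefficient is chosen to cancel this second
    part. *)
Lemma gjms_term_defect l f m q : smooth_fun f ->
  laplacian hp (restr (gjms_terms l f m)) q
    + ((k%:R / 2) ^+ 2 - l%:R ^+ 2) * restr (gjms_terms l f m) q =
  - (4 * m%:R * (l%:R - m%:R)) * restr (gjms_terms l f m) q
  - chain_coef l m * (sinh_inv (\val q.2) `^ (k%:R / 2 - l%:R + (2 * m)%:R + 2)
      * chain l m.+1 f q.1).
Proof.
move=> sf; have sc := smooth_gjms_chain h lambda l m sf.
rewrite (laplacian_sinh_pow conf_gt0 hpE _ q (smooth_fun_scale (chain_coef l m) sc)).
have -> : laplacian h (fun p => chain_coef l m * chain l m f p) q.1 =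
    chain_coef l m * laplacian h (chain l m f) q.1.
  have E := laplacian_lin h (chain_coef l m) 0 q.1 sc (smooth_fun_cst 0).
  rewrite !mul0r addr0 in E; rewrite -E; congr (laplacian h _ q.1).
  by apply/funext => p'; ring.
rewrite /interior_restr /gjms_terms [chain l m.+1 f]/= /neg_laplacian_plus /gjms_const natrM.
move: (sinh_inv _ `^ (_ + 2)) => y; move: (sinh_inv _ `^ _) => x.
move: (chain_coef l m) (laplacian h _ _) (chain l m f q.1) (k%:R : R) => c L a K.
by move: (m%:R : R) (l%:R : R) => M LL; field.
Qed.

Lemma gjms_partial_sum l f m q : smooth_fun f -> (m < l)%N ->
  \sum_(0 <= i < m.+1) (laplacian hp (restr (gjms_terms l f i)) q
    + ((k%:R / 2) ^+ 2 - l%:R ^+ 2) * restr (gjms_terms l f i) q) =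
  - chain_coef l m * (sinh_inv (\val q.2) `^ (k%:R / 2 - l%:R + (2 * m)%:R + 2)
      * chain l m.+1 f q.1).
Proof.
move=> sf; elim: m => [|m IH] ml.
  by rewrite big_nat1 gjms_term_defect// mulr0 mul0r oppr0 mul0r add0r mulNr.
rewrite big_nat_recr// -[LHS]/(_ + _) IH ?(ltnW ml)// gjms_term_defect// /interior_restr /gjms_terms.
have -> : k%:R / 2 - l%:R + (2 * m.+1)%:R = k%:R / 2 - l%:R + (2 * m)%:R + 2 :> R.
  by rewrite mulnS natrD; ring.
(* This recursion is what makes consecutive terms telescope. *)
have E : 4 * m.+1%:R * (l%:R - m.+1%:R) * chain_coef l m.+1 = - chain_coef l m.
  rewrite /chain_coef /chain_norm big_ord_recr /= -/(chain_norm l m) exprS.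
  have n0 := chain_norm_neq0 (ltnW ml).
  have m0 : (m.+1%:R : R) != 0 by rewrite pnatr_eq0.
  have l0 : (l%:R - m.+1%:R : R) != 0 by rewrite subr_eq0 eqr_nat gtn_eqF.
  move: (chain_norm l m) (m.+1%:R : R) (l%:R - m.+1%:R : R) n0 m0 l0 ((-1 : R) ^+ m) => a b c a0 b0 c0 s.
  by field; rewrite a0 b0 c0.
rewrite -E; move: (_ `^ _) (_ `^ _) (chain_coef l m.+1) (chain l m.+1 f q.1) (chain l m.+2 f q.1).
by move=> x y c a b; ring.
Qed.

(** The factors l + 1 - (i + 1) run down from l; the induction multiplies by (l - m)! to complete
    their partial products to l! without division. *)
Lemma chain_norm_fact l : chain_norm l.+1 l = 2 ^+ (2 * l) * (l`!)%:R ^+ 2.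
Proof.
have E m : (m <= l)%N -> \prod_(i < m) (4 * i.+1%:R * (l.+1%:R - i.+1%:R)) *
   ((l - m)`!)%:R = 2 ^+ (2 * m) * (m`!)%:R * (l`!)%:R :> R.
  elim: m => [|m IH] ml; first by rewrite big_ord0 subn0 muln0 expr0 fact0 !mul1r.
  rewrite big_ord_recr /= factS natrM mulnS exprD.
  have H := IH (ltnW ml); have lmE : (l - m = (l - m.+1).+1)%N by rewrite subnSK.
  rewrite lmE factS natrM -lmE natrB ?(ltnW ml)// in H.
  have -> : l.+1%:R - m.+1%:R = l%:R - m%:R :> R by rewrite -!natr1; ring.
  move: H; move: (\prod_(i < m) _) (((l - m.+1)`!)%:R : R) (l%:R - m%:R : R) => P F d H.
  have -> : P * (4 * m.+1%:R * d) * F = 4 * m.+1%:R * (P * (d * F)) by ring.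
  by rewrite H; ring.
have := E l (leqnn _); rewrite subnn fact0 mulr1 -/(chain_norm l.+1 l) => ->.
by rewrite expr2 mulrA.
Qed.

Lemma gjms_coefE l : gjms_coef l.+1 = - chain_coef l.+1 l :> R.
Proof.
rewrite /gjms_coef /chain_coef chain_norm_fact /= exprS mulN1r !invfM invrN invr_sign.
by rewrite !mulNr !mulrA.
Qed.

(* [r^(k/2 - l) gjms_solution] is the sum of the [gjms_terms], hence annihilated
   up to the single term of order [k/2 + l] computed in [gjms_partial_sum]. *)
Definition gjms_solution l f : S -> R -> R := fun p r =>
  conf lambda r `^ (l%:R - k%:R / 2) *
  \sum_(0 <= m < l) (sinh_inv r ^+ 2) ^+ m * (chain_coef l m * chain l m f p).

Lemma smooth_gjms_solution l f : smooth_fun f -> smooth_bd (gjms_solution l f).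
Proof.
move=> sf; apply: smooth_bdM.
  apply: smooth_bd_powR; first by move=> _; exact: conf_gt0.
  exact: smooth_bd_conf.
apply: (@smooth_bd_sum R k S e l (fun m p r => (sinh_inv r ^+ 2) ^+ m * (chain_coef l m * chain l m f p))) => m.
apply: smooth_bdM; last exact/smooth_bd_fun/smooth_fun_scale/smooth_gjms_chain.
exact: (smooth_bdX _ (smooth_bdX 2 (smooth_bd_sinh_inv conf_gt0))).
Qed.

Lemma sinh_inv0 : sinh_inv 0 = 0.
Proof. by rewrite /sinh_inv mul0r. Qed.

Lemma gjms_solution0 l f p : gjms_solution l.+1 f p 0 = f p.
Proof.
rewrite /gjms_solution conf0 powR1 mul1r big_nat_recl// big1 => [|m _].
  by rewrite expr0 mul1r addr0 /chain_coef /chain_norm big_ord0 expr0 divr1 mul1r.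
by rewrite sinh_inv0 expr0n /= expr0n mul0r.
Qed.

(** The power of conf in [gjms_solution] turns r^(k/2 - l) into a power of [sinh_inv]. The exponents
    left over are even naturals, which is why the solution is smooth up to r = 0. *)
Lemma gjms_solutionE l f p r : itv0 e r ->
  r `^ (k%:R / 2 - l%:R) * gjms_solution l f p r = \sum_(0 <= m < l) gjms_terms l f m p r.
Proof.
move=> re; have S0 := sinh_inv_gt0 conf_gt0 re; have r0 : 0 < r by case/andP: re.
have c0 : 0 < conf lambda r by apply: conf_gt0; case/andP: re => /ltW -> ->.
have E : r `^ (k%:R / 2 - l%:R) * conf lambda r `^ (l%:R - k%:R / 2) =
    sinh_inv r `^ (k%:R / 2 - l%:R).
  rewrite /sinh_inv powRM ?invr_ge0 ?(ltW r0) ?(ltW c0)//; congr (_ * _).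
  by rewrite -(powR_inv1 (ltW c0)) -powRrM mulN1r opprB.
rewrite /gjms_solution mulrA E mulr_sumr; apply: eq_bigr => m _.
rewrite /gjms_terms mulrA; congr (_ * _).
have C : (k%:R / 2 - l%:R + (2 * m)%:R == 0 :> R) ==> (sinh_inv r != 0).
  by rewrite (gt_eqF S0) implybT.
by rewrite (powRD C) (powR_mulrn _ (ltW S0)) -exprM.
Qed.

Lemma gjms_solution_defect l f q : smooth_fun f ->
  laplacian hp (restr (fun p r => r `^ (k%:R / 2 - l.+1%:R) * gjms_solution l.+1 f p r)) q
    + ((k%:R / 2) ^+ 2 - l.+1%:R ^+ 2)
      * (\val q.2 `^ (k%:R / 2 - l.+1%:R) * restr (gjms_solution l.+1 f) q) =
  sinh_inv (\val q.2) `^ (k%:R / 2 + l.+1%:R) * (gjms_coef l.+1 * chain l.+1 l.+1 f q.1).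
Proof.
move=> sf.
have -> : restr (fun p r => r `^ (k%:R / 2 - l.+1%:R) * gjms_solution l.+1 f p r) =
    restr (fun p r => \sum_(0 <= m < l.+1) gjms_terms l.+1 f m p r).
  by apply/funext => q'; exact: gjms_solutionE (val_itv0 q').
rewrite laplacian_int_sum; last by move=> m; exact: smooth_int_terms.
have -> : \val q.2 `^ (k%:R / 2 - l.+1%:R) * restr (gjms_solution l.+1 f) q =
    \sum_(0 <= m < l.+1) restr (gjms_terms l.+1 f m) q.
  exact: gjms_solutionE (val_itv0 q).
rewrite mulr_sumr -big_split gjms_partial_sum// gjms_coefE mulrCA.
by congr (_ `^ _ * _); rewrite natrM -natr1; ring.
Qed.

(* The coefficients [log_coef l m] of [sinh_inv ^ (2 m + 2)] correct [ln sinh_inv];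
   [log_const l m] is the coefficient of the one term left after [m] corrections. *)
Definition log_const (l m : nat) : R :=
  (1 - k%:R) * lambda * \prod_(i < m) (lambda * (2 * i.+1%:R + 1 - k%:R) / (2 * (l%:R - i.+1%:R))).

Definition log_coef (l m : nat) : R := log_const l m / (4 * m.+1%:R * (l%:R - m.+1%:R)).

Definition log_term (l m : nat) : S -> R -> R := fun p r =>
  sinh_inv r `^ (2 * m.+1%:R) * log_coef l m.

Lemma smooth_int_log_term l m : smooth_int (log_term l m).
Proof.
apply: smooth_intM; first exact: smooth_int_sinh_pow.
exact/smooth_bd_interior/smooth_bd_cst.
Qed.

(** For k = 2 l the exponent sigma = 2 (m + 1) has indicial value - 4 (m + 1) (l - m - 1), so adding
    [log_coef] times that power cancels the remaining term. Its second part, with factor lambda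
    sigma (sigma + 1 - k), produces the next factor of [log_const]. *)
Lemma log_partial_sum l m q : k%:R = 2 * l%:R :> R -> (m < l)%N ->
  laplacian hp (restr (fun p r => ln (sinh_inv r))) q + k%:R
    + \sum_(0 <= i < m) laplacian hp (restr (log_term l i)) q =
  log_const l m * sinh_inv (\val q.2) `^ (2 * m.+1%:R).
Proof.
move=> kl; have S0 := sinh_inv_gt0 conf_gt0 (val_itv0 q).
elim: m => [|m IH] ml.
  rewrite big_nil addr0 (laplacian_ln_sinh conf_gt0 hpE) /log_const big_ord0 !mulr1.
  by rewrite -(powR_mulrn 2 (ltW S0)).
rewrite big_nat_recr// -[X in _ + X = _]/(_ + _) addrA IH ?(ltnW ml)//.
rewrite (laplacian_sinh_pow conf_gt0 hpE _ q (smooth_fun_cst (log_coef l m))) laplacian_cst add0r.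
have -> : 2 * m.+1%:R + 2 = 2 * m.+2%:R :> R by rewrite -(natr1 m.+1); ring.
have m0 : (m.+1%:R : R) != 0 by rewrite pnatr_eq0.
have l0 : (l%:R - m.+1%:R : R) != 0 by rewrite subr_eq0 eqr_nat gtn_eqF.
rewrite /log_coef /log_const big_ord_recr /=.
move: (\prod_(i < m) _) (_ `^ _) (_ `^ _) => P x y.
rewrite kl; move: (m.+1%:R : R) (l%:R : R) m0 l0 => M L M0 L0.
by field; rewrite M0 L0.
Qed.

Definition log_solution (l : nat) : S -> R -> R := fun p r =>
  - ln (conf lambda r) + \sum_(0 <= m < l) (sinh_inv r ^+ 2) ^+ m.+1 * log_coef l.+1 m.

Lemma smooth_log_solution l : smooth_bd (log_solution l).
Proof.
apply: smooth_bdD.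
  have := smooth_bdM (smooth_bd_cst (-1)) (smooth_bd_ln (fun (p : S) => conf_gt0) (@smooth_bd_conf R k S e lambda)).
  by apply: smooth_bd_eq => p r _; rewrite mulN1r.
apply: (@smooth_bd_sum R k S e l (fun m p r => (sinh_inv r ^+ 2) ^+ m.+1 * log_coef l.+1 m)) => m.
apply: smooth_bdM; last exact: smooth_bd_cst.
exact: (smooth_bdX _ (smooth_bdX 2 (smooth_bd_sinh_inv conf_gt0))).
Qed.

Lemma log_solution0 l p : log_solution l p 0 = 0.
Proof.
rewrite /log_solution conf0 ln1 oppr0 add0r big1// => m _.
by rewrite sinh_inv0 !expr0n mul0r.
Qed.

Lemma log_solution_defect l q : k%:R = 2 * l.+1%:R :> R ->
  laplacian hp (restr (fun p r => ln r + log_solution l p r)) q + k%:R =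
  log_const l.+1 l * sinh_inv (\val q.2) `^ k%:R.
Proof.
move=> kl; have := log_partial_sum q kl (ltnSn l); rewrite -kl => <-.
have -> : restr (fun p r => ln r + log_solution l p r) =
    restr (fun p r => ln (sinh_inv r) + \sum_(0 <= m < l) log_term l.+1 m p r).
  apply/funext => q'; rewrite /interior_restr /log_solution addrA.
  have re := val_itv0 q'; move: (\val q'.2) re => r re; case/andP: (re) => r0 re'.
  have c0 : 0 < conf lambda r by apply: conf_gt0; rewrite ltW.
  congr (_ + _); first by rewrite /sinh_inv ln_div.
  apply: eq_bigr => m _; rewrite /log_term -exprM.
  by rewrite -natrM (powR_mulrn _ (ltW (sinh_inv_gt0 conf_gt0 re))).
rewrite laplacian_intD; [|exact: smooth_int_ln_sinh| ]; last first.
  move=> phi aphi.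
  exact: (smooth_on_sum (index_iota 0 l) xpredT (@chart_cyl_open _ _ _ e phi)
    (fun m => smooth_int_log_term l.+1 m aphi)).
rewrite laplacian_int_sum; last by move=> m; exact: smooth_int_log_term.
by rewrite addrAC.
Qed.

Lemma fact_double_odd l : ((2 * l).+1)`!%:R = (\prod_(i < l.+1) (2 * i%:R + 1)) * (2 ^+ l * l`!%:R) :> R.
Proof.
elim: l => [|l IH]; first by rewrite big_ord1 muln0 expr0 !mulr0 !fact0 add0r !mulr1.
rewrite mulnS [in LHS]factS natrM [in LHS]factS natrM IH [in RHS]big_ord_recr /= exprS factS natrM.
move: (\prod_(i < l.+1) (2 * i%:R + 1) : R) (2 ^+ l : R) (l`!%:R : R) => P x y.
have -> : (2 + 2 * l)%:R = 2 * l.+1%:R :> R by rewrite natrD natrM -natr1; ring.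
have -> : (2 + 2 * l).+1%:R = 2 * l.+1%:R + 1 :> R by rewrite -natr1 natrD natrM -(natr1 l); ring.
by ring.
Qed.

Lemma prod_double_odd l : \prod_(j < l) (- lambda * (2 * j%:R + 1) / (2 * j.+1%:R)) =
  (- lambda) ^+ l * (\prod_(i < l) (2 * i%:R + 1)) / (2 ^+ l * l`!%:R) :> R.
Proof.
elim: l => [|l IH]; first by rewrite !big_ord0 !expr0 fact0 !mul1r invr1.
rewrite big_ord_recr /= IH big_ord_recr /= !exprS factS natrM.
have f0 := @fact_neq0 R l; have m0 : (l.+1%:R : R) != 0 by rewrite pnatr_eq0.
have x0 : (2 ^+ l : R) != 0 by rewrite expf_neq0.
move: (l`!%:R : R) (l.+1%:R : R) (2 ^+ l : R) f0 m0 x0 => a b c a0 b0 c0.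
by field; rewrite a0 b0 c0.
Qed.

(** The odd numbers up to k - 1 appear in the numerator over 2^l l!. Multiplying both by 2^l l!
    completes the odd product to (k - 1)! ([fact_double_odd]) and the denominator to the one in
    [gjms_coef]. *)
Lemma log_constE l : k = (2 * l.+1)%N ->
  log_const l.+1 l = gjms_coef l.+1 * (lambda ^+ l.+1 * (k.-1)`!%:R).
Proof.
move=> kE; have -> : (k.-1 = (2 * l).+1)%N by rewrite kE mulnS.
have kR : k%:R = 2 * l.+1%:R :> R by rewrite kE natrM.
have -> : log_const l.+1 l = (1 - k%:R) * lambda *
    \prod_(j < l) (- lambda * (2 * j%:R + 1) / (2 * j.+1%:R)).
  (* With i = l - 1 - j and k = 2 (l + 1), the numerator 2 (i + 1) + 1 - k becomes - (2 j + 1), and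
     l + 1 - (i + 1) becomes j + 1. *)
  congr (_ * _); rewrite (reindex_inj rev_ord_inj); apply: eq_bigr => j _ /=.
  have jl : (j < l)%N by [].
  rewrite subnSK// (natrB _ (ltnW jl)) kR -!natr1.
  by congr (_ / _); ring.
rewrite prod_double_odd fact_double_odd gjms_coefE /chain_coef chain_norm_fact [in RHS]big_ord_recr /= kR -(natr1 l).
have f0 := @fact_neq0 R l; have x0 : (2 ^+ l : R) != 0 by rewrite expf_neq0.
have -> : (- lambda) ^+ l = (-1) ^+ l * lambda ^+ l by exact: exprNn.
rewrite [2 ^+ (2 * l)]exprM -[2 ^+ 2]/(2 * 2) exprMn [lambda ^+ l.+1]exprS expr2.
move: (l`!%:R : R) (2 ^+ l : R) f0 x0 => a c a0 c0.
move: ((-1) ^+ l : R) (lambda ^+ l) (\prod_(i < l) (2 * i%:R + 1) : R) (l%:R : R) => s x P L.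
by field; rewrite a0 c0.
Qed.

End ExactExtensions.

(** * General defining functions *)

Section DefiningFunction.
Context {R : realType} {k : nat} {S : smooth_space R k} {e : {posnum R}}.
Notation tb p := (@toward_boundary R k S e p).
Notation smooth_bd := (@smooth_to_boundary R k S e).
Notation restr V := (@interior_restr R k S e V).
Notation smooth_int := (@smooth_interior R k S e).
Implicit Types (V W : S -> R -> R) (p : S) (q : cyl S e).

Variables (h : riem_metric S) (hp : riem_metric (cyl S e)) (lambda : R).
Hypothesis conf_gt0 : forall r, 0 <= r < e%:num -> 0 < conf lambda r.
Hypothesis hpE : forall (phi : chart R k S) x r, atlas phi -> cimg phi x -> itv0 e r ->
  hp (cyl_chart e phi) (row_mx x r%:M : 'rV[R]_(k + 1)) =
    block_mx ((conf lambda r ^+ 2 / r ^+ 2) *: h phi x) 0 0 (r ^- 2)%:M.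

Lemma tb_cvg_near p (f g : cyl S e -> R) (a : R) : (\forall q \near tb p, f q = g q) ->
  f q @[q --> tb p] --> a -> g q @[q --> tb p] --> a.
Proof. by move=> fg fa; apply: cvg_trans fa; exact: near_eq_cvg. Qed.

Lemma metric_diag_gt0 phi p (i : 'I_k) : atlas phi -> cdom phi p ->
  0 < h phi (cmap phi p) i i.
Proof.
move=> aphi dp; have px : cimg phi (cmap phi p) by exists p.
have d0 : (delta_mx 0 i : 'rV[R]_k) != 0.
  by apply/eqP => /rowP /(_ i); rewrite !mxE !eqxx => /eqP; rewrite oner_eq0.
have := @metric_pos _ _ _ h phi _ aphi px _ d0.
by rewrite trmx_delta -rowE -colE !mxE.
Qed.

Lemma cvg_metric phi p (i j : 'I_k) : atlas phi -> cdom phi p ->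
  h phi (cmap phi q.1) i j @[q --> tb p] --> h phi (cmap phi p) i j.
Proof.
move=> aphi dp; have px : cimg phi (cmap phi p) by exists p.
have C := smooth_on_continuous (@metric_smooth _ _ _ h phi aphi i j) px.
move=> B nB; have nA : nbhs (cmap phi p) [set x : 'rV[R]_k | B (h phi x i j)] by exact: C.
have nW : nbhs p [set p' | B (h phi (cmap phi p') i j)] by exact: (cmap_continuous dp nA).
exists [set pr : S * R | B (h phi (cmap phi pr.1) i j)]; last by [].
by exists ([set p' | B (h phi (cmap phi p') i j)], setT) => [|pr []] //=; split=> //; exact: filterT.
Qed.

Variable rho : S -> R -> R.
Hypotheses (k0 : (0 < k)%N) (hrho : defining_function hp h rho).

Lemma smooth_rho_quot : smooth_bd (bd_quot rho).
Proof. by case: hrho => sr r0 _ _ _; exact: smooth_bd_quot. Qed.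

Lemma rho_quotE q : restr rho q = \val q.2 * restr (bd_quot rho) q.
Proof. by rewrite /interior_restr bd_quotE ?gt_eqF ?val_gt0// mulrC divfK// gt_eqF ?val_gt0. Qed.

Lemma rho_quot_gt0 q : 0 < restr (bd_quot rho) q.
Proof.
case: hrho => _ _ /(_ q) + _ _; rewrite rho_quotE pmulr_rgt0//; exact: val_gt0.
Qed.

(* [rho^2 h_+] restricts to [h] on the boundary, which forces [rho = r + O(r^2)]. *)
Lemma rho_quot0 p : bd_quot rho p 0 = 1.
Proof.
have cw := smooth_bd_cvg (p := p) smooth_rho_quot.
(* A limit of positive values; it selects the root 1 of w^2 = 1 at the end. *)
have w0 : 0 <= bd_quot rho p 0.
  rewrite leNgt; apply/negP => w0.
  have N : \forall q \near tb p, restr (bd_quot rho) q < 0 by exact: (cvgr_lt _ cw).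
  have [q] := filter_ex N; rewrite ltNge => /negP; apply; exact/ltW/rho_quot_gt0.
(* In the product chart rho^2 h_+ is w^2 conf^2 h on directions tangent to Sigma, so one diagonal
   component of h, positive and available since k >= 1, gives w^2 = 1 on the boundary. *)
have [phi aphi dp] := atlas_cover p; pose i := Ordinal k0.
case: hrho => _ _ _ _ /(_ phi p aphi dp i i) lim1.
have h0 := metric_diag_gt0 i aphi dp.
have lim2 := tb_cvgM (tb_cvgM (tb_cvgX (m := 2) cw) (tb_cvgX (m := 2) (cvg_conf lambda p)))
  (cvg_metric (i := i) (j := i) aphi dp).
have E : bd_quot rho p 0 ^+ 2 * 1 ^+ 2 * h phi (cmap phi p) i i = h phi (cmap phi p) i i.
  apply: (tb_cvg_unique _ lim1); apply: tb_cvg_near lim2.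
  apply: filterS (near_toward_boundary dp ltr01) => q [dq _ _].
  have pq : cimg phi (cmap phi q.1) by exists q.1.
  have re := val_itv0 q; rewrite rho_quotE /cyl_map (hpE aphi pq re) block_mxKul [in RHS]mxE.
  rewrite /interior_restr; case/andP: re => /lt0r_neq0 r0 _; move: (\val q.2) r0 => r r0.
  by move: (bd_quot _ _ _) (conf _ _) (h phi _ _ _) => a b c; field.
have : bd_quot rho p 0 ^+ 2 == 1.
  by rewrite -(inj_eq (mulIf (lt0r_neq0 h0))) mul1r -[X in _ == X]E expr1n mulr1.
by rewrite sqrp_eq1// => /eqP.
Qed.

Lemma rho_quot_bd_gt0 p r : 0 <= r < e%:num -> 0 < bd_quot rho p r.
Proof.
move=> /andP[]; rewrite le_eqVlt => /predU1P[<- _|r0 re]; first by rewrite rho_quot0.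
have rr : itv0 e r by apply/andP.
by have := rho_quot_gt0 (p, to_itv0 e r); rewrite /interior_restr /= val_to_itv0.
Qed.

End DefiningFunction.

Section Operators.
Context {R : realType} {k : nat} {S : smooth_space R k} {e : {posnum R}}.
Notation tb p := (@toward_boundary R k S e p).
Notation smooth_bd := (@smooth_to_boundary R k S e).
Notation restr V := (@interior_restr R k S e V).
Notation smooth_int := (@smooth_interior R k S e).
Implicit Types (V W : S -> R -> R) (E : cyl S e -> R) (v : S -> R) (p : S) (q : cyl S e).

Lemma bigO_scale (V W : S -> R -> R) (s : R) (u : cyl S e -> R) E :
  (forall q, restr V q `^ s = restr W q `^ s * u q) ->
  (forall p, u q @[q --> tb p] --> (1 : R)) -> boundary_bigO V s E -> boundary_bigO W s E.
Proof.
(* The absolute value covers a negative C, and the factor 2 bounds u near the boundary, where it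
   tends to 1. *)
move=> VW u1 bE p; have [C bC] := bE p; exists (`|C| * 2).
have N : \forall q \near tb p, u q < 2 by apply: (cvgr_lt _ (u1 p)); rewrite ltr1n.
apply: filterS2 bC N => q bq uq; apply: (le_trans bq).
apply: (@le_trans _ _ (`|C| * restr V q `^ s)); first by rewrite ler_wpM2r ?ler_norm ?powR_ge0.
by rewrite -mulrA ler_wpM2l// VW mulrC ler_wpM2r ?powR_ge0// ltW.
Qed.

Notation bd_r := (fun (_ : S) (r : R) => r).

Lemma bigO_of_value (s : R) E v :
  boundary_value (fun q => \val q.2 `^ (- s) * E q) v -> boundary_bigO bd_r s E.
Proof.
move=> Ev p; exists (`|v p| + 1).
have N : \forall q \near tb p, `|\val q.2 `^ (- s) * E q| < `|v p| + 1.
  by apply: (cvgr_norm_lt _ (Ev p)); rewrite ltrDl.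
apply: filterS N => q; have x0 : 0 < \val q.2 `^ s by rewrite powR_gt0// val_gt0.
rewrite powRN normrM gtr0_norm ?invr_gt0// -ltr_pdivlMl ?invr_gt0// invrK mulrC => /ltW.
exact.
Qed.

Lemma bigO_sub (V : S -> R -> R) (s : R) E1 E2 : boundary_bigO V s E1 ->
  boundary_bigO V s E2 -> boundary_bigO V s (fun q => E1 q - E2 q).
Proof.
move=> b1 b2 p; have [C1 c1] := b1 p; have [C2 c2] := b2 p; exists (C1 + C2).
apply: filterS2 c1 c2 => q l1 l2; rewrite mulrDl.
exact: le_trans (ler_normB _ _) (lerD l1 l2).
Qed.

Variables (h : riem_metric S) (hp : riem_metric (cyl S e)) (lambda : R).
Hypothesis conf_gt0 : forall r, 0 <= r < e%:num -> 0 < conf lambda r.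
Hypothesis hpE : forall (phi : chart R k S) x r, atlas phi -> cimg phi x -> itv0 e r ->
  hp (cyl_chart e phi) (row_mx x r%:M : 'rV[R]_(k + 1)) =
    block_mx ((conf lambda r ^+ 2 / r ^+ 2) *: h phi x) 0 0 (r ^- 2)%:M.

(* Two functions with defects of order [s + 2 l] and equal boundary data have
   the same obstruction. *)
Lemma value_transfer (l : nat) (s c : R) G E E0 v : smooth_bd G -> (forall p, G p 0 = 0) ->
  s * (s - k%:R) + c = 0 -> 2 * s - k%:R = - (2 * l%:R) ->
  (forall q, laplacian hp (restr (fun p r => r `^ s * G p r)) q
     + c * (\val q.2 `^ s * restr G q) = E q - E0 q) ->
  boundary_bigO bd_r (s + 2 * l%:R) E ->
  boundary_value (fun q => \val q.2 `^ (- (s + 2 * l%:R)) * E0 q) v ->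
  boundary_value (fun q => \val q.2 `^ (- (s + 2 * l%:R)) * E q) v.
Proof.
move=> sG G0 ind sl GE bE vE p.
have U := @obstruction_vanishing _ _ _ _ h hp lambda conf_gt0 hpE l s c G p sG G0 ind sl.
apply: (tb_cvg_eq _ _ (tb_cvgD (U _) (vE p))); last 2 first.
- by rewrite add0r.
- move=> p'; have [C bC] := bigO_sub bE (bigO_of_value vE) p'; exists C.
  by apply: filterS bC => q; rewrite GE.
by move=> q; rewrite GE -mulrDr subrK.
Qed.

(** The quotient of [sinh_inv] by r is 1 / conf, which tends to 1 at the boundary. *)
Lemma sinh_value (s : R) (a : S -> R) : smooth_fun a ->
  boundary_value (fun q => \val q.2 `^ (- s) * (sinh_inv lambda (\val q.2) `^ s * a q.1)) a.
Proof.
move=> sa p.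
have sc : smooth_bd (fun _ r => conf lambda r `^ (- s)).
  by apply: smooth_bd_powR; [move=> _; exact: conf_gt0|exact: smooth_bd_conf].
have := tb_cvgM (smooth_bd_cvg (p := p) sc) (smooth_bd_cvg (p := p) (smooth_bd_fun sa)).
rewrite conf0 powR1 mul1r; apply: tb_cvg_eq => // q.
have re := val_itv0 q; rewrite /interior_restr; move: (q.1) (\val q.2) re => p' r re.
have [r0 re'] := andP re; have c0 : 0 < conf lambda r by apply: conf_gt0; rewrite ltW.
rewrite mulrA; congr (_ * _); rewrite /sinh_inv powRM ?invr_ge0 ?ltW// mulrA.
rewrite [r `^ - s]powRN mulVf ?mul1r ?lt0r_neq0 ?powR_gt0//.
by rewrite -powR_inv1 ?ltW// -powRrM mulN1r.
Qed.

End Operators.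

(** * Existence and uniqueness of the obstruction for an arbitrary defining function *)

Section Determination.
Context {R : realType} {k : nat} {S : smooth_space R k} {e : {posnum R}}.
Notation tb p := (@toward_boundary R k S e p).
Notation smooth_bd := (@smooth_to_boundary R k S e).
Notation restr V := (@interior_restr R k S e V).
Notation bd_r := (fun (_ : S) (r : R) => r).
Implicit Types (E : cyl S e -> R) (v : S -> R) (p : S) (q : cyl S e).

Variables (h : riem_metric S) (hp : riem_metric (cyl S e)) (lambda : R).
Hypothesis conf_gt0 : forall r, 0 <= r < e%:num -> 0 < conf lambda r.
Hypothesis hpE : forall (phi : chart R k S) x r, atlas phi -> cimg phi x -> itv0 e r ->
  hp (cyl_chart e phi) (row_mx x r%:M : 'rV[R]_(k + 1)) =
    block_mx ((conf lambda r ^+ 2 / r ^+ 2) *: h phi x) 0 0 (r ^- 2)%:M.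
Variable rho : S -> R -> R.
Hypotheses (k0 : (0 < k)%N) (hrho : defining_function hp h rho).

Let w := bd_quot rho.
Let w_gt0 p r : 0 <= r < e%:num -> 0 < w p r := @rho_quot_bd_gt0 _ _ _ _ _ _ _ hpE _ k0 hrho p r.
Let sw : smooth_bd w := smooth_rho_quot hrho.
Let w0 p : w p 0 = 1 := @rho_quot0 _ _ _ _ _ _ _ hpE _ k0 hrho p.

Lemma smooth_rho_pow (s : R) : smooth_bd (fun p r => w p r `^ s).
Proof. exact: smooth_bd_powR w_gt0 sw. Qed.

Lemma cvg_rho_pow (s : R) p : restr w q `^ s @[q --> tb p] --> (1 : R).
Proof. by have := smooth_bd_cvg (p := p) (smooth_rho_pow s); rewrite w0 powR1. Qed.

Lemma rho_powE (s : R) q : restr rho q `^ s = \val q.2 `^ s * restr w q `^ s.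
Proof.
rewrite rho_quotE powRM ?(ltW (val_gt0 q))//; exact/ltW/(rho_quot_gt0 hrho).
Qed.

Lemma rho_quot_powN (s : R) q : restr w q `^ s * restr w q `^ (- s) = 1.
Proof. by rewrite powRN mulfV// lt0r_neq0// powR_gt0//; exact: (rho_quot_gt0 hrho). Qed.

Lemma bigO_rhoP (s : R) E : boundary_bigO rho s E <-> boundary_bigO bd_r s E.
Proof.
split.
  by apply: (bigO_scale (u := fun q => restr w q `^ s) (rho_powE s)) => p; exact: cvg_rho_pow.
apply: (bigO_scale (u := fun q => restr w q `^ (- s))) => [q|p]; last exact: cvg_rho_pow.
by rewrite rho_powE -mulrA rho_quot_powN mulr1.
Qed.

Lemma value_rho (s : R) E v : boundary_value (fun q => \val q.2 `^ s * E q) v ->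
  boundary_value (fun q => restr rho q `^ s * E q) v.
Proof.
move=> Ev p; apply: tb_cvg_eq (tb_cvgM (cvg_rho_pow s p) (Ev p)); last exact: mul1r.
by move=> q; rewrite rho_powE mulrA [X in X * _]mulrC.
Qed.

Lemma laplacian_addr_ext (u v : cyl S e -> R) (c : R) q : u =1 v ->
  laplacian hp u q + c = laplacian hp v q + c.
Proof. by move=> /funext ->. Qed.

Lemma gjms_defectE (l : nat) (F : S -> R -> R) q :
  gjms_defect hp rho l F q =
  laplacian hp (restr (fun p r => r `^ (k%:R / 2 - l%:R) * (w p r `^ (k%:R / 2 - l%:R) * F p r))) q
  + ((k%:R / 2) ^+ 2 - l%:R ^+ 2)
    * (\val q.2 `^ (k%:R / 2 - l%:R) * restr (fun p r => w p r `^ (k%:R / 2 - l%:R) * F p r) q).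
Proof.
rewrite /gjms_defect; set s := k%:R / 2 - l%:R.
have H q' : restr rho q' `^ s * restr F q' =
    \val q'.2 `^ s * restr (fun p r => w p r `^ s * F p r) q'.
  by rewrite rho_powE -mulrA.
by rewrite H; apply: laplacian_addr_ext => q'; exact: H.
Qed.

Lemma gjms_solution_value l f : smooth_fun f -> boundary_value
  (fun q => \val q.2 `^ (- (k%:R / 2 + l.+1%:R)) *
     (sinh_inv lambda (\val q.2) `^ (k%:R / 2 + l.+1%:R)
        * (gjms_coef l.+1 * gjms_chain h lambda l.+1 l.+1 f q.1)))
  (fun p => gjms_coef l.+1 * gjms_chain h lambda l.+1 l.+1 f p).
Proof.
move=> sf; apply: (sinh_value conf_gt0 (k%:R / 2 + l.+1%:R) (a := fun p => gjms_coef l.+1 * gjms_chain h lambda l.+1 l.+1 f p)).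
exact/smooth_fun_scale/smooth_gjms_chain.
Qed.

Lemma gjms_extension_exists l f : smooth_fun f -> exists F, gjms_extension hp rho l.+1 f F.
Proof.
move=> sf; set s := k%:R / 2 - l.+1%:R : R.
pose F p r := w p r `^ (- s) * gjms_solution h lambda l.+1 f p r.
have wF q : restr (fun p r => w p r `^ s * F p r) q = restr (gjms_solution h lambda l.+1 f) q.
  by rewrite /interior_restr /F mulrA rho_quot_powN mul1r.
exists F; split.
- exact: smooth_bdM (smooth_rho_pow _) (smooth_gjms_solution h conf_gt0 l.+1 sf).
- by move=> p; rewrite /F w0 powR1 mul1r gjms_solution0.
apply/bigO_rhoP; have := bigO_of_value (gjms_solution_value (l := l) sf).
congr (boundary_bigO _ _ _); apply/funext => q.
rewrite gjms_defectE -(gjms_solution_defect conf_gt0 hpE)// -/s wF.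
apply: laplacian_addr_ext => q'.
by congr (_ * _); exact/esym/wF.
Qed.

(** A competing extension F is compared with the exact solution after rewriting rho^s F as r^s (w^s
    F). The difference vanishes at r = 0 and has a defect of order k/2 + l, so [value_transfer]
    carries the value over. *)
Lemma gjms_operatorP l :
  is_gjms_operator hp rho l.+1 (fun f => gjms_chain h lambda l.+1 l.+1 f).
Proof.
move=> f sf; split; first exact: gjms_extension_exists.
move=> F [sF F0 bF]; set s := k%:R / 2 - l.+1%:R : R.
pose G p r := w p r `^ s * F p r + (-1) * gjms_solution h lambda l.+1 f p r.
have sol := smooth_gjms_solution h conf_gt0 l.+1 sf.
have swF : smooth_bd (fun p r => w p r `^ s * F p r) := smooth_bdM (smooth_rho_pow s) sF.
have sG : smooth_bd G := smooth_bdD swF (smooth_bdM (smooth_bd_cst (-1)) sol).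
have G0 p : G p 0 = 0 by rewrite /G w0 powR1 mul1r F0 gjms_solution0 mulN1r subrr.
(* The two indicial roots are k/2 - l and k/2 + l, with l here written [l.+1]. *)
have sE : s + 2 * l.+1%:R = k%:R / 2 + l.+1%:R by rewrite /s; ring.
have ind : s * (s - k%:R) + ((k%:R / 2) ^+ 2 - l.+1%:R ^+ 2) = 0 by rewrite /s; field.
have sl : 2 * s - k%:R = - (2 * l.+1%:R) by rewrite /s; field.
apply: value_rho.
have -> : - (k%:R / 2) - l.+1%:R = - (s + 2 * l.+1%:R) :> R by rewrite sE opprD.
apply: (value_transfer conf_gt0 hpE sG G0 ind sl (E0 := fun q =>
  sinh_inv lambda (\val q.2) `^ (k%:R / 2 + l.+1%:R)
        * (gjms_coef l.+1 * gjms_chain h lambda l.+1 l.+1 f q.1))).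
- move=> q; rewrite gjms_defectE -(gjms_solution_defect conf_gt0 hpE)// -/s.
  have rs := @smooth_int_rpow R k S e s.
  have := laplacian_lin hp 1 (-1) q
    (smooth_fun_restr (smooth_intM rs (smooth_bd_interior swF)))
    (smooth_fun_restr (smooth_intM rs (smooth_bd_interior sol))).
  rewrite mul1r mulN1r => L.
  have -> : restr (fun p r => r `^ s * G p r) = fun q =>
     1 * restr (fun p r => r `^ s * (w p r `^ s * F p r)) q
     + (-1) * restr (fun p r => r `^ s * gjms_solution h lambda l.+1 f p r) q.
    apply/funext => q'; rewrite /interior_restr /G.
    by move: (_ `^ s) (_ * F _ _) (gjms_solution _ _ _ _ _ _) => a b c; ring.
  rewrite L; have -> : restr G q = restr (fun p r => w p r `^ s * F p r) q
    - restr (gjms_solution h lambda l.+1 f) q by rewrite /interior_restr /G mulN1r.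
  by move: (laplacian _ _ _) (laplacian _ _ _) (restr _ _) (restr _ _) (_ `^ s) => a b c d x; ring.
- by rewrite sE; exact/bigO_rhoP.
- by rewrite sE; exact: gjms_solution_value.
Qed.

Lemma log_defectE (A : S -> R -> R) q : log_defect hp rho A q =
  laplacian hp (restr (fun p r => ln r + (ln (w p r) + A p r))) q + k%:R.
Proof.
rewrite /log_defect; apply: laplacian_addr_ext => q'.
rewrite [in LHS]rho_quotE lnM ?posrE ?val_gt0 ?(rho_quot_gt0 hrho)//.
by rewrite -addrA.
Qed.

Lemma log_solution_value l : boundary_value
  (fun q => \val q.2 `^ (- k%:R) * (log_const (k := k) lambda l.+1 l * sinh_inv lambda (\val q.2) `^ k%:R))
  (fun _ : S => log_const (k := k) lambda l.+1 l).
Proof.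
have := @sinh_value R k S e lambda conf_gt0 k%:R _ (smooth_fun_cst (log_const (k := k) lambda l.+1 l)).
by congr boundary_value; apply/funext => q; congr (_ * _); exact: mulrC.
Qed.

Lemma smooth_ln_rho : smooth_bd (fun p r => ln (w p r)).
Proof. exact: smooth_bd_ln w_gt0 sw. Qed.

Lemma critical_Q_curvatureP l : k = (2 * l.+1)%N ->
  is_critical_Q_curvature hp rho (fun _ => lambda ^+ l.+1 * (k.-1)`!%:R).
Proof.
move=> kl; have kR : k%:R = 2 * l.+1%:R :> R by rewrite kl natrM.
have sol : smooth_bd (log_solution (S := S) lambda l) := smooth_log_solution conf_gt0 l.
have solE q := log_solution_defect conf_gt0 hpE q kR.
split.
  exists (fun p r => log_solution (S := S) lambda l p r + (-1) * ln (w p r)); split.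
  - exact: smooth_bdD sol (smooth_bdM (smooth_bd_cst (-1)) smooth_ln_rho).
  - by move=> p; rewrite w0 ln1 mulr0 addr0 log_solution0.
  apply/bigO_rhoP; have := bigO_of_value (log_solution_value (l := l)).
  congr (boundary_bigO _ _ _); apply/funext => q; rewrite log_defectE -solE.
  apply: laplacian_addr_ext => q'; rewrite /interior_restr.
  by congr (_ + _); rewrite mulN1r addrC subrK.
move=> A [sA A0 bA].
pose G p r := ln (w p r) + A p r + (-1) * log_solution (S := S) lambda l p r.
have sG : smooth_bd G := smooth_bdD (smooth_bdD smooth_ln_rho sA) (smooth_bdM (smooth_bd_cst (-1)) sol).
have G0 p : G p 0 = 0 by rewrite /G w0 ln1 A0 log_solution0 mulr0 !addr0.
have sE : 0 + 2 * l.+1%:R = k%:R :> R by rewrite add0r kR.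
have kl2 : k./2 = l.+1 by rewrite kl mul2n doubleK.
rewrite kl2; have -> : (fun _ : S => gjms_coef l.+1 * (lambda ^+ l.+1 * (k.-1)`!%:R)) =
   fun _ => log_const (k := k) lambda l.+1 l.
  by apply/funext => _; rewrite log_constE.
apply: value_rho; rewrite -sE.
(* The logarithmic problem is compared with s = 0 and c = 0: the constant k and ln r cancel in the
   difference of two solutions, and the indicial roots are 0 and k. *)
have ind : 0 * (0 - k%:R) + 0 = 0 :> R by rewrite mul0r addr0.
have sl : 2 * 0 - k%:R = - (2 * l.+1%:R) :> R by rewrite mulr0 sub0r kR.
apply: (value_transfer conf_gt0 hpE sG G0 ind sl (E0 := fun q =>
  log_const (k := k) lambda l.+1 l * sinh_inv lambda (\val q.2) `^ k%:R)).
- move=> q; rewrite log_defectE -solE mul0r addr0.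
  have sl0 : @smooth_interior R k S e (fun p r => ln r + log_solution (S := S) lambda l p r).
    apply: smooth_intD (smooth_bd_interior sol).
    by apply: (smooth_int_ln _ (@smooth_int_r R k S e)) => p r /andP[].
  have -> : restr (fun p r => r `^ 0 * G p r) = restr G.
    by apply/funext => q'; rewrite /interior_restr powRr0 mul1r.
  have := laplacian_intD hp q sl0 (smooth_bd_interior sG).
  have -> : restr (fun p r => ln r + log_solution (S := S) lambda l p r + G p r) =
    restr (fun p r => ln r + (ln (w p r) + A p r)).
    apply/funext => q'; rewrite /interior_restr /G.
    by move: (log_solution _ _ _ _) (A _ _) (ln (w _ _)) (ln _) => a b c d; ring.
  move=> ->; move: (laplacian _ _ _) (laplacian _ _ _) => a b; ring.
- by rewrite sE; exact/bigO_rhoP.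
- by rewrite sE; exact: log_solution_value.
Qed.

End Determination.

Theorem theorem1p2 (R : realType) (n k : nat) (hn : (3 <= n)%N)
  (hk : (1 <= k <= n.-1)%N)
  (M : smooth_space R n) (hM : is_manifold M)
  (g : riem_metric M) (lambda : R) (hg : is_einstein g lambda)
  (S : smooth_space R k) (hS : is_manifold S)
  (iota : S -> M) (hiota : smooth_embedding iota) (hmin : is_minimal iota g)
  (e : {posnum R})
  (he : forall r : R, 0 <= r < e%:num -> 0 < 1 - lambda / 4 * r ^+ 2)
  (gp : riem_metric (cyl M e)) (hgp : canonical_poincare g lambda gp)
  (h : riem_metric S) (hh : is_induced_metric iota g h)
  (hp : riem_metric (cyl S e)) (hhp : is_induced_metric (cyl_lift iota) gp hp)
  (rho : S -> R -> R) (hrho : defining_function hp h rho) :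
  (forall l : nat, (1 <= l)%N ->
     is_gjms_operator hp rho l
       (\big[comp/id]_(1 <= j < l.+1)
          neg_laplacian_plus h
            (lambda * ((k%:R / 2 + j%:R - 1) * (k%:R / 2 - j%:R))))) /\
  (~~ odd k ->
     is_critical_Q_curvature hp rho
       (fun _ => lambda ^+ k./2 * (k.-1`!)%:R)).
Proof.
have [smi _ _ _] := hiota; have /andP[k0 _] := hk.
have hpE := induced_cylinder_metric smi hh hgp hhp.
split=> [[//|l] _ f sf|ek].
  have [ex val] := gjms_operatorP he hpE k0 hrho l sf.
  by rewrite -(gjms_chainE h lambda l.+1 sf).
have [l kl] : exists l, k = (2 * l.+1)%N.
  case: (k./2) (odd_double_half k) => [|l]; rewrite (negbTE ek) add0n => kl.
    by rewrite -kl in k0.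
  by exists l; rewrite mul2n kl.
have -> : k./2 = l.+1 by rewrite kl mul2n doubleK.
by have := critical_Q_curvatureP he hpE k0 hrho kl.
Qed.
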